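(* For $n\ge1$ let $\tau_n$ be a Cayley tree of size $n$ (a uniformly random tree with $n$ labelled vertices) and $T_n=\mathrm{Cut}(\tau_n)$ its cut-tree. Let $(\vartheta_n)_{n\ge0}$ be i.i.d. (unconditioned) Galton–Watson trees with offspring law Poisson$(1)$, and let $T_\infty$ be the tree obtained from an infinite branch by attaching, for each $n\ge0$, an independent cut-tree $\mathrm{Cut}(\vartheta_n)$ by an edge (joining its root) to the vertex of the branch at height $n$. Then $T_n$ converges to $T_\infty$ in distribution with respect to the local limit topology as $n\to\infty$.
   Context: Trees (other than the labelled trees being cut) are rooted, unordered, with finite numbers of children, identified up to root- and parent-preserving bijections. For an integer $R\ge0$, $t|_R$ is the subtree of vertices at graph distance at most $R$ from the root; the local limit topology is induced by $d_{\mathrm{loc}}(t,s)=\exp[-\inf\{R\ge0:t|_R\ne s|_R\}]$. Cut-tree of a finite (labelled) tree $\tau$: a random rooted binary unordered tree $\mathrm{Cut}(\tau)$ defined recursively. If $\tau$ has a single vertex, $\mathrm{Cut}(\tau)$ is the single-vertex tree. Otherwise pick an edge of $\tau$ uniformly at random and remove it, let $\tau_1,\tau_2$ be the two resulting sub-trees, and let $\mathrm{Cut}(\tau)$ be the tree obtained by attaching the roots of $\mathrm{Cut}(\tau_1)$ and $\mathrm{Cut}(\tau_2)$ (built independently given $\tau_1,\tau_2$) by edges to a new common root. The infinite branch is the infinite path $v_0,v_1,v_2,\dots$ rooted at $v_0$, with $v_n$ at height $n$. *)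

(* Defs.v *)
From HB Require Import structures.
From mathcomp Require Import all_boot all_order all_algebra generic_quotient finmap.
From mathcomp Require Import all_classical all_reals all_analysis.

Set Implicit Arguments.
Unset Strict Implicit.
Unset Printing Implicit Defensive.

Import Order.TTheory GRing.Theory Num.Theory numFieldNormedType.Exports.

Local Open Scope classical_set_scope.
Local Open Scope ring_scope.

(* A rooted tree is represented by a set of words closed under removal of the
   last letter: the empty word is the root, [parent u] is the parent of [u], and
   the distance of [u] to the root is [size u]. Letters only serve to name
   vertices (the children of a vertex need not be numbered 0, .., k - 1); every
   rooted tree with finite numbers of children has such a representation. *)
Definition parent (u : seq nat) : seq nat := take (size u).-1 u.

Record wtree := WTree {
  verts : set (seq nat);
  verts_root : verts [::];
  verts_parent : forall u, verts u -> verts (parent u);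
  verts_locfin : forall u, finite_set [set i | verts (rcons u i)] }.

HB.instance Definition _ := gen_eqMixin wtree.
HB.instance Definition _ := gen_choiceMixin wtree.

Definition wtree_iso (t s : wtree) : Prop :=
  exists f : seq nat -> seq nat,
    [/\ set_bij (verts t) (verts s) f, f [::] = [::]
      & forall u, verts t u -> f (parent u) = parent (f u)].

Lemma parent_rcons u i : parent (rcons u i) = u.
Proof. by rewrite /parent size_rcons /= -cats1 take_size_cat. Qed.

Lemma size_parent u : size (parent u) = (size u).-1.
Proof. by rewrite /parent size_takel // leq_pred. Qed.

Lemma wtree_eq (t s : wtree) : verts t = verts s -> t = s.
Proof.
case: t s => A a1 a2 a3 [B b1 b2 b3] /= e; subst B.
by congr WTree; exact: Prop_irrelevance.
Qed.

Lemma wtree_iso_refl t : wtree_iso t t.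
Proof. by exists id; split => //; split => // u tu; exists u. Qed.

Lemma wtree_iso_sym t s : wtree_iso t s -> wtree_iso s t.
Proof.
case=> f [/[dup] bf [ff fi fs] f0 fp].
pose g v := if pselect (exists2 u, verts t u & f u = v) is left e
  then s2val (cid2 e) else v.
have gP v : verts s v -> verts t (g v) /\ f (g v) = v.
  move=> sv; rewrite /g; case: pselect => [e|]; first by case: cid2.
  by case; case: (fs v sv) => u tu <-; exists u.
have gK u : verts t u -> g (f u) = u.
  move=> tu; have [tg e] := gP _ (ff u tu).
  by apply: fi => //; rewrite inE.
exists g; split; first split.
- by move=> v /gP[].
- move=> v w; rewrite !inE => /gP[_ ev] /gP[_ ew] e.
  by rewrite -ev -ew e.
- by move=> u tu; exists (f u); [exact: ff|exact: gK].
- by rewrite -[in LHS]f0 gK //; exact: verts_root.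
- move=> v /gP[tv ev].
  by rewrite -[in LHS]ev -fp // gK //; exact: verts_parent.
Qed.

Lemma wtree_iso_trans t s r :
  wtree_iso t s -> wtree_iso s r -> wtree_iso t r.
Proof.
case=> f [bf f0 fp] [g [bg g0 gp]]; exists (g \o f); split.
- exact: set_bij_comp bg.
- by rewrite /= f0.
- by move=> u tu /=; rewrite fp // gp //; case: bf => ff _ _; exact: ff.
Qed.

Definition wtree_isob : rel wtree := fun t s => `[< wtree_iso t s >].

Lemma wtree_isob_refl : reflexive wtree_isob.
Proof. by move=> t; apply/asboolP; exact: wtree_iso_refl. Qed.

Lemma wtree_isob_sym : symmetric wtree_isob.
Proof.
by move=> t s; apply/asboolP/asboolP; exact: wtree_iso_sym.
Qed.

Lemma wtree_isob_trans : transitive wtree_isob.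
Proof.
move=> s t r /asboolP ts /asboolP sr; apply/asboolP.
exact: wtree_iso_trans sr.
Qed.

Canonical wtree_equiv :=
  EquivRel wtree_isob wtree_isob_refl wtree_isob_sym wtree_isob_trans.

(* Rooted, unordered, locally finite trees up to root- and parent-preserving
   bijections. *)
Definition tree : Type := {eq_quot wtree_equiv}%qT.
HB.instance Definition _ := Choice.on tree.
HB.instance Definition _ := EqQuotient.on tree.

Definition tree_of (t : wtree) : tree := (\pi_tree t)%qT.
Definition rep (t : tree) : wtree := repr t.

Lemma tree_ofP t s : tree_of t = tree_of s <-> wtree_iso t s.
Proof.
rewrite /tree_of; split=> [/eqmodP/asboolP//|h].
by apply/eqmodP/asboolP.
Qed.

Lemma repK t : tree_of (rep t) = t.
Proof. exact: reprK. Qed.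

Lemma wtrunc_parent R (t : wtree) u :
  [set v | verts t v /\ (size v <= R)%N] u -> [set v | verts t v /\ (size v <= R)%N] (parent u).
Proof.
move=> [tu uR]; split; first exact: verts_parent.
by rewrite size_parent (leq_trans (leq_pred _)).
Qed.

Lemma wtrunc_locfin R (t : wtree) u :
  finite_set [set i | [set v | verts t v /\ (size v <= R)%N] (rcons u i)].
Proof. by apply: sub_finite_set (verts_locfin t u) => i []. Qed.

Definition wtrunc R (t : wtree) : wtree :=
  @WTree [set v | verts t v /\ (size v <= R)%N] (conj (verts_root t) isT)
    (@wtrunc_parent R t) (@wtrunc_locfin R t).

Definition trunc (R : nat) (t : tree) : tree := tree_of (wtrunc R (rep t)).

Section dloc.
Context {R : realType}.
Local Open Scope ereal_scope.

(* The infimum of the empty set is +oo and expeR (- +oo) = 0. *)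
Definition dloc (t s : tree) : R :=
  fine (expeR (- ereal_inf
    [set (r%:R : R)%:E | r in [set r : nat | trunc r t <> trunc r s]])).

End dloc.

Lemma wtree_iso_size t s f u : [/\ set_bij (verts t) (verts s) f, f [::] = [::]
  & forall u, verts t u -> f (parent u) = parent (f u)] -> verts t u -> size (f u) = size u.
Proof.
case=> [[ff fi _] f0 fp]; elim/last_ind: u => [|u i IH] tu; first by rewrite f0.
have tu' : verts t u by rewrite -(parent_rcons u i); exact: verts_parent.
have := fp _ tu; rewrite parent_rcons => e.
have := IH tu'; rewrite e size_parent size_rcons => <-.
case E : (f (rcons u i)) => [|//]; exfalso.
have : rcons u i = [::].
  by apply: fi; rewrite ?inE ?f0 //; exact: verts_root.
by case: (u).
Qed.

Lemma wtrunc_iso R t s : wtree_iso t s -> wtree_iso (wtrunc R t) (wtrunc R s).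
Proof.
case=> f [/[dup] bf [ff fi fs] f0 fp]; exists f; split => //; last first.
  by move=> u [tu _]; exact: fp.
split.
- move=> u [tu uR]; split; first exact: ff.
  by rewrite (wtree_iso_size (t := t) (s := s)).
- by move=> u v; rewrite !inE => -[tu _] [tv _]; apply: fi; rewrite inE.
- move=> v [sv vR]; have [u tu e] := fs v sv; exists u => //; split => //.
  by rewrite -(wtree_iso_size (t := t) (s := s) (f := f)) ?e.
Qed.

Lemma wtrunc_wtrunc k m t : (k <= m)%N -> wtrunc k (wtrunc m t) = wtrunc k t.
Proof.
move=> km; apply: wtree_eq; apply/seteqP; split => v /=.
  by case=> -[tv _] vk.
by case=> tv vk; split => //; split => //; exact: leq_trans km.
Qed.

Lemma truncE k t : trunc k (tree_of t) = tree_of (wtrunc k t).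
Proof.
by apply/tree_ofP/wtrunc_iso/tree_ofP; rewrite repK.
Qed.

Lemma trunc_trunc k m t : (k <= m)%N -> trunc k (trunc m t) = trunc k t.
Proof. by move=> km; rewrite {2}/trunc truncE wtrunc_wtrunc. Qed.

Lemma level_finite (t : wtree) k : finite_set (verts (wtrunc k t)).
Proof.
elim: k => [|k IH].
  apply: (sub_finite_set _ (finite_set1 [::])) => u [_] /=.
  by rewrite leqn0 => /nilP ->.
have fin : finite_set (\bigcup_(u in verts (wtrunc k t))
    [set rcons u i | i in [set i | verts t (rcons u i)]]).
  apply: bigcup_finite => // u _; apply: finite_image; exact: verts_locfin.
apply: (@sub_finite_set _ _ ([set [::]] `|` \bigcup_(u in verts (wtrunc k t))
    [set rcons u i | i in [set i | verts t (rcons u i)]])); last first.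
  by rewrite finite_setU; split.
move=> u [tu]; elim/last_ind: u tu => [|u i _] tu; first by left.
rewrite size_rcons ltnS => uk; right; exists u; last by exists i.
by split => //; rewrite -(parent_rcons u i); exact: verts_parent.
Qed.

Lemma ultra_finite (F : set_system nat) (S : eqType) (h : nat -> S)
    (A : set S) : UltraFilter F -> finite_set A -> F [set k | A (h k)] ->
  exists2 v, A v & F [set k | h k = v].
Proof.
move=> FU /finite_seqP[r ->] {A}.
elim: r => [|v r IH] /= FA.
  by exfalso; apply: (@filter_not_empty _ F); apply: filterS FA => k.
have [Fv|Fv] := in_ultra_setVsetC [set k | h k = v] FU.
  by exists v => //=; rewrite mem_head.
have /IH[w /= wr Fw] : F [set k | [set` r] (h k)].
  apply: filterS (filterI FA Fv) => k /= [].
  by rewrite inE => /orP[/eqP|].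
by exists w => //; rewrite /= inE wr orbT.
Qed.

Lemma wtree_iso_local t s :
  (forall k, wtree_iso (wtrunc k t) (wtrunc k s)) -> wtree_iso t s.
Proof.
move=> /choice[f fP].
have [F [FU sF]] := ultraFilterLemma eventually_filter.
have FP : ProperFilter F := @ultra_proper _ _ FU.
have Fge m : F [set k | (m <= k)%N] by apply: sF; exists m.
have lvl u k : verts t u -> (size u <= k)%N -> verts (wtrunc (size u) s) (f k u).
  move=> tu uk; have [[ff _ _] _ _] := fP k.
  have [sfu _] : verts (wtrunc k s) (f k u) by apply: ff; split.
  split => //; rewrite (wtree_iso_size (fP k)) //=; split => //.
have lim u : exists v, verts t u -> verts s v /\ F [set k | f k u = v].
  have [tu|] := pselect (verts t u); last by exists [::].
  have [v [sv _] Fv] : exists2 v, verts (wtrunc (size u) s) v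
      & F [set k | f k u = v].
    apply: (ultra_finite FU (level_finite s (size u))).
    by apply: filterS (Fge (size u)) => k; exact: lvl.
  by exists v => _; split.
have [g gP] := choice lim.
exists g; split; first split.
- by move=> u /gP[].
- move=> u v; rewrite !inE => tu tv guv.
  have [_ Fu] := gP u tu; have [_ Fv] := gP v tv.
  have [k [/= [[fu fv] uk] vk]] := filter_ex
    (filterI (filterI (filterI Fu Fv) (Fge (size u))) (Fge (size v))).
  have [[_ fi _] _ _] := fP k.
  by apply: fi; rewrite ?inE ?fu ?fv //; split.
- move=> v sv.
  have /choice[h hP] : forall k, exists u, (size v <= k)%N ->
      verts (wtrunc (size v) t) u /\ f k u = v.
    move=> k; have [vk|] := boolP (size v <= k)%N; last by exists [::].
    have [[_ _ fs] _ _] := fP k.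
    have [u [tu uk] fu] : exists2 u, verts (wtrunc k t) u & f k u = v.
      by have [|u ? ?] := fs v; [split|exists u].
    exists u => _; split => //; split => //.
    by rewrite -fu (wtree_iso_size (fP k)) //; split.
  have [u [tu _] Fu] : exists2 u, verts (wtrunc (size v) t) u
      & F [set k | h k = u].
    apply: (ultra_finite FU (level_finite t (size v))).
    by apply: filterS (Fge (size v)) => k /= /hP[].
  exists u => //; have [_ Fg] := gP u tu.
  have [k [/= [hk fk] vk]] := filter_ex (filterI (filterI Fu Fg) (Fge (size v))).
  by rewrite -fk -hk; case: (hP k vk).
- have [_ F0] := gP _ (verts_root t).
  have [k /= <-] := filter_ex F0.
  by have [_ ->] := fP k.
- move=> u tu; have [_ Fu] := gP u tu.
  have [_ Fp] := gP _ (verts_parent tu).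
  have [k [/= [fu fp] uk]] := filter_ex (filterI (filterI Fu Fp) (Fge (size u))).
  have [_ _ fpar] := fP k.
  by rewrite -fu -fp fpar //; split.
Qed.

Lemma trunc_sep t s : (forall k, trunc k t = trunc k s) -> t = s.
Proof.
move=> h; rewrite -(repK t) -(repK s); apply/tree_ofP/wtree_iso_local => k.
exact/tree_ofP/h.
Qed.

Lemma trunc_le k m t s : (k <= m)%N -> trunc m t = trunc m s ->
  trunc k t = trunc k s.
Proof. by move=> km e; rewrite -(trunc_trunc t km) e trunc_trunc. Qed.

Section dloc_theory.
Context {R : realType}.

Variant dloc_spec (t s : tree) : R -> Prop :=
| DlocEq of t = s : dloc_spec t s 0
| DlocNeq m of trunc m t <> trunc m s
    & (forall k, (k < m)%N -> trunc k t = trunc k s) :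
    dloc_spec t s (expR (- m%:R)).

Lemma dlocP t s : dloc_spec t s (dloc t s).
Proof.
have [->|ts] := pselect (t = s).
  suff -> : dloc s s = 0 :> R by exact: DlocEq.
  rewrite /dloc (_ : [set r : nat | _] = set0) ?image_set0 ?ereal_inf0 //.
  by apply/seteqP; split => // k /=; exact.
have ex : exists k, `[< trunc k t <> trunc k s >].
  apply: contrapT => /forallNP h; apply/ts/trunc_sep => k.
  by apply: contrapT => /asboolP /h.
have [m /asboolP mts mmin] := ex_minnP ex.
have lt k : (k < m)%N -> trunc k t = trunc k s.
  move=> km; apply: contrapT => /asboolP /mmin; by rewrite leqNgt km.
suff -> : dloc t s = expR (- m%:R) :> R by exact: DlocNeq.
rewrite /dloc (_ : ereal_inf _ = m%:R%:E) //.
apply/eqP; rewrite eq_le; apply/andP; split.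
  by apply: ereal_inf_lbound; exists m.
apply: le_ereal_inf_tmp => _ [k /= kts <-].
by rewrite lee_fin ler_nat; apply: mmin; apply/asboolP.
Qed.

Lemma dlocxx t : dloc t t = 0 :> R.
Proof. by case: dlocP. Qed.

Lemma dloc_eq0 t s : dloc t s = 0 :> R -> t = s.
Proof.
by case: dlocP => // m _ _ /eqP; rewrite expR_eq0.
Qed.

Lemma dloc_sym t s : dloc t s = dloc s t :> R.
Proof.
rewrite /dloc; congr (fine (expeR (- ereal_inf (_ @` _)))).
by apply/seteqP; split => k /= /nesym.
Qed.

Lemma dloc_ge0 t s : 0 <= dloc t s :> R.
Proof. by case: dlocP => // *; exact: expR_ge0. Qed.

Lemma dloc_le t s m : trunc m t <> trunc m s -> expR (- m%:R) <= dloc t s :> R.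
Proof.
case: dlocP => [->//|k _ h] ts; rewrite ler_expR lerN2 ler_nat leqNgt.
by apply/negP => /h.
Qed.

Lemma dloc_triangle s t r : dloc t r <= dloc t s + dloc s r :> R.
Proof.
case: (dlocP t r) => [_|m tr _]; first by rewrite addr_ge0 ?dloc_ge0.
have [e|ts] := pselect (trunc m t = trunc m s).
  by apply: ler_wpDl; [exact: dloc_ge0|apply: dloc_le; rewrite -e].
by apply: ler_wpDr; [exact: dloc_ge0|exact: dloc_le].
Qed.

End dloc_theory.

(* The space of trees with the local limit topology; the parameter [R] is the
   type of real numbers in which the metric takes its values. *)
Definition loctree (R : realType) : Type := tree.
HB.instance Definition _ (R : realType) := Choice.on (loctree R).
HB.instance Definition _ (R : realType) :=
  @isMetric.Build R (loctree R) dloc dlocxx dloc_eq0 dloc_sym dloc_triangle.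

Lemma wleaf_parent u : [set [::]] u -> [set [::]] (parent u).
Proof. by move=> ->. Qed.

Lemma wleaf_locfin u : finite_set [set i | [set [::] : seq nat] (rcons u i)].
Proof.
by rewrite (_ : [set i | _] = set0) //; apply/seteqP; split => // i; case: u.
Qed.

Definition wleaf : wtree := @WTree [set [::]] erefl wleaf_parent wleaf_locfin.

Definition join_verts (t s : wtree) : set (seq nat) :=
  [set [::]] `|` cons 0%N @` verts t `|` cons 1%N @` verts s.

Lemma parent_cons i u : u != [::] -> parent (i :: u) = i :: parent u.
Proof. by case: u. Qed.

Lemma parent_seq1 i : parent [:: i] = [::].
Proof. by []. Qed.

Lemma join_parent t s u : join_verts t s u -> join_verts t s (parent u).
Proof.
have [->//|u0] := eqVneq u [::]; move=> [[/= e|[v tv <-]]|[v tv <-]].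
- by rewrite e eqxx in u0.
- have [->|v0] := eqVneq v [::]; first by left; left.
  rewrite parent_cons //; left; right; exists (parent v) => //.
  exact: verts_parent.
- have [->|v0] := eqVneq v [::]; first by left; left.
  rewrite parent_cons //; right; exists (parent v) => //.
  exact: verts_parent.
Qed.

Lemma join_locfin t s u : finite_set [set i | join_verts t s (rcons u i)].
Proof.
apply: (@sub_finite_set _ _ ([set 0%N; 1%N] `|`
  ([set i | verts t (rcons (behead u) i)] `|`
   [set i | verts s (rcons (behead u) i)]))); last first.
  rewrite !finite_setU; split; last by split; exact: verts_locfin.
  by split; exact: finite_set1.
move=> i; case: u => [|j u] /= [[//|[v tv]]|[v sv]].
- by case=> <- _; left; left.
- by case=> <- _; left; right.
- by case=> _ e; right; left; rewrite /= -e.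
- by case=> _ e; right; right; rewrite /= -e.
Qed.

Definition wjoin (t s : wtree) : wtree :=
  @WTree (join_verts t s) (or_introl (or_introl erefl))
    (@join_parent t s) (@join_locfin t s).

(* [nseq n 0] is the vertex v_n of the branch, and the tree [t n] is copied
   below the child [rcons (nseq n 0) 1] of v_n. *)
Definition branch_verts (t : nat -> wtree) : set (seq nat) :=
  [set u | exists n, u = nseq n 0%N
        \/ exists2 v, verts (t n) v & u = nseq n 0%N ++ 1%N :: v].

Lemma branch_root t : branch_verts t [::].
Proof. by exists 0%N; left. Qed.

Lemma branch_parent t u : branch_verts t u -> branch_verts t (parent u).
Proof.
case=> n [->|[v tv ->]].
  exists n.-1; left; rewrite /parent size_nseq.
  by case: n => // n; rewrite -[n.+1]addn1 nseqD take_size_cat ?size_nseq ?addn1.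
exists n; have [->|v0] := eqVneq v [::].
  by left; rewrite cats1 parent_rcons.
right; exists (parent v); first exact: verts_parent.
case/lastP: v v0 tv => // v i _ _.
by rewrite -rcons_cons -rcons_cat !parent_rcons.
Qed.

Lemma branch_locfin t u : finite_set [set i | branch_verts t (rcons u i)].
Proof.
apply: (@sub_finite_set _ _ ([set 0%N; 1%N] `|`
  \bigcup_(n in [set n | (n <= size u)%N])
    [set i | verts (t n) (rcons (drop n.+1 u) i)])); last first.
  rewrite !finite_setU; split; first by split; exact: finite_set1.
  apply: bigcup_finite => [|n _]; last exact: verts_locfin.
  by apply: sub_finite_set (finite_II (size u).+1) => n /=; rewrite ltnS.
move=> i [n [e|[v tv e]]].
  left; left => /=; have : i \in nseq n 0%N by rewrite -e mem_rcons mem_head.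
  by move=> /nseqP[].
case/lastP: v tv e => [|v j] tv.
  by rewrite cats1 => /rcons_inj[_ ->]; left; right.
rewrite -rcons_cons -rcons_cat => /rcons_inj[-> ->]; right; exists n => /=.
  by rewrite size_cat size_nseq leq_addr.
rewrite drop_cat size_nseq ltnNge leqnSn /= subSnn /=.
by rewrite drop0.
Qed.

Definition wbranch (t : nat -> wtree) : wtree :=
  WTree (branch_root t) (@branch_parent t) (@branch_locfin t).

Definition leaf : tree := tree_of wleaf.

Definition join (t s : tree) : tree := tree_of (wjoin (rep t) (rep s)).

Definition branch_with (t : nat -> tree) : tree :=
  tree_of (wbranch (fun n => rep (t n))).

Lemma joinC t s : join t s = join s t.
Proof.
apply/tree_ofP; exists (fun u => if u is i :: v then (1 - i)%N :: v else u).
split; first split.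
- move=> u [[->|[v tv <-]]|[v sv <-]] /=.
  + by left; left.
  + by right; exists v.
  + by left; right; exists v.
- move=> u v; rewrite !inE.
  by move=> [[->|[u' _ <-]]|[u' _ <-]] [[->|[v' _ <-]]|[v' _ <-]] //= [->].
- move=> u [[->|[v tv <-]]|[v sv <-]] /=.
  + by exists [::] => //; left; left.
  + by exists (1%N :: v) => //; right; exists v.
  + by exists (0%N :: v) => //; left; right; exists v.
- by [].
- by case=> [|i [|j u]].
Qed.

Section lgraph.
Variable K : choiceType.
Local Open Scope fset_scope.

(* Vertices and edges of a graph; edges are two-element sets of vertices. *)
Definition lgraph : Type := ({fset K} * {fset {fset K}})%type.

Definition adj (g : lgraph) : rel K := fun x y => [fset x; y] \in g.2.

Definition linked (g : lgraph) (x y : K) : Prop :=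
  exists p, path (adj g) x p /\ last x p = y.

Definition is_tree (g : lgraph) : Prop :=
  [/\ g.1 != fset0,
      forall e, e \in g.2 -> e `<=` g.1 /\ #|` e| = 2%N,
      forall x y, x \in g.1 -> y \in g.1 -> linked g x y
    & forall c, uniq c -> cycle (adj g) c -> (size c < 3)%N].

Definition component (g : lgraph) (x : K) : lgraph :=
  let V := [fset y in g.1 | `[< linked g x y >]] in
  (V, [fset e in g.2 | e `<=` V]).

Definition remove_edge (g : lgraph) (e : {fset K}) : lgraph :=
  (g.1, g.2 `\ e).

Variable R : realType.

(* [cut_mean m g phi] is the expectation of phi (Cut(g)) for a tree g with at
   most m + 1 vertices. The order in which the two ends x, y of an edge are
   listed is immaterial by [joinC]. *)
Fixpoint cut_mean (m : nat) (g : lgraph) (phi : tree -> R) : R :=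
  if (#|` g.1| <= 1)%N then phi leaf else
  if m isn't m'.+1 then 0 else
  #|` g.2|%:R^-1 * \sum_(e <- g.2)
    if enum_fset e is [:: x; y] then
      let g' := remove_edge g e in
      cut_mean m' (component g' x) (fun t1 =>
        cut_mean m' (component g' y) (fun t2 => phi (join t1 t2)))
    else 0.

Definition cut_law (g : lgraph) (t : tree) : R :=
  cut_mean #|` g.1| g (fun s => (s == t)%:R).

End lgraph.

Definition labelled_trees n : {set lgraph 'I_n} :=
  [set g : lgraph 'I_n | [forall x : 'I_n, x \in g.1] && `[< is_tree g >]]%SET.

(* The finite graph spanned by a set of words [A] closed under [parent]; the
   value at an infinite [A] is the empty graph. *)
Definition graph_of (A : set (seq nat)) : lgraph (seq nat) :=
  let V := fset_set A in
  (V, [fset [fset u; parent u] | u in V `\ [::]])%fset.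

(* The vertices of the family tree in which [k u] is the number of children of
   the individual [u], named [rcons u 0], .., [rcons u (k u).-1]. *)
Definition family_tree (k : seq nat -> nat) : set (seq nat) :=
  [set u | forall i, (i < size u)%N -> (nth 0%N u i < k (take i u))%N].

Section random.
Context d (Om : measurableType d) (R : realType) (P : probability Om R).
Local Open Scope ereal_scope.

Definition random_tree (X : Om -> loctree R) : Prop :=
  forall U : set (loctree R), open U -> measurable (X @^-1` U).

(* [tau] is uniformly distributed on the trees with vertices 0, .., n - 1. *)
Definition uniform_tree n (tau : Om -> lgraph 'I_n) : Prop :=
  forall g, measurable (tau @^-1` [set g]) /\
    P (tau @^-1` [set g]) =
      (if g \in labelled_trees n then (#|labelled_trees n|%:R^-1)%R else 0%R)%:E.

(* Conditionally on [tau], the law of [T] is that of Cut(tau). *)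
Definition random_cut_tree (K : choiceType) (tau : Om -> lgraph K)
    (T : Om -> loctree R) : Prop :=
  random_tree T /\
  forall g t, P [set w | tau w = g /\ T w = t] =
    P [set w | tau w = g] * (cut_law R g t)%:E.

(* Conditionally on [tau], the [C i] are independent with laws Cut(tau i). *)
Definition random_cut_trees (I K : choiceType) (tau : I -> Om -> lgraph K)
    (C : I -> Om -> loctree R) : Prop :=
  (forall i, random_tree (C i)) /\
  forall (J : {fset I}) (g : I -> lgraph K) (t : I -> loctree R),
    P [set w | forall i, i \in J -> tau i w = g i /\ C i w = t i] =
    P [set w | forall i, i \in J -> tau i w = g i]
      * (\prod_(i <- J) cut_law R (g i) (t i))%R%:E.

Definition mutually_independent (I : choiceType) d' (S : measurableType d')
    (X : I -> Om -> S) : Prop :=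
  forall (J : {fset I}) (B : I -> set S), (forall i, measurable (B i)) ->
    P [set w | forall i, i \in J -> B i (X i w)] =
    \prod_(i <- J) P (X i @^-1` B i).

End random.

Definition cvg_in_distribution (R : realType) (S : topologicalType)
    (d : nat -> measure_display) (Om : forall n, measurableType (d n))
    (P : forall n, probability (Om n) R) (X : forall n, Om n -> S)
    d' (Om' : measurableType d') (P' : probability Om' R) (X' : Om' -> S) :=
  forall f : S -> R, continuous f -> (exists M, forall x, `|f x| <= M) ->
    (fun n => 'E_(P n)[f \o X n])%E @ \oo --> ('E_P'[f \o X'])%E.

(* Main.v *)
Require Import Defs.
From mathcomp Require Import all_boot all_order all_algebra finmap.
From mathcomp Require Import all_classical all_reals all_analysis.
From mathcomp Require Import measurable_realfun.
From mathcomp Require Import ring lra.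
From mathcomp Require Import zify.

(** The cut-tree of a tree with n vertices is obtained by cutting a uniform edge, so its
    law satisfies a recursion. For a uniform labelled tree, cutting an edge gives a pair
    of labelled trees with one marked vertex each ([split_tree], [glue_tree]), which are
    uniform given their sizes; hence, up to normalisation, the law is the functional
    [cayley_sum n] of total mass n^(n-1) / n! defined by

      M_n (phi) = n / (2 (n - 1)) * sum over 1 <= k < n of M_k * M_(n-k) (phi o join)

    ([sum_labelled_trees]). For a Galton-Watson tree with Poisson (1) offspring, a plane
    tree with a marked edge is a plane tree grafted at some rank below a vertex of
    another one, and the Poisson weights compensate for the choice of the rank; the
    cut-trees of size n therefore satisfy the same recursion ([plane_sumE]). So the
    cut-tree of such a Galton-Watson tree has the law of M_k with weight e^(-k).

    For a large n, consider the event that the first cut leaves a part of size k, for a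
    fixed k. Relative to the mass n^(n-1) / n!, the weight of this event is at least
    e^(-k) M_k (1), because these masses grow at most by the factor e from one n to the
    next ([cayley_coef_ratio]). Iterating r times along
    the larger part, the law of the first r levels of T_n is at least the law of
    r independent cut-trees of Galton-Watson trees of bounded sizes hanging from a branch
    ([limit_mean_le]). This minorant has mass s_K^r, where s_K is the mass given by
    the Borel law to {1, .., K}; it also bounds from below the law of the
    first r levels of T_oo ([branch_expectation_ge]). Since s_K tends to 1
    ([borel_mass_cvg]), no mass is lost, and both laws are close to their
    common minorant. A bounded continuous function is the increasing limit of
    functions of the truncations ([lower_env]), which yields the lower half of the
    convergence of expectations ([expectation_lower_bound]); applying it to M + f and
    M - f gives the result.

    The masses rest on Abel's identity ([abel_poly]), which is at the same time the
    recursion for n^(n-1) / n! and a renewal equation for e^(-n) n^n / n!; the divergence of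
    the harmonic series then forces the Borel law to have mass 1. *)

Set Implicit Arguments.
Unset Strict Implicit.
Unset Printing Implicit Defensive.
Import Order.TTheory GRing.Theory Num.Theory numFieldNormedType.Exports.
Import Defs.
Local Open Scope classical_set_scope.
Local Open Scope ring_scope.

(** * Abel's binomial identity *)

Section abel.
Variable F : numFieldType.

(** The n-th finite difference kills polynomials of degree less than n. Absorbing
one factor k of k^m into the binomial coefficient lowers both n and m. *)
Lemma sum_sign_bin_expr (m n : nat) : (m < n)%N ->
  \sum_(k < n.+1) (-1) ^+ k * 'C(n, k)%:R * k%:R ^+ m = 0 :> F.
Proof.
elim/ltn_ind: m n => -[|m] IH n mn.
  rewrite -[RHS](_ : (1 + -1) ^+ n = 0 :> F); last first.
    by rewrite subrr expr0n; case: n mn.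
  rewrite exprDn; apply: eq_bigr => k _.
  by rewrite expr0 mulr1 expr1n mul1r mulr_natr.
case: n mn => // n mn; rewrite big_ord_recl expr0n mulr0 add0r.
transitivity (- n.+1%:R * \sum_(j < m.+1) 'C(m, j)%:R *
    \sum_(k < n.+1) (-1) ^+ k * 'C(n, k)%:R * k%:R ^+ j : F); last first.
  rewrite big1 ?mulr0 // => j _; rewrite IH ?mulr0 //.
  exact: leq_ltn_trans (leq_ord j) mn.
under [X in _ * X]eq_bigr do rewrite mulr_sumr.
rewrite exchange_big /= mulr_sumr; apply: eq_bigr => k _.
rewrite /bump /= add1n exprS (exprS _ m).
have -> : (-1 * (-1) ^+ k * 'C(n.+1, k.+1)%:R * (k.+1%:R * k.+1%:R ^+ m) : F)
  = - n.+1%:R * ((-1) ^+ k * 'C(n, k)%:R * k.+1%:R ^+ m).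
  have : (n.+1%:R * 'C(n, k)%:R = k.+1%:R * 'C(n.+1, k.+1)%:R :> F).
    by rewrite -!natrM mul_bin_diag.
  move: n.+1%:R k.+1%:R 'C(n, k)%:R 'C(n.+1, k.+1)%:R => a b c e h.
  by ring: h.
congr (_ * _).
under eq_bigr do rewrite mulrCA.
rewrite -mulr_sumr; congr (_ * _).
rewrite -natr1 addrC exprDn; apply: eq_bigr => j _.
by rewrite expr1n mul1r mulr_natl.
Qed.

Lemma poly_eq_deriv (p q : {poly F}) a :
  p^`() = q^`() -> p.[a] = q.[a] -> p = q.
Proof.
move=> dpq pqa; apply/eqP; rewrite -subr_eq0; apply/eqP.
have /size1_polyC e : (size (p - q)%R <= 1)%N.
  apply/leq_sizeP => -[//|j] _.
  have : ((p - q)^`())`_j = 0 by rewrite derivB dpq subrr coef0.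
  by rewrite coef_deriv => /eqP; rewrite mulrn_eq0 /= => /eqP.
have : (p - q).[a] = 0 by rewrite hornerD hornerN pqa subrr.
by rewrite e hornerC => ->.
Qed.

(** One of Abel's identities, stated with a shift c so that it is stable under
differentiation: the derivative of the identity for (n, c) is n times the identity
for (n - 1, c + 1), and at X = - (c + n) the left-hand side is an n-th finite
difference of a polynomial of degree n - 1. *)
Lemma abel_poly n (c : F) : (0 < n)%N ->
  \sum_(k < n) ('C(n, k.+1) * k.+1 ^ k)%:R *:
     ('X + (c + (n - k.+1)%:R)%:P) ^+ (n - k.+1)
  = n%:R *: ('X + (c + n%:R)%:P) ^+ n.-1.
Proof.
elim: n c => // n IH c _; have [->|n0] := eqVneq n 0%N.
  by rewrite big_ord1 subnn !expr0 bin1.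
(* At this point the shifted powers become powers of - (k + 1). *)
apply: (@poly_eq_deriv _ _ (- (c + n.+1%:R))); last first.
  rewrite horner_sum.
  rewrite [RHS](_ : _ = 0); last first.
    rewrite hornerZ horner_exp hornerD hornerX hornerC addNr expr0n.
    by case: n n0 {IH} => //= n _; rewrite mulr0.
  transitivity ((-1) ^+ n.+1 * \sum_(k < n.+2) (-1) ^+ k * 'C(n.+1, k)%:R * k%:R ^+ n : F);
    last by rewrite sum_sign_bin_expr ?mulr0.
  rewrite [in RHS]big_ord_recl expr0n (negPf n0) mulr0 add0r mulr_sumr.
  apply: eq_bigr => -[k kn] _; rewrite lift0 /=.
  rewrite hornerZ horner_exp hornerD hornerX hornerC natrM natrX.
  have -> : - (c + n.+1%:R) + (c + (n.+1 - k.+1)%:R) = - k.+1%:R.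
    by rewrite natrB //; ring.
  rewrite (exprNn k.+1%:R) -[X in (-1) ^+ X * (_ * _ * _)](subnK kn) exprD.
  rewrite -[X in _ = _ * (_ * _%:R ^+ X)](subnK (kn : (k <= n)%N)) subSS exprD.
  rewrite -!(signr_odd F (n - k)) -!(signr_odd F k.+1).
  by case: (odd _); case: (odd _); rewrite ?expr0 ?expr1; ring.
rewrite linear_sum /= derivZ deriv_exp derivD derivX derivC addr0 mul1r.
rewrite big_ord_recr /= subnn expr0 linearZ /= (derivC 1) scaler0 addr0.
have {}IH := IH (c + 1).
transitivity (n.+1%:R *: (n%:R *: ('X + (c + 1 + n%:R)%:P) ^+ n.-1)); last first.
  by rewrite -addrA [1 + _]addrC natr1 !scaler_nat mulrnAC.
rewrite -IH ?lt0n // scaler_sumr; apply: eq_bigr => k _.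
rewrite derivZ deriv_exp derivD derivX derivC addr0 mul1r.
have kn : (k < n)%N by case: k.
rewrite subSS.
rewrite scalerA -[X in _ *: X]scaler_nat scalerA /= !natrM.
have -> : c + (n - k)%:R = c + 1 + (n - k.+1)%:R.
  rewrite -addrA; congr (_ + _); rewrite natrB 1?ltnW // natrB //.
  by rewrite -[k.+1%:R]natr1; ring.
rewrite subnS; congr (_ *: _).
have : ('C(n.+1, k.+1) * (n - k) = n.+1 * 'C(n, k.+1))%N.
  by rewrite (mul_bin_down n.+1) subSS mulnC.
move=> /(congr1 (fun i => i%:R : F)); rewrite !natrM => e; ring: e.
Qed.

End abel.

(** * The Borel law *)

Section borel.
Variable R : realType.

(** The total weight n^(n-1) / n! of the rooted labelled trees of size n, in their
exponential generating function; it is e^n times the probability that a critical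
Poisson Galton-Watson tree has n vertices (the Borel law). *)
Definition cayley_coef n : R := n%:R ^+ n.-1 / n`!%:R.
Local Notation y := cayley_coef.

Definition pointed_coef n : R := n%:R ^+ n / n`!%:R.
Local Notation D := pointed_coef.

Lemma fact_neq0 n : n`!%:R != 0 :> R.
Proof. by rewrite pnatr_eq0 -lt0n fact_gt0. Qed.

Lemma cayley_coef_gt0 n : (0 < n)%N -> 0 < y n.
Proof. by move=> n0; rewrite divr_gt0 ?exprn_gt0 ?ltr0n ?fact_gt0. Qed.

Lemma cayley_coef1 : y 1 = 1.
Proof. by rewrite /y expr0 divr1. Qed.

Lemma pointed_coefE n : (0 < n)%N -> D n = n%:R * y n.
Proof. by case: n => // n _; rewrite /D /y exprS mulrA. Qed.

(** A renewal equation: after multiplication by e^(-n), the pointed coefficients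
are the renewal probabilities of the Borel law. It is Abel's identity at 0. *)
Lemma pointed_coef_renewal n : (0 < n)%N ->
  D n = \sum_(k < n) y k.+1 * D (n - k.+1).
Proof.
move=> n0; have := congr1 (fun p : {poly R} => p.[0] / n`!%:R) (abel_poly 0 n0).
rewrite hornerZ horner_exp hornerD hornerX hornerC !add0r -exprS prednK //.
rewrite -/(D n) => <-; rewrite horner_sum mulr_suml; apply: eq_bigr => -[k kn] _.
rewrite hornerZ horner_exp hornerD hornerX hornerC !add0r /=.
rewrite /y /D /= -(bin_fact kn) !natrM natrX.
by field; rewrite !fact_neq0 pnatr_eq0 -lt0n bin_gt0 kn nat1r pnatr_eq0.
Qed.

(** The number of edges on one side and the convolution on the other reflect the
cutting of a tree at an edge; here it is the renewal equation, symmetrised under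
k <-> n - k. *)
Lemma cayley_coef_rec n : (1 < n)%N ->
  2 * n.-1%:R * y n = n%:R * \sum_(1 <= k < n) y k * y (n - k).
Proof.
case: n => [|[|n]] //= _.
have h : n.+1%:R * y n.+2 = \sum_(1 <= k < n.+2) (n.+2 - k)%:R * (y k * y (n.+2 - k)).
  have := pointed_coef_renewal (isT : (0 < n.+2)%N).
  rewrite big_ord_recr /= subnn pointed_coefE // [D 0]divr1 mulr1.
  rewrite -[n.+2%:R]natr1 mulrDl mul1r => /addIr ->.
  rewrite big_add1 /= big_mkord; apply: eq_bigr => -[k kn] _ /=.
  by rewrite pointed_coefE ?subn_gt0 // mulrCA.
have h' : n.+1%:R * y n.+2 = \sum_(1 <= k < n.+2) k%:R * (y k * y (n.+2 - k)).
  rewrite h big_nat_rev /= [LHS]big_nat [RHS]big_nat.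
  apply: eq_bigr => k /andP[k1 kn].
  by rewrite add1n subSS subKn ?[y k * _]mulrC // ltnW.
rewrite -mulrA mulr_natl mulr2n {1}h h' -big_split mulr_sumr /=.
rewrite !big_nat; apply: eq_bigr => k /andP[k1 kn].
by rewrite -mulrDl -natrD subnK // ltnW.
Qed.

(** Since (1 + 1/m)^(m-1) <= e, one step down costs at most a factor e. This is why
the law of the smaller half of a cut Cayley tree dominates the Borel law, for every n
and not only in the limit. *)
Lemma cayley_coef_ratio n k : (k < n)%N -> expR (- k%:R) * y n <= y (n - k).
Proof.
elim: k => [|k IH] kn; first by rewrite oppr0 expR0 mul1r subn0 lexx.
apply: (@le_trans _ _ (expR (-1) * y (n - k))).
  rewrite -natr1 opprD addrC expRD -mulrA ler_pM2l ?expR_gt0 //.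
  by apply: IH; apply: ltnW.
have -> : (n - k = (n - k.+1).+1)%N by lia.
have : (0 < n - k.+1)%N by rewrite subn_gt0.
move: (n - k.+1)%N => {IH kn k} m m0; rewrite /y /=.
case: m m0 => // m _ /=.
have -> : m.+2%:R ^+ m.+1 / m.+2`!%:R = m.+2%:R ^+ m / m.+1`!%:R :> R.
  by rewrite factS natrM invfM mulrA exprSr mulfK ?pnatr_eq0.
rewrite mulrA ler_pM2r; last by rewrite invr_gt0 ltr0n fact_gt0.
rewrite expRN ler_pdivrMl ?expR_gt0 //.
have -> : m.+2%:R = m.+1%:R * (1 + m.+1%:R^-1) :> R.
  by rewrite mulrDr mulr1 divff ?pnatr_eq0 // natr1.
rewrite exprMn mulrC ler_pM2r ?exprn_gt0 ?ltr0n //.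
apply: (@le_trans _ _ (expR m.+1%:R^-1 ^+ m)).
  by rewrite lerXn2r ?nnegrE ?addr_ge0 ?invr_ge0 ?expR_ge0 ?expR_ge1Dx.
rewrite -expRM_natr ler_expR mulrC ler_pdivrMr ?ltr0n // mul1r ler_nat //.
Qed.

(** From (1 + 1/n)^(n+1) >= e, the quantity n e^(-n) n^n / n! is nondecreasing. *)
Lemma pointed_coef_harmonic n : (0 < n)%N ->
  expR (-1) / n%:R <= expR (- n%:R) * D n.
Proof.
move=> n0; rewrite ler_pdivrMr ?ltr0n //.
elim: n n0 => // n IH _; have [->|] := posnP n.
  by rewrite /D expr1 divr1 !mulr1.
move=> /[dup] n0 /IH /le_trans; apply.
have -> : expR (- n.+1%:R) = expR (- n%:R) * expR (-1) :> R.
  by rewrite -natr1 opprD expRD.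
suff h : D n * n%:R <= expR (-1) * (D n.+1 * n.+1%:R).
  by move: h; rewrite -(ler_pM2l (expR_gt0 (- n%:R))) !mulrA.
have -> : D n * n%:R = n%:R ^+ n.+1 / n`!%:R by rewrite exprSr mulrAC.
have -> : D n.+1 * n.+1%:R = n.+1%:R ^+ n.+1 / n`!%:R.
  by rewrite /D factS natrM invfM mulrA mulrAC mulfVK ?pnatr_eq0 // exprSr.
rewrite mulrA ler_pM2r ?invr_gt0 ?ltr0n ?fact_gt0 //.
have -> : n%:R = n.+1%:R * (1 - n.+1%:R^-1) :> R.
  by rewrite mulrBr mulr1 divff ?pnatr_eq0 // -natr1 addrK.
rewrite exprMn mulrC ler_pM2r ?exprn_gt0 ?ltr0n //.
have -> : expR (-1) = expR (- n.+1%:R^-1) ^+ n.+1 :> R.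
  by rewrite -expRM_natr mulNr mulVf ?pnatr_eq0.
rewrite lerXn2r ?nnegrE ?expR_ge0 ?expR_ge1Dx //.
by rewrite subr_ge0 invf_le1 ?ltr0n // ler1n.
Qed.

Definition borel_mass K : R := \sum_(1 <= k < K.+1) expR (- k%:R) * y k.

Lemma borel_mass_ge0 K : 0 <= borel_mass K.
Proof.
rewrite /borel_mass big_nat sumr_ge0 // => k /andP[k0 _].
by rewrite mulr_ge0 ?expR_ge0 // ltW // cayley_coef_gt0.
Qed.

(** The Borel law has total mass 1, that is, the critical tree is almost surely finite.
Otherwise the renewal equation would bound the sum of the renewal probabilities by
1/e, although they dominate a multiple of the harmonic series. *)
Lemma borel_mass_cvg (e : R) : 0 < e -> exists K, 1 - e < borel_mass K.
Proof.
move=> e0; apply: contrapT => /forallNP h.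
have sle K : borel_mass K <= 1 - e by rewrite leNgt; apply/negP/h.
pose d n := expR (- n%:R) * D n.
have d0 n : 0 <= d n.
  by rewrite mulr_ge0 ?expR_ge0 // divr_ge0 ?exprn_ge0.
have bnd N : e * \sum_(n < N.+1) d n <= 1.
  suff : \sum_(n < N.+1) d n <= 1 + (1 - e) * \sum_(n < N.+1) d n by lra.
  rewrite {1}big_ord_recl; apply: lerD.
    by rewrite /d /D expr0 fact0 oppr0 expR0 divr1 mulr1.
  (* The double sum over k <= i < N is at most the product of the sums. *)
  apply: (@le_trans _ _ (borel_mass N * \sum_(n < N.+1) d n)); last first.
    by apply: ler_wpM2r => //; apply: sumr_ge0.
  rewrite /borel_mass big_add1 /= big_mkord mulr_suml.
  have -> : \sum_(i < N) d (lift ord0 i) = \sum_(i < N) \sum_(k < N | (k <= i)%N)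
      expR (- k.+1%:R) * y k.+1 * d (i - k)%N.
    apply: eq_bigr => -[i iN] _; rewrite lift0 /d pointed_coef_renewal //= mulr_sumr.
    rewrite (big_ord_widen_cond N predT (fun k => expR (- i.+1%:R) * (y k.+1 * D (i.+1 - k.+1)))) //=.
    apply: eq_big => [k|[k kN] /= ki]; first by rewrite ltnS.
    have -> : expR (- i.+1%:R) = expR (- k.+1%:R) * expR (- (i - k)%:R) :> R.
      by rewrite -expRD natrB // -!natr1; congr expR; ring.
    by rewrite subSS /d; ring.
  rewrite (exchange_big_dep predT) //=; apply: ler_sum => -[k kN] _ /=.
  rewrite -mulr_sumr; apply: ler_wpM2l.
    by rewrite mulr_ge0 ?expR_ge0 // ltW // cayley_coef_gt0.
  rewrite -(big_mkord (fun i => (k <= i)%N) (fun i => d (i - k)%N)) /=.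
  rewrite -(big_mkord predT d) -(big_nat_widenl k 0 N predT) //.
  rewrite -{1}[k]add0n big_addn.
  under eq_bigr do rewrite addnK.
  rewrite [leRHS](@big_cat_nat _ _ _ (N - k)) //=; last first.
    by rewrite (leq_trans (leq_subr _ _)).
  by rewrite lerDl sumr_ge0.
have : cvgn (series (@harmonic R)); last exact: dvg_harmonic.
apply: nondecreasing_is_cvgn.
  by apply: nondecreasing_series => n _ _; exact: harmonic_ge0.
exists (expR 1 / e) => _ [N _ <-].
rewrite ler_pdivlMr // -(ler_pM2l (expR_gt0 (-1))) -expRD addNr expR0.
apply: le_trans (bnd N); rewrite mulrA [X in X <= _]mulrC ler_pM2l //.
rewrite seriesEord /= big_ord_recl mulr_sumr; apply: ler_wpDl => //.
by apply: ler_sum => i _; rewrite lift0 /=; exact: pointed_coef_harmonic.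
Qed.

End borel.

(** * Joins, truncations and averages of trees *)

(** Makes [join] computable on representatives. *)
Lemma wjoin_iso t t' s s' : wtree_iso t t' -> wtree_iso s s' ->
  wtree_iso (wjoin t s) (wjoin t' s').
Proof.
move=> [f [[ff fi fs] f0 fp]] [g [[gf gi gs] g0 gp]].
pose h (u : seq nat) :=
  if u is i :: v then i :: (if i == 0%N then f v else g v) else [::].
exists h; split => //; first split.
- move=> u [[->|[v tv <-]]|[v sv <-]] /=.
  + by left; left.
  + by left; right; exists (f v) => //; exact: ff.
  + by right; exists (g v) => //; exact: gf.
- move=> u u'; rewrite !inE.
  move=> [[->|[v tv <-]]|[v tv <-]] [[->|[v' tv' <-]]|[v' tv' <-]] //= [e].
    by congr cons; apply: fi; rewrite ?inE.
  by congr cons; apply: gi; rewrite ?inE.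
- move=> u [[->|[v tv <-]]|[v sv <-]] /=.
  + by exists [::] => //; left; left.
  + have [w tw <-] := fs v tv; exists (0%N :: w) => //.
    by left; right; exists w.
  + have [w tw <-] := gs v sv; exists (1%N :: w) => //.
    by right; exists w.
- move=> u [[->//|[v tv <-]]|[v sv <-]] /=.
  + have [->|v0] := eqVneq v [::]; first by rewrite f0.
    rewrite !parent_cons //=; first by rewrite fp.
    rewrite -size_eq0 (wtree_iso_size (t := t) (s := t')) ?size_eq0 //.
  + have [->|v0] := eqVneq v [::]; first by rewrite g0.
    rewrite !parent_cons //=; first by rewrite gp.
    rewrite -size_eq0 (wtree_iso_size (t := s) (s := s')) ?size_eq0 //.
Qed.

Lemma join_tree_of t s : join (tree_of t) (tree_of s) = tree_of (wjoin t s).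
Proof. by apply/tree_ofP/wjoin_iso; apply/tree_ofP; rewrite repK. Qed.

(** Truncations of a join lose one level in each subtree; this is what makes
inductions on the truncation level possible. *)
Lemma trunc_join r t s : trunc r.+1 (join t s) = join (trunc r t) (trunc r s).
Proof.
rewrite join_tree_of truncE; congr tree_of; apply: wtree_eq.
apply/seteqP; split => u /=.
  move=> [[[->|[v tv <-]]|[v tv <-]]] /= vr; first by left; left.
    by left; right; exists v.
  by right; exists v.
move=> [[->|[v [tv vr] <-]]|[v [tv vr] <-]]; split => //.
- by left; left.
- by left; right; exists v.
- by right; exists v.
Qed.

Lemma trunc0 t : trunc 0 t = leaf.
Proof.
congr tree_of; apply: wtree_eq; apply/seteqP; split => u /=.
  by case=> _; rewrite leqn0 => /nilP.
by move=> ->; split => //; exact: verts_root.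
Qed.

(** The branch is self-similar: cut above its root, it is the first hanging tree next
to a branch again. *)
Lemma branch_with_join t :
  branch_with t = join (t 0%N) (branch_with (fun n => t n.+1)).
Proof.
rewrite joinC -[t 0%N]repK join_tree_of; congr tree_of.
apply: wtree_eq; apply/seteqP; split => u /=.
  move=> [[|n] [->|[v tv ->]]].
  - by left; left.
  - by right; exists v.
  - by left; right; exists (nseq n 0%N) => //; exists n; left.
  - left; right; exists (nseq n 0%N ++ 1%N :: v) => //.
    by exists n; right; exists v.
move=> [[->|[v [n [->|[w tw ->]]] <-]]|[v tv <-]].
- by exists 0%N; left.
- by exists n.+1; left.
- by exists n.+1; right; exists w.
- by exists 0%N; right; exists v.
Qed.

Definition depends_on_trunc T r (phi : tree -> T) :=
  forall t s, trunc r t = trunc r s -> phi t = phi s.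

Lemma depends_on_trunc0 T (phi : tree -> T) t :
  depends_on_trunc 0 phi -> phi t = phi leaf.
Proof. by apply; rewrite !trunc0. Qed.

Lemma depends_on_trunc_join T r (phi : tree -> T) t :
  depends_on_trunc r.+1 phi -> depends_on_trunc r (fun s => phi (join t s)).
Proof. by move=> h s s' e; apply: h; rewrite !trunc_join e. Qed.

Section averages.
Variable R : realType.
Implicit Types (M N : (tree -> R) -> R) (phi psi : tree -> R).

(** Expectations under finitely supported measures on trees, kept as functionals so
that the recursion of [cut_mean] is an equation between them. The list may repeat
trees, which makes sums of averages mere concatenations. *)
Definition average M := exists L : seq (R * tree),
  (forall p, p \in L -> 0 <= p.1) /\
  forall phi, M phi = \sum_(p <- L) p.1 * phi p.2.

Lemma average_leaf : average (fun phi => phi leaf).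
Proof.
exists [:: (1, leaf)]; split => [p|phi].
  by rewrite inE => /eqP ->.
by rewrite big_seq1 mul1r.
Qed.

Lemma average0 : average (fun=> 0).
Proof. by exists [::]; split => // phi; rewrite big_nil. Qed.

Lemma averageD M N : average M -> average N ->
  average (fun phi => M phi + N phi).
Proof.
move=> [L [L0 LM]] [L' [L'0 LN]]; exists (L ++ L'); split => [p|phi].
  by rewrite mem_cat => /orP[/L0|/L'0].
by rewrite big_cat LM LN.
Qed.

Lemma averageZ c M : 0 <= c -> average M -> average (fun phi => c * M phi).
Proof.
move=> c0 [L [L0 LM]].
exists [seq (c * p.1, p.2) | p <- L]; split => [_ /mapP[p /L0 p0 ->]|phi].
  exact: mulr_ge0.
by rewrite big_map LM mulr_sumr; apply: eq_bigr => p _; rewrite mulrA.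
Qed.

Lemma average_sum (I : eqType) (r : seq I) (M : I -> (tree -> R) -> R) :
  (forall i, i \in r -> average (M i)) ->
  average (fun phi => \sum_(i <- r) M i phi).
Proof.
elim: r => [|i r IH] h.
  have [L [L0 LM]] := average0; exists L; split => // phi.
  by rewrite big_nil -LM.
have [L [L0 LM]] : average (fun phi => M i phi + \sum_(i <- r) M i phi).
  apply: averageD; first by apply: h; rewrite mem_head.
  by apply: IH => j jr; apply: h; rewrite inE jr orbT.
by exists L; split => // phi; rewrite big_cons LM.
Qed.

Lemma average_bind (M : (tree -> R) -> R) (N : tree -> (tree -> R) -> R) :
  average M -> (forall t, average (N t)) ->
  average (fun phi => M (fun t => N t phi)).
Proof.
move=> [L [L0 LM]] aN.
have [L' [L'0 LM']] :
    average (fun phi => \sum_(p <- L) p.1 * N p.2 phi).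
  by apply: average_sum => p pL; apply: averageZ; [exact: L0|exact: aN].
by exists L'; split => // phi; rewrite LM -LM'.
Qed.

Lemma average_map M (h : tree -> tree) :
  average M -> average (fun phi => M (phi \o h)).
Proof.
move=> [L [L0 LM]].
exists [seq (p.1, h p.2) | p <- L]; split => [_ /mapP[p /L0 p0 ->]//|phi].
by rewrite big_map LM.
Qed.

(** The law of the join of two independent trees. *)
Definition join_average M N phi := M (fun t => N (fun s => phi (join t s))).

Lemma average_join M N : average M -> average N -> average (join_average M N).
Proof.
move=> aM aN; apply: (average_bind (N := fun t phi => N (phi \o join t))) => //.
by move=> t; apply: average_map.
Qed.

Lemma average_ge0 M phi : average M -> (forall t, 0 <= phi t) -> 0 <= M phi.
Proof.
move=> [L [L0 ->]] h; rewrite big_seq sumr_ge0 // => p pL.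
by rewrite mulr_ge0 ?L0.
Qed.

Lemma le_average M phi psi : average M -> (forall t, phi t <= psi t) ->
  M phi <= M psi.
Proof.
move=> [L [L0 LM]] h; rewrite !LM big_seq [leRHS]big_seq.
by apply: ler_sum => p pL; rewrite ler_wpM2l ?L0.
Qed.

Lemma eq_average M phi psi : average M -> phi =1 psi -> M phi = M psi.
Proof.
by move=> [L [L0 LM]] h; rewrite !LM; apply: eq_bigr => p _; rewrite h.
Qed.

Lemma average_linZ M phi c : average M -> M (fun t => c * phi t) = c * M phi.
Proof.
move=> [L [L0 LM]]; rewrite !LM mulr_sumr.
by apply: eq_bigr => p _; rewrite mulrCA.
Qed.

Lemma average_linB M phi psi : average M ->
  M (fun t => phi t - psi t) = M phi - M psi.
Proof.
move=> [L [L0 LM]]; rewrite !LM -sumrB.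
by apply: eq_bigr => p _; rewrite mulrBr.
Qed.

Lemma average_sumE M (I : Type) (r : seq I) (P : pred I) (phi : I -> tree -> R) :
  average M ->
  M (fun t => \sum_(i <- r | P i) phi i t) = \sum_(i <- r | P i) M (phi i).
Proof.
move=> [L [L0 LM]]; rewrite LM.
under [RHS]eq_bigr do rewrite LM.
by rewrite exchange_big /=; apply: eq_bigr => p _; rewrite mulr_sumr.
Qed.

(** A finite Fubini theorem. *)
Lemma average_comm M N (h : tree -> tree -> R) : average M -> average N ->
  M (fun t => N (h t)) = N (fun s => M (h^~ s)).
Proof.
move=> aM [L [L0 LN]].
rewrite LN (eq_average aM (fun t => LN (h t))) average_sumE //.
by apply: eq_bigr => p _; rewrite average_linZ.
Qed.

(** The two subtrees of a join are not ordered, so the order of the two laws is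
irrelevant. *)
Lemma join_averageC M N phi : average M -> average N ->
  join_average M N phi = join_average N M phi.
Proof.
move=> aM aN; rewrite /join_average average_comm //.
by apply: eq_average => // s; apply: eq_average => // t; rewrite joinC.
Qed.

(** Recovers the point masses, in terms of which the law of a random tree is given. *)
Lemma average_indic M : average M -> exists2 S : seq tree, uniq S &
  forall phi, M phi = \sum_(t <- S) M (fun s => (s == t)%:R) * phi t.
Proof.
move=> [L [L0 LM]]; exists (undup [seq p.2 | p <- L]); first exact: undup_uniq.
move=> phi; rewrite LM.
under [RHS]eq_bigr do rewrite LM mulr_suml.
rewrite exchange_big /= !big_seq; apply: eq_bigr => p pL.
have pS : p.2 \in undup [seq q.2 | q <- L] by rewrite mem_undup map_f.
rewrite (bigD1_seq _ pS (undup_uniq _)) /= eqxx mulr1 big1 ?addr0 // => t.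
by rewrite eq_sym => /negPf ->; rewrite mulr0 mul0r.
Qed.

End averages.

(** * Cutting and gluing trees along an edge *)

Section cut_and_glue.
Local Open Scope fset_scope.

Section links.

Lemma linked_refl (K : choiceType) (g : lgraph K) x : linked g x x.
Proof. by exists [::]. Qed.

Lemma linked_trans (K : choiceType) (g : lgraph K) y x z :
  linked g x y -> linked g y z -> linked g x z.
Proof.
move=> [p [xp <-]] [q [yq <-]]; exists (p ++ q).
by rewrite cat_path xp yq last_cat.
Qed.

Lemma adj_linked (K : choiceType) (g : lgraph K) x y :
  adj g x y -> linked g x y.
Proof. by move=> xy; exists [:: y]; rewrite /= xy. Qed.

Lemma adjC (K : choiceType) (g : lgraph K) x y : adj g x y = adj g y x.
Proof. by rewrite /adj fsetUC. Qed.

(** A map sending edges to walks sends walks to walks; used with inclusions of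
graphs and with the collapsing of a part of a graph to a vertex. *)
Lemma linked_map (K K' : choiceType) (g : lgraph K) (h : lgraph K')
    (f : K -> K') x y : (forall u v, adj g u v -> linked h (f u) (f v)) ->
  linked g x y -> linked h (f x) (f y).
Proof.
move=> gh [p [xp <-]]; elim: p x xp => [|z p IH] x /=.
  by move=> _; exact: linked_refl.
by move=> /andP[/gh xz /IH]; exact: linked_trans.
Qed.

Lemma linked_closed (K : choiceType) (g : lgraph K) (S : K -> Prop) x y :
  (forall u v, adj g u v -> S u -> S v) -> linked g x y -> S x -> S y.
Proof.
move=> gS [p [xp <-]]; elim: p x xp => [|z p IH] x //=.
by move=> /andP[/gS xz /IH zp] /xz.
Qed.

Lemma linked_sym (K : choiceType) (g : lgraph K) x y :
  linked g x y -> linked g y x.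
Proof.
move=> xy; apply: (linked_closed (S := fun z => linked g z x) _ xy).
  by move=> u v uv; apply: linked_trans; apply: adj_linked; rewrite adjC.
exact: linked_refl.
Qed.

End links.

Section trees.
Variable K : choiceType.
Implicit Types (g h : lgraph K) (x y z : K) (e : {fset K}).

Definition simple_edges g :=
  forall e, e \in g.2 -> e `<=` g.1 /\ #|` e| = 2%N.

Definition connected_graph g :=
  forall x y, x \in g.1 -> y \in g.1 -> linked g x y.

Lemma simple_adj g x y : simple_edges g -> adj g x y ->
  [/\ x \in g.1, y \in g.1 & x != y].
Proof.
move=> sg /sg[/fsubsetP eg]; rewrite cardfs2; case: eqP => // _ _.
by split => //; apply: eg; rewrite !inE eqxx ?orbT.
Qed.

Lemma cardfs2P e : #|` e| = 2%N -> exists x y, x != y /\ e = [fset x; y].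
Proof.
move=> e2; have /fset0Pn[x xe] : e != fset0.
  by rewrite -cardfs_eq0 e2.
have /cardfs1P[y ey] : #|` e `\ x| == 1%N.
  by move: e2; rewrite (cardfsD1 x) xe add1n => -[->].
exists x, y; split; last by rewrite -(fsetD1K xe) ey.
by have := fset11 y; rewrite -ey in_fsetD1 eq_sym => /andP[].
Qed.

Lemma simple_edgeP g e : simple_edges g -> e \in g.2 ->
  exists x y, [/\ x != y, e = [fset x; y] & adj g x y].
Proof.
move=> sg eg; have [_ /cardfs2P[x [y [xy ee]]]] := sg e eg.
by exists x, y; split; rewrite ?/adj -?ee.
Qed.

Lemma adj_remove g e x y :
  adj (remove_edge g e) x y = ([fset x; y] != e) && adj g x y.
Proof. by rewrite /adj /= in_fsetD1. Qed.

(** A form of acyclicity that is easier to transport along gluings than the absence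
of cycles. *)
Definition bridged g :=
  forall x y, adj g x y -> ~ linked (remove_edge g [fset x; y]) x y.

Lemma fset2_neq (a b u v : K) : u != a -> u != b -> [fset u; v] != [fset a; b].
Proof.
move=> ua ub; apply/eqP => /fsetP/(_ u).
by rewrite !inE eqxx (negPf ua) (negPf ub).
Qed.

(** A detour around an edge closes up to a cycle, and a cycle provides a detour
around each of its edges. *)
Lemma is_treeP g : is_tree g <->
  [/\ g.1 != fset0, simple_edges g, connected_graph g & bridged g].
Proof.
split=> -[g0 sg cg ag]; split => //.
  move=> x y xy [p [xp]].
  have [_ _ nxy] := simple_adj sg xy.
  case: (shortenP xp) => q xq uq _ qy.
  have xq' : path (adj g) x q.
    by apply: sub_path xq => u v; rewrite adj_remove => /andP[].
  have /ag : cycle (adj g) (x :: q).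
    by rewrite /= rcons_path xq' qy adjC.
  case: q uq xq qy {xq'} => [|z [|t q]] uq /=.
  - by move=> _ e; rewrite e eqxx in nxy.
  - by rewrite andbT adj_remove => /[swap] ->; rewrite eqxx.
  - by move=> _ _ /(_ uq).
move=> [|a [|b [|d q]]] //; rewrite /cycle rcons_cons /= !inE !negb_or.
move=> /and4P[/and3P[ab ad aq] /andP[bd bq] _ _] /and3P[gab gbd gdq]; exfalso.
(* Past its first step, the rest of the cycle avoids both a and b until its end. *)
have stay c r : c != a -> c != b -> a \notin r -> b \notin r ->
    path (adj g) c (rcons r a) ->
    path (adj (remove_edge g [fset a; b])) c (rcons r a).
  elim: r c => [|c' r IH] c ca cb /=.
    by rewrite adj_remove fset2_neq.
  rewrite !inE !negb_or => /andP[c'a ar] /andP[c'b br] /andP[cc' /IH].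
  by rewrite adj_remove fset2_neq // cc' => -> //; rewrite eq_sym.
apply: (ag a b gab); apply: linked_sym.
apply: (linked_trans (y := d)).
  by apply: adj_linked; rewrite adj_remove gbd fsetUC fset2_neq // eq_sym.
exists (rcons q a); rewrite last_rcons; split => //.
by apply: stay => //; rewrite eq_sym.
Qed.

(** The inverse of the removal of the edge {x, y}. *)
Definition glue_graph g1 g2 x y : lgraph K :=
  (g1.1 `|` g2.1, [fset x; y] |` (g1.2 `|` g2.2)).

Definition disjoint_union g1 g2 : lgraph K := (g1.1 `|` g2.1, g1.2 `|` g2.2).

Lemma disjoint_unionC g1 g2 : disjoint_union g1 g2 = disjoint_union g2 g1.
Proof. by rewrite /disjoint_union fsetUC [g1.2 `|` _]fsetUC. Qed.

Lemma fset2_sub x y (A : {fset K}) :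
  ([fset x; y] `<=` A) = (x \in A) && (y \in A).
Proof. by rewrite fsubUset !fsub1set. Qed.

Lemma component_disjoint_union g1 g2 x :
  simple_edges g1 -> simple_edges g2 -> connected_graph g1 ->
  [disjoint g1.1 & g2.1] -> x \in g1.1 ->
  component (disjoint_union g1 g2) x = g1.
Proof.
move=> s1 s2 c1 /fdisjointP d x1.
have link z : `[< linked (disjoint_union g1 g2) x z >] = (z \in g1.1).
  apply/asboolP/idP => [xz|z1].
    apply: (linked_closed (S := fun z => z \in g1.1) _ xz) => // u v.
    rewrite /adj /= in_fsetU => /orP[/(simple_adj s1)[]//|/(simple_adj s2)[u2 _ _]].
    by move=> /d; rewrite u2.
  apply: (linked_map (f := id) _ (c1 _ _ x1 z1)) => u v uv.
  by apply: adj_linked; rewrite /adj /= in_fsetU -/(adj g1 u v) uv.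
have VE : [fset z in g1.1 `|` g2.1 | `[< linked (disjoint_union g1 g2) x z >]]
    = g1.1.
  apply/fsetP => z; rewrite !inE /=.
  by rewrite link; case: (z \in g1.1); rewrite // andbF.
rewrite /component VE; rewrite [RHS]surjective_pairing; congr pair.
apply/fsetP => e; rewrite !inE /=; apply/andP/idP => [[/orP[//|e2] e1]|e1].
  have [u [v [_ ee uv]]] := simple_edgeP s2 e2.
  have [u2 _ _] := simple_adj s2 uv.
  by move: e1; rewrite ee fset2_sub => /andP[/d]; rewrite u2.
by rewrite e1; have [] := s1 e e1.
Qed.

Lemma component_disjoint_unionr g1 g2 y :
  simple_edges g1 -> simple_edges g2 -> connected_graph g2 ->
  [disjoint g1.1 & g2.1] -> y \in g2.1 ->
  component (disjoint_union g1 g2) y = g2.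
Proof.
move=> s1 s2 c2 d y2; rewrite disjoint_unionC component_disjoint_union //.
by rewrite fdisjoint_sym.
Qed.

Lemma remove_glue g1 g2 x y : simple_edges g1 -> simple_edges g2 ->
  [disjoint g1.1 & g2.1] -> x \in g1.1 -> y \in g2.1 ->
  remove_edge (glue_graph g1 g2 x y) [fset x; y] = disjoint_union g1 g2.
Proof.
move=> s1 s2 /fdisjointP d x1 y2; congr pair; rewrite fsetU1K //=.
rewrite in_fsetU negb_or; apply/andP; split; apply/negP.
  by move=> /s1[]; rewrite fset2_sub => /andP[_ /d]; rewrite y2.
by move=> /s2[]; rewrite fset2_sub => /andP[]; rewrite (negPf (d _ x1)).
Qed.

Lemma adj_glue g1 g2 x y : adj (glue_graph g1 g2 x y) x y.
Proof. by rewrite /adj /= fset1U1. Qed.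

(** Collapsing the second part to x turns a detour in the glued graph into a detour
inside the first part. *)
Lemma glue_bridge g1 g2 x y u v : simple_edges g1 -> simple_edges g2 ->
  [disjoint g1.1 & g2.1] -> x \in g1.1 -> y \in g2.1 ->
  adj g1 u v -> linked (remove_edge (glue_graph g1 g2 x y) [fset u; v]) u v ->
  linked (remove_edge g1 [fset u; v]) u v.
Proof.
move=> s1 s2 /fdisjointP d x1 y2 uv.
pose f z := if z \in g1.1 then z else x.
have [u1 v1 _] := simple_adj s1 uv.
move=> uvl; suff : linked (remove_edge g1 [fset u; v]) (f u) (f v).
  by rewrite /f u1 v1.
apply: linked_map uvl => a b; rewrite adj_remove /adj /= !in_fsetU in_fset1.
have ny : y \in g1.1 = false by apply/negP => /d; rewrite y2.
move=> /andP[abuv /or3P[/eqP e|ab|ab]]; rewrite /f.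
- have aE : a \in [fset x; y] by rewrite -e !inE eqxx.
  have bE : b \in [fset x; y] by rewrite -e !inE eqxx orbT.
  move: aE bE; rewrite !inE.
  by move=> /orP[]/eqP -> /orP[]/eqP ->; rewrite ?x1 ?ny; exact: linked_refl.
- have [a1 b1 _] := simple_adj s1 ab.
  by rewrite a1 b1; apply: adj_linked; rewrite adj_remove abuv.
- have [a2 b2 _] := simple_adj s2 ab.
  have -> : a \in g1.1 = false by apply/negP => /d; rewrite a2.
  have -> : b \in g1.1 = false by apply/negP => /d; rewrite b2.
  exact: linked_refl.
Qed.

Lemma glueC g1 g2 x y : glue_graph g1 g2 x y = glue_graph g2 g1 y x.
Proof. by rewrite /glue_graph fsetUC [g1.2 `|` _]fsetUC [[fset x; y]]fsetUC. Qed.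

(** Together with [split_tree]: trees with a marked oriented edge are the same as
pairs of disjoint trees with one marked vertex in each. *)
Lemma glue_tree g1 g2 x y : is_tree g1 -> is_tree g2 ->
  [disjoint g1.1 & g2.1] -> x \in g1.1 -> y \in g2.1 ->
  is_tree (glue_graph g1 g2 x y).
Proof.
move=> /is_treeP[n1 s1 c1 b1] /is_treeP[n2 s2 c2 b2] d x1 y2.
have d' : [disjoint g2.1 & g1.1] by rewrite fdisjoint_sym.
apply/is_treeP; split.
- by apply/fset0Pn; exists x; rewrite in_fsetU x1.
- move=> e; rewrite /= !in_fsetU in_fset1 => /or3P[/eqP ->|/s1[es e2]|/s2[es e2]].
  + rewrite fset2_sub !in_fsetU x1 y2 orbT cardfs2; split => //.
    by case: eqP y2 => // <-; rewrite (negPf (fdisjointP d _ x1)).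
  + by split => //; apply: (fsubset_trans es); rewrite fsubsetUl.
  + by split => //; apply: (fsubset_trans es); rewrite fsubsetUr.
- have to_x z : z \in (glue_graph g1 g2 x y).1 -> linked (glue_graph g1 g2 x y) x z.
    rewrite in_fsetU => /orP[z1|z2].
      apply: (linked_map (f := id) _ (c1 _ _ x1 z1)) => u v uv.
      by apply: adj_linked; rewrite /adj /= !in_fsetU -/(adj g1 u v) uv orbT.
    apply: linked_trans (adj_linked (adj_glue g1 g2 x y)) _.
    apply: (linked_map (f := id) _ (c2 _ _ y2 z2)) => u v uv.
    by apply: adj_linked; rewrite /adj /= !in_fsetU -/(adj g2 u v) uv !orbT.
  by move=> u v /to_x xu /to_x; apply: linked_trans; exact: linked_sym.
- move=> u v; rewrite {1}/adj /= !in_fsetU in_fset1 => /or3P[/eqP e|uv|uv].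
  + rewrite e remove_glue // => uvl.
    have xyl : linked (disjoint_union g1 g2) x y.
      have uE : u \in [fset x; y] by rewrite -e !inE eqxx.
      have vE : v \in [fset x; y] by rewrite -e !inE eqxx orbT.
      have xE : x \in [fset u; v] by rewrite e !inE eqxx.
      have yE : y \in [fset u; v] by rewrite e !inE eqxx orbT.
      move: xE yE; rewrite !inE.
      move=> /orP[]/eqP -> /orP[]/eqP -> //; try exact: linked_refl.
      exact: linked_sym.
    have : component (disjoint_union g1 g2) x = g1.
      exact: component_disjoint_union.
    move=> /(congr1 fst)/fsetP/(_ y).
    rewrite !inE y2 orbT /= (negPf (fdisjointP d' _ y2)).
    by move=> /asboolPn.
  + by move=> /(glue_bridge s1 s2 d x1 y2 uv); exact: b1.
  + rewrite glueC => /(glue_bridge s2 s1 d' y2 x1 uv); exact: b2.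
Qed.

Lemma split_tree g x y : is_tree g -> adj g x y ->
  let g1 := component (remove_edge g [fset x; y]) x in
  let g2 := component (remove_edge g [fset x; y]) y in
  [/\ is_tree g1, is_tree g2, [disjoint g1.1 & g2.1]
    & [/\ x \in g1.1, y \in g2.1 & g = glue_graph g1 g2 x y]].
Proof.
move=> tg xy g1 g2; have [n sg cg bg] := (is_treeP g).1 tg.
set g' := remove_edge g _ in g1 g2 *.
have [xg yg nxy] := simple_adj sg xy.
have g'g u v : adj g' u v -> adj g u v by rewrite adj_remove => /andP[].
have comp_tree z : z \in g.1 -> is_tree (component g' z) /\ z \in (component g' z).1.
  move=> zg; have zz : z \in (component g' z).1.
    by rewrite !inE zg; apply/asboolP; exact: linked_refl.
  split => //; case: tg => _ _ _ ag; split.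
  - by apply/fset0Pn; exists z.
  - move=> e; rewrite !inE => /andP[/andP[_ eg] es].
    by split => //; case: (sg e eg).
  - suff to_z u : u \in (component g' z).1 -> linked (component g' z) z u.
      by move=> u v /to_z zu /to_z; apply: linked_trans; exact: linked_sym.
    rewrite !inE => /andP[_ /asboolP zu].
    suff [] : linked (component g' z) z u /\ u \in (component g' z).1 by [].
    apply: (linked_closed (S := fun u => linked (component g' z) z u /\
      u \in (component g' z).1) _ zu); last by split => //; exact: linked_refl.
    move=> a b ab [za az].
    have [ag' za'] : a \in g.1 /\ linked g' z a.
      by move: az; rewrite !inE => /andP[? /asboolP].
    have [_ bg' _] := simple_adj sg (g'g _ _ ab).
    have bz : b \in (component g' z).1.
      rewrite !inE bg'; apply/asboolP; apply: linked_trans za' _.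
      exact: adj_linked.
    split => //; apply: (linked_trans za); apply: adj_linked.
    rewrite /adj !inE -!andbA; apply/and3P; split.
    - by move: ab; rewrite adj_remove => /andP[].
    - exact: g'g.
    - rewrite fset2_sub bz andbT !inE ag'; exact/asboolP.
  - move=> c uc cc; apply: ag => //; apply: sub_cycle cc => u v.
    by rewrite /adj !inE => /andP[/andP[]].
have [t1 x1] := comp_tree x xg.
have [t2 y2] := comp_tree y yg.
have linkedP z : z \in g.1 -> linked g' x z \/ linked g' y z.
  move=> zg; apply: (linked_closed (S := fun z => linked g' x z \/ linked g' y z)
    _ (cg x z xg zg)); last by left; exact: linked_refl.
  move=> u v uv uS; have [e|ne] := eqVneq [fset u; v] [fset x; y].
    have : v \in [fset x; y] by rewrite -e !inE eqxx orbT.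
    by rewrite !inE => /orP[]/eqP ->; [left|right]; exact: linked_refl.
  have uv' : linked g' u v by apply: adj_linked; rewrite adj_remove ne.
  by case: uS => [xu|yu]; [left|right]; exact: linked_trans uv'.
split => //.
  apply/fdisjointP => z; rewrite !inE => /andP[zg /asboolP xz].
  rewrite zg; apply/asboolPn => yz; apply: (bg x y xy).
  by apply: linked_trans xz _; exact: linked_sym.
split => //; rewrite [LHS]surjective_pairing; congr pair.
  apply/fsetP => z; rewrite in_fsetU !inE.
  have [zg|] := boolP (z \in g.1); last by [].
  by apply/esym/orP; case: (linkedP z zg) => h; [left|right]; apply/asboolP.
apply/fsetP => e; rewrite in_fsetU in_fset1 in_fsetU.
have [->|ne] := eqVneq e [fset x; y]; first exact: xy.
have [eg|] := boolP (e \in g.2); last by rewrite !inE => /negbTE ->; rewrite andbF.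
rewrite /= !inE ne eg /=; apply/esym.
have [u [v [_ ee uv]]] := simple_edgeP sg eg.
have [ug vg _] := simple_adj sg uv.
have uv' : linked g' u v by apply: adj_linked; rewrite adj_remove -ee ne.
rewrite ee !fset2_sub !inE ug vg /=.
by case: (linkedP u ug) => h; apply/orP; [left|right]; apply/andP; split;
  apply/asboolP => //; exact: linked_trans h uv'.
Qed.

End trees.

End cut_and_glue.

(** * The law of the cut-tree as an average *)

Section cut_tree_law.
Local Open Scope fset_scope.

Section cut_mean.
Variables (R : realType) (K : choiceType).
Implicit Types (g : lgraph K) (phi : tree -> R).

Lemma average_cut_mean m g : average (fun phi : tree -> R => cut_mean m g phi).
Proof.
elim: m g => [|m IH] g /=; case: (#|` g.1| <= 1)%N; try exact: average_leaf.
  exact: average0.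
apply: averageZ; first by rewrite invr_ge0.
apply: average_sum => e _.
case: (enum_fset e) => [|x [|y [|z r]]]; try exact: average0.
apply: (average_join (M := @cut_mean K R m (component (remove_edge g e) x))
  (N := @cut_mean K R m (component (remove_edge g e) y))); exact: IH.
Qed.

(** A function of the ends of an edge that does not depend on their order can be
computed from any listing of the edge. *)
Lemma match_edge (G : K -> K -> R) x y : x != y -> G x y = G y x ->
  (if enum_fset [fset x; y] is [:: a; b] then G a b else 0) = G x y.
Proof.
move=> xy Gxy; have := fset_uniq [fset x; y].
have : #|` [fset x; y]| = 2%N by rewrite cardfs2 xy.
have : forall z, (z \in enum_fset [fset x; y]) = (z == x) || (z == y).
  by move=> z; rewrite -[RHS]in_fset2.
rewrite /= cardfE -cardfE.
case: (enum_fset _) => [|a [|b [|c r]]] //= zE _; rewrite inE andbT => ab.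
have := zE a; have := zE b; rewrite !inE !eqxx orbT /=.
move=> /esym/orP[]/eqP e /esym/orP[]/eqP e'; rewrite e e' //.
- by rewrite e e' eqxx in ab.
- by rewrite e e' eqxx in ab.
Qed.

(** The contribution of the edge {x, y} to one step of the recursion of [cut_mean],
with its fuel m. *)
Definition edge_average m g x y phi :=
  join_average (cut_mean m (component (remove_edge g [fset x; y]) x))
    (cut_mean m (component (remove_edge g [fset x; y]) y)) phi.

Lemma edge_averageC m g x y phi :
  edge_average m g x y phi = edge_average m g y x phi.
Proof.
rewrite /edge_average [[fset y; x]]fsetUC.
by apply: join_averageC; exact: average_cut_mean.
Qed.

Lemma cut_meanS m g phi : simple_edges g -> (1 < #|` g.1|)%N ->
  forall F : {fset K} -> R,
  (forall x y, adj g x y -> F [fset x; y] = edge_average m g x y phi) ->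
  cut_mean m.+1 g phi = #|` g.2|%:R^-1 * \sum_(e <- g.2) F e.
Proof.
move=> sg g1 F FE /=; rewrite leqNgt g1 /=; congr (_ * _).
rewrite big_seq [RHS]big_seq; apply: eq_bigr => e eg.
have [x [y [xy ee xye]]] := simple_edgeP sg eg.
rewrite ee (FE _ _ xye); pose g' := remove_edge g [fset x; y].
pose G a b := join_average (@cut_mean K R m (component g' a))
  (@cut_mean K R m (component g' b)) phi.
have GC : G x y = G y x by apply: join_averageC; exact: average_cut_mean.
exact: (match_edge xy GC).
Qed.

(** The expectation of phi (Cut (g)): [cut_mean] with enough fuel. *)
Definition cut_average g phi : R := cut_mean #|` g.1| g phi.

Lemma average_cut_average g : average (cut_average g).
Proof. exact: average_cut_mean. Qed.

Lemma cut_average_leaf g phi : (#|` g.1| <= 1)%N -> cut_average g phi = phi leaf.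
Proof.
by move=> g1; rewrite /cut_average; move: {1}#|` g.1| => [|m] /=; rewrite g1.
Qed.

Lemma card_glue g1 g2 x y : [disjoint g1.1 & g2.1] ->
  #|` (glue_graph g1 g2 x y).1| = (#|` g1.1| + #|` g2.1|)%N.
Proof. by rewrite cardfsU => /eqP ->; rewrite cardfs0 subn0. Qed.

Lemma card_component g x y : is_tree g -> adj g x y ->
  (#|` (component (remove_edge g [fset x; y]) x).1| < #|` g.1|)%N /\
  (#|` (component (remove_edge g [fset x; y]) y).1| < #|` g.1|)%N.
Proof.
move=> tg xy; have [_ _ d [x1 y2 gE]] := split_tree tg xy.
have e := card_glue x y d; rewrite -gE in e; rewrite e.
set c1 := component _ x in x1 *; set c2 := component _ y in y2 *.
have : (0 < #|` c1.1|)%N by rewrite cardfs_gt0; apply/fset0Pn; exists x.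
have : (0 < #|` c2.1|)%N by rewrite cardfs_gt0; apply/fset0Pn; exists y.
by split; [rewrite -addn1 leq_add2l|rewrite -add1n leq_add2r].
Qed.

(** Both parts of a cut tree are strictly smaller, so the fuel is never exhausted. *)
Lemma cut_mean_fuel m g phi : is_tree g -> (#|` g.1| <= m.+1)%N ->
  cut_mean m g phi = cut_average g phi.
Proof.
suff H m1 m2 : is_tree g -> (#|` g.1| <= m1.+1)%N -> (#|` g.1| <= m2.+1)%N ->
    cut_mean m1 g phi = cut_mean m2 g phi :> R.
  by move=> tg gm; apply: H.
elim: m1 m2 g phi => [|m1 IH] [|m2] g phi tg g1 g2 //.
- by rewrite /= g1.
- by rewrite /= g2.
have [gle|ggt] := leqP #|` g.1| 1; first by rewrite /= gle.
have [_ sg _ _] := (is_treeP g).1 tg.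
have [F FE] : exists F : {fset K} -> R,
    forall x y, adj g x y -> F [fset x; y] = edge_average m1 g x y phi.
  exists (fun e => if enum_fset e is [:: x; y] then edge_average m1 g x y phi
    else 0) => x y xy; have [_ _ nxy] := simple_adj sg xy.
  exact: (match_edge nxy (edge_averageC m1 g x y phi)).
rewrite (cut_meanS sg ggt FE) (cut_meanS sg ggt (F := F)) // => x y xy.
rewrite FE //; have [t1 t2 _ _] := split_tree tg xy.
have [c1 c2] := card_component tg xy.
rewrite /edge_average /join_average (IH m2) //; try lia.
by congr cut_mean; apply/funext => t; rewrite (IH m2) //; lia.
Qed.

(** The conditional expectation of phi (Cut (g)) given that the first edge to be cut
is {x, y}. *)
Definition edge_cut g x y phi :=
  join_average (cut_average (component (remove_edge g [fset x; y]) x))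
    (cut_average (component (remove_edge g [fset x; y]) y)) phi.

Lemma edge_cutC g x y phi : edge_cut g x y phi = edge_cut g y x phi.
Proof.
rewrite /edge_cut [[fset y; x]]fsetUC.
by apply: join_averageC; exact: average_cut_average.
Qed.

Lemma adj_exists g : is_tree g -> (1 < #|` g.1|)%N -> exists x y, adj g x y.
Proof.
move=> [_ _ cg _] g1.
have /fset0Pn[x xg] : g.1 != fset0 by rewrite -cardfs_gt0 ltnW.
have /fset0Pn[y] : g.1 `\ x != fset0.
  by move: g1; rewrite (cardfsD1 x) xg -cardfs_gt0.
rewrite in_fsetD1 => /andP[yx yg].
have [[|z p] [/= xp e]] := cg x y xg yg; first by rewrite e eqxx in yx.
by exists x, z; case/andP: xp.
Qed.

Lemma card_tree_edges g : is_tree g -> #|` g.2|.+1 = #|` g.1|.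
Proof.
have [n] := ubnP #|` g.1|; elim: n g => // n IH g gn tg.
have [n0 sg _ _] := (is_treeP g).1 tg.
have [gle|ggt] := leqP #|` g.1| 1.
  suff -> : g.2 = fset0.
    by apply/eqP; rewrite cardfs0 eqn_leq gle andbT cardfs_gt0.
  apply/fsetP => e; rewrite in_fset0; apply/negP => /sg[/fsubset_leq_card].
  by move=> /leq_trans/(_ gle) /[swap] ->.
have [x [y xy]] := adj_exists tg ggt.
have [c1 c2] := card_component tg xy.
have [t1 t2 d [x1 y2 gE]] := split_tree tg xy.
have [_ s1 _ _] := (is_treeP _).1 t1; have [_ s2 _ _] := (is_treeP _).1 t2.
have e1 := IH _ (leq_trans c1 gn) t1; have e2 := IH _ (leq_trans c2 gn) t2.
rewrite gE card_glue // -e1 -e2.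
move: (component _ x) (component _ y) t1 t2 d x1 y2 s1 s2 {gE c1 c2 e1 e2}.
move=> g1 g2 t1 t2 d x1 y2 s1 s2; rewrite /glue_graph /=.
have dE : g1.2 `&` g2.2 = fset0.
  apply/fsetP => e; rewrite in_fset0 in_fsetI; apply/negP => /andP[].
  move=> /(simple_edgeP s1)[u [v [_ -> uv]]].
  have [u1 _ _] := simple_adj s1 uv.
  by move=> /s2[]; rewrite fset2_sub (negPf (fdisjointP d _ u1)).
have xyN : [fset x; y] \notin g1.2 `|` g2.2.
  rewrite in_fsetU negb_or; apply/andP; split; apply/negP.
    by move=> /s1[]; rewrite fset2_sub (negPf (fdisjointP_sym d _ y2)) andbF.
  by move=> /s2[]; rewrite fset2_sub (negPf (fdisjointP d _ x1)).
by rewrite cardfsU1 xyN cardfsU dE cardfs0 subn0 addSn add1n addnS.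
Qed.

(** The first edge is uniform among the |V| - 1 edges of the tree. *)
Lemma cut_average_edges g phi (F : {fset K} -> R) :
  is_tree g -> (1 < #|` g.1|)%N ->
  (forall x y, adj g x y -> F [fset x; y] = edge_cut g x y phi) ->
  #|` g.1|.-1%:R * cut_average g phi = \sum_(e <- g.2) F e.
Proof.
move=> tg g1 FE; have gE := card_tree_edges tg.
have [_ sg _ _] := (is_treeP g).1 tg.
rewrite -(cut_mean_fuel (m := #|` g.1|.-2.+1)) //; last lia.
rewrite (cut_meanS sg g1 (F := F)) => [|x y xy].
  by rewrite -gE /= mulVKf // pnatr_eq0 -lt0n -ltnS gE.
have [t1 t2 _ _] := split_tree tg xy; have [c1 c2] := card_component tg xy.
rewrite FE // /edge_cut /edge_average /join_average.
rewrite (cut_mean_fuel (m := #|` g.1|.-2)) //; last lia.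
apply: eq_average => [|t]; first exact: average_cut_average.
by rewrite (cut_mean_fuel (m := #|` g.1|.-2)) //; lia.
Qed.

Definition edge_term g phi (e : {fset K}) : R :=
  if enum_fset e is [:: x; y] then edge_cut g x y phi else 0.

Lemma edge_termE g phi x y : x != y ->
  edge_term g phi [fset x; y] = edge_cut g x y phi.
Proof. by move=> xy; exact: (match_edge xy (edge_cutC g x y phi)). Qed.

Lemma cut_average_edge_terms g phi : is_tree g -> (1 < #|` g.1|)%N ->
  #|` g.1|.-1%:R * cut_average g phi = \sum_(e <- g.2) edge_term g phi e.
Proof.
move=> tg g1; apply: cut_average_edges => // x y.
have [_ sg _ _] := (is_treeP g).1 tg.
by move=> /(simple_adj sg)[_ _ xy]; exact: edge_termE.
Qed.

Lemma cut_average1 g : is_tree g -> cut_average g (fun=> 1) = 1.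
Proof.
have [n] := ubnP #|` g.1|; elim: n g => // n IH g gn tg.
have [gle|ggt] := leqP #|` g.1| 1; first by rewrite cut_average_leaf.
have gE := card_tree_edges tg.
apply: (@mulfI _ #|` g.1|.-1%:R); first by rewrite pnatr_eq0; lia.
rewrite (cut_average_edges tg ggt (F := fun=> 1)) => [|x y xy].
  by rewrite big_const_seq count_predT iter_addr_0 mulr1 -gE.
have [t1 t2 _ _] := split_tree tg xy; have [c1 c2] := card_component tg xy.
rewrite /edge_cut /join_average (eq_average (average_cut_average _) (psi := fun=> 1)) => [|t].
  by rewrite IH //; exact: leq_trans c1 gn.
by rewrite IH //; exact: leq_trans c2 gn.
Qed.

End cut_mean.

End cut_tree_law.

(** * Cut-trees of uniform labelled trees *)

Section labelled_cut_trees.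
Local Open Scope fset_scope.

Section cayley_average.
Variable R : realType.
Implicit Types (phi : tree -> R).

(** The recursion that the laws of the cut-trees of uniform labelled trees and of
size-conditioned Galton-Watson trees have in common, normalised to have total mass
n^(n-1) / n!. The argument m is fuel. *)
Fixpoint cayley_rec m n phi : R :=
  if (n <= 1)%N then phi leaf else
  if m isn't m'.+1 then 0 else
  n%:R / (2 * n.-1%:R) *
    \sum_(1 <= k < n) join_average (cayley_rec m' k) (cayley_rec m' (n - k)%N) phi.

Definition cayley_sum n phi := cayley_rec n n phi.

Lemma average_cayley_rec m n : average (cayley_rec m n).
Proof.
elim: m n => [|m IH] n.
  have [n1|n1] := leqP n 1.
    have -> : cayley_rec 0 n = fun phi => phi leaf.
      by apply/funext => phi; rewrite /= n1.
    exact: average_leaf.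
  have -> : cayley_rec 0 n = fun=> 0.
    by apply/funext => phi; rewrite /= leqNgt n1.
  exact: average0.
have [n1|n1] := leqP n 1.
  have -> : cayley_rec m.+1 n = fun phi => phi leaf.
    by apply/funext => phi; rewrite /= n1.
  exact: average_leaf.
have -> : cayley_rec m.+1 n = fun phi => n%:R / (2 * n.-1%:R) *
    \sum_(1 <= k < n) join_average (cayley_rec m k) (cayley_rec m (n - k)) phi.
  by apply/funext => phi; rewrite /= leqNgt n1.
apply: averageZ; first by rewrite mulr_ge0 ?invr_ge0 ?mulr_ge0.
by apply: average_sum => k _; exact: (average_join (IH k) (IH (n - k)%N)).
Qed.

Lemma average_cayley_sum n : average (cayley_sum n).
Proof. exact: average_cayley_rec. Qed.

Lemma cayley_rec_fuel m m' n phi : (n <= m.+1)%N -> (n <= m'.+1)%N ->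
  cayley_rec m n phi = cayley_rec m' n phi.
Proof.
elim: m m' n phi => [|m IH] [|m'] n phi nm nm'; rewrite /= ?nm ?nm' //.
case: ifP => // _; congr (_ * _)%R; rewrite big_nat [RHS]big_nat.
apply: eq_bigr => k /andP[k0 kn].
rewrite /join_average (IH m'); [|lia|lia].
apply: (eq_average (average_cayley_rec _ _)) => t.
by apply: IH; lia.
Qed.

Lemma cayley_sum1 phi : cayley_sum 1 phi = phi leaf.
Proof. by []. Qed.

Lemma cayley_sumE n phi : (1 < n)%N -> cayley_sum n phi =
  n%:R / (2 * n.-1%:R) *
    \sum_(1 <= k < n) join_average (cayley_sum k) (cayley_sum (n - k)) phi.
Proof.
move=> n1; rewrite /cayley_sum (@cayley_rec_fuel _ n.-2.+1); [|lia|lia].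
rewrite /= leqNgt n1 /=; congr (_ * _)%R; rewrite big_nat [RHS]big_nat.
apply: eq_bigr => k /andP[k0 kn].
rewrite /join_average (@cayley_rec_fuel _ k k); [|lia|lia].
apply: (eq_average (average_cayley_rec _ _)) => t.
by apply: cayley_rec_fuel; lia.
Qed.

(** The total mass satisfies the recursion of [cayley_coef_rec]. *)
Lemma cayley_sum_const n : (0 < n)%N -> cayley_sum n (fun=> 1) = cayley_coef R n.
Proof.
elim/ltn_ind: n => n IH n0; have [n1|n1] := leqP n 1.
  have -> : n = 1%N by lia.
  by rewrite cayley_sum1 cayley_coef1.
have n1' : n.-1%:R != 0 :> R by rewrite pnatr_eq0; lia.
rewrite cayley_sumE //; apply: (@mulfI _ (2 * n.-1%:R)).
  by rewrite mulf_neq0 // pnatr_eq0.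
rewrite mulrA mulrCA divff ?mulf_neq0 ?pnatr_eq0 // ?mulr1; last by lia.
rewrite cayley_coef_rec //; congr (_ * _)%R; rewrite big_nat [RHS]big_nat.
apply: eq_bigr => k /andP[k0 kn]; rewrite /join_average.
rewrite (eq_average (average_cayley_sum k) (psi := fun=> cayley_coef R (n - k) * 1)).
  by rewrite average_linZ ?IH 1?mulrC //; exact: average_cayley_sum.
by move=> t; rewrite IH ?mulr1 //; lia.
Qed.

End cayley_average.

Section labelled.
Variables (R : realType) (K : finType).
Implicit Types (g : lgraph K) (V W : {fset K}) (phi : tree -> R).

Lemma sum_fset_const V (c : R) : \sum_(x in V) c = #|` V|%:R * c.
Proof.
by rewrite -big_uniq ?fset_uniq //= big_const_seq count_predT iter_addr_0 mulr_natl.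
Qed.

(** Each edge is counted once per orientation. *)
Lemma sum_adj g (F : {fset K} -> R) (G : K * K -> R) : simple_edges g ->
  (forall x y, adj g x y -> F [fset x; y] = G (x, y)) ->
  \sum_(p : K * K | adj g p.1 p.2) G p = 2 * \sum_(e <- g.2) F e.
Proof.
move=> sg FG; rewrite (partition_big (fun p : K * K => [fset p.1; p.2])
  (fun e => e \in g.2)) //=.
rewrite big_uniq ?fset_uniq //= mulr_sumr; apply: eq_bigr => e eg.
have [x [y [xy ee xye]]] := simple_edgeP sg eg.
rewrite (bigD1 (x, y)) /= ?xye ?ee ?eqxx // (bigD1 (y, x)) /=; last first.
  by rewrite adjC xye fsetUC !eqxx xpair_eqE negb_and eq_sym xy.
rewrite big1 ?addr0; last first.
  move=> [a b] /= /andP[/andP[/andP[ab /eqP e1] ne1] ne2]; exfalso.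
  have [_ _ nab] := simple_adj sg ab.
  have : a \in [fset x; y] by rewrite -e1 !inE eqxx.
  have : b \in [fset x; y] by rewrite -e1 !inE eqxx orbT.
  rewrite !inE => /orP[]/eqP bE /orP[]/eqP aE; rewrite aE bE ?eqxx // in ne1 ne2 nab.
rewrite -!FG // 1?adjC // [[fset y; x]]fsetUC mulr_natl mulr2n //.
Qed.

(** There are binomially many subsets of each size. *)
Lemma sum_fsubset V (G : nat -> R) :
  \sum_(W : {fset K} | W `<=` V) G #|` W|
  = \sum_(k < #|` V|.+1) 'C(#|` V|, k)%:R * G k.
Proof.
have cardW (W : {fset K}) : #|` W| = #|[set x in W]%SET|.
  rewrite cardsE -(card_uniqP (fset_uniq W)); exact: eq_card.
rewrite (partition_big (fun W => inord #|` W| : 'I_#|` V|.+1) predT) //=.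
apply: eq_bigr => k _; rewrite (eq_bigr (fun=> G k)); last first.
  move=> W /andP[WV /eqP <-]; rewrite inordK // ltnS.
  exact: fsubset_leq_card.
rewrite sumr_const mulr_natl; congr (_ *+ _)%R.
transitivity #|[set A : {set K} | A \subset [set x in V]%SET & #|A| == k]%SET|;
  last by rewrite cards_draws -cardW.
rewrite -(card_in_imset (f := fun W : {fset K} => [set x in W]%SET)).
  apply: eq_card => A; rewrite inE; apply/imsetP/andP => [[W]|[AV /eqP Ak]].
    rewrite unfold_in => /andP[WV /eqP <-] ->; split.
      by apply/fintype.subsetP => x; rewrite !inE; exact: (fsubsetP WV).
    by rewrite inordK ?cardW // -!cardW ltnS fsubset_leq_card.
  have AE : A = [set x in [fset x in A]]%SET by apply/setP => x; rewrite !inE.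
  exists [fset x in A] => //; rewrite unfold_in; apply/andP; split.
    by apply/fsubsetP => x; rewrite !inE => /(fintype.subsetP AV); rewrite inE.
  have kE : #|` [fset x in A]| = k by rewrite cardW -AE.
  by apply/eqP/val_inj; rewrite /= inordK kE.
move=> W W' _ _ /setP e; apply/fsetP => x; have := e x; by rewrite !inE.
Qed.

Lemma fsetUDl_disjoint V W : [disjoint V & W]%fset -> (V `|` W) `\` V = W.
Proof.
move=> d; apply/fsetP => x; rewrite !inE.
by have [xV|//] := boolP (x \in V); rewrite (negPf (fdisjointP d _ xV)).
Qed.

Definition trees_on V : pred (lgraph K) :=
  fun g => (g.1 == V) && `[< is_tree g >].

Definition tree_pairs V : pred (lgraph K * lgraph K) := fun q =>
  [&& `[< is_tree q.1 >], `[< is_tree q.2 >], [disjoint q.1.1 & q.2.1]%fset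
    & q.1.1 `|` q.2.1 == V].

Definition pair_average (q : lgraph K * lgraph K) phi : R :=
  join_average (cut_average q.1) (cut_average q.2) phi.

(** Cutting at the marked edge is a bijection onto pairs of trees with one marked
vertex each, with inverse the gluing. *)
Lemma sum_marked_trees V phi x y :
  \sum_(g : lgraph K | trees_on V g && adj g x y) edge_cut g x y phi
  = \sum_(q : lgraph K * lgraph K | tree_pairs V q && ((x \in q.1.1) && (y \in q.2.1)))
      pair_average q phi.
Proof.
pose h (q : lgraph K * lgraph K) : lgraph K := glue_graph q.1 q.2 x y.
pose h' g := (component (remove_edge g [fset x; y]) x,
  component (remove_edge g [fset x; y]) y).
have h'K g : trees_on V g && adj g x y -> h (h' g) = g.
  by move=> /andP[/andP[_ /asboolP tg] /(split_tree tg)[_ _ _ [_ _ gE]]]; rewrite /h /= -gE.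
have hK q : tree_pairs V q && ((x \in q.1.1) && (y \in q.2.1)) -> h' (h q) = q.
  move=> /andP[/and4P[/asboolP t1 /asboolP t2 d _] /andP[x1 y2]].
  have [_ s1 c1 _] := (is_treeP _).1 t1; have [_ s2 c2 _] := (is_treeP _).1 t2.
  rewrite /h' /h remove_glue // component_disjoint_union //.
  by rewrite component_disjoint_unionr // -surjective_pairing.
rewrite (reindex_onto h h' h'K) /=; apply: eq_big => [q|q].
  apply/idP/idP.
    move=> /andP[/andP[/andP[/eqP V_ /asboolP tg] /(split_tree tg)]] /[swap].
    move=> /eqP qE; rewrite -[component _ x]/(h' (h q)).1.
    rewrite -[component _ y]/(h' (h q)).2 qE => -[t1 t2 d [x1 y2 _]].
    by rewrite /tree_pairs d x1 y2 -V_ eqxx !asboolT.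
  move=> /[dup] /hK -> /andP[/and4P[/asboolP t1 /asboolP t2 d /eqP V_] /andP[x1 y2]].
  by rewrite eqxx /trees_on /h /= V_ eqxx adj_glue asboolT //; exact: glue_tree.
move=> /andP[_ /eqP qE]; rewrite /edge_cut -[component _ x]/(h' (h q)).1.
by rewrite -[component _ y]/(h' (h q)).2 qE.
Qed.

(** Sum over all trees on V the recursion of the cut-tree, and exchange the sum over
the tree with the sum over the edge: a pair of trees of sizes k and n - k arises from
k (n - k) oriented edges. *)
Lemma sum_trees_on_rec V phi : (1 < #|` V|)%N ->
  2 * #|` V|.-1%:R * \sum_(g : lgraph K | trees_on V g) cut_average g phi
  = \sum_(q | tree_pairs V q) (#|` q.1.1| * #|` q.2.1|)%:R * pair_average q phi.
Proof.
move=> V1.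
transitivity (\sum_(g : lgraph K | trees_on V g)
    \sum_(p : K * K | adj g p.1 p.2) edge_cut g p.1 p.2 phi).
  rewrite mulr_sumr; apply: eq_bigr => g /andP[/eqP gV /asboolP tg].
  have [_ sg _ _] := (is_treeP g).1 tg.
  rewrite (sum_adj (F := edge_term g phi)) // => [|x y /(simple_adj sg)[_ _ xy]].
    by rewrite -mulrA -gV cut_average_edge_terms // gV.
  exact: edge_termE.
rewrite (exchange_big_dep predT) //=.
under eq_bigr do rewrite sum_marked_trees.
rewrite (exchange_big_dep (tree_pairs V)) /=; last by move=> p q _ /andP[].
apply: eq_bigr => q qV.
under eq_bigl do rewrite qV /=.
rewrite -(pair_big (mem q.1.1) (mem q.2.1) (fun _ _ => pair_average q phi)) /=.
by rewrite !sum_fset_const mulrA natrM.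
Qed.

Lemma trees_on_single x phi :
  \sum_(g : lgraph K | trees_on [fset x] g) cut_average g phi = phi leaf.
Proof.
rewrite (big_pred1 ([fset x], fset0)).
  by rewrite cut_average_leaf //= cardfs1.
move=> [V E]; rewrite /trees_on /= xpair_eqE /=; apply/andP/andP => -[/eqP VE].
  move=> /asboolP t; split; first exact/eqP.
  have := card_tree_edges t; rewrite VE /= cardfs1 => -[].
  by move=> /cardfs0_eq ->.
move=> /eqP ->; split; first exact/eqP.
apply/asboolP/is_treeP; rewrite VE; split => //=.
- by apply/fset0Pn; exists x; rewrite inE.
- by move=> u v; rewrite !inE => /eqP -> /eqP ->; exact: linked_refl.
Qed.

Lemma fact_pred m : (0 < m)%N -> m`! = (m * m.-1`!)%N.
Proof. by case: m. Qed.

(** Induction on the size of V inside a fixed vertex type: choosing the vertex set W of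
one part gives a binomial coefficient, so the sums divided by factorials satisfy the
recursion of [cayley_sum]. For a constant phi this is Cayley's formula. *)
Theorem sum_labelled_trees V phi : V != fset0 ->
  \sum_(g : lgraph K | trees_on V g) cut_average g phi
  = #|` V|.-1`!%:R * cayley_sum #|` V| phi.
Proof.
have [n] := ubnP #|` V|; elim: n V phi => // n IH V phi Vn V0.
have [Vle|Vgt] := leqP #|` V| 1.
  have /cardfs1P[x ->] : #|` V| == 1%N.
    by rewrite eqn_leq Vle cardfs_gt0.
  by rewrite trees_on_single cardfs1 cayley_sum1 fact0 mul1r.
have V1 : #|` V|.-1%:R != 0 :> R by rewrite pnatr_eq0; lia.
apply: (@mulfI _ (2 * #|` V|.-1%:R)); first by rewrite mulf_neq0 // pnatr_eq0.
rewrite sum_trees_on_rec //.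
(* The value of the inner sums depends only on the size of W; it is 0 at the two ends
   because no tree has an empty vertex set. *)
pose N := #|` V|; pose J k := join_average (@cayley_sum R k) (cayley_sum (N - k)) phi.
pose G k : R := if (0 < k < N)%N then (k`! * (N - k)`!)%:R * J k else 0.
transitivity (\sum_(W : {fset K} | W `<=` V) G #|` W|).
  rewrite (partition_big (fun q : lgraph K * lgraph K => q.1.1)
    (fun W => W `<=` V)) /=; last first.
    by move=> q /and4P[_ _ _ /eqP <-]; exact: fsubsetUl.
  apply: eq_bigr => W WV.
  have cW : #|` V `\` W| = (N - #|` W|)%N by rewrite cardfsDS.
  transitivity (\sum_(g1 : lgraph K | trees_on W g1)
      \sum_(g2 : lgraph K | trees_on (V `\` W) g2)
        (#|` W| * #|` V `\` W|)%:R * pair_average (g1, g2) phi).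
    rewrite pair_big_dep /=; apply: eq_big => [[g1 g2]|[g1 g2] /=]; last first.
      by move=> /andP[/and4P[_ _ d /eqP <-] /eqP <-]; rewrite fsetUDl_disjoint.
    rewrite /tree_pairs /trees_on /=; apply/idP/idP.
      move=> /andP[/and4P[-> -> d /eqP <-] /eqP <-]; rewrite eqxx andbT /=.
      by rewrite fsetUDl_disjoint ?eqxx.
    move=> /andP[/andP[/eqP -> ->] /andP[/eqP -> ->]].
    have -> : W `|` (V `\` W) = V.
      apply/fsetP => x; rewrite !inE.
      by have [/(fsubsetP WV) ->|] := boolP (x \in W).
    have -> : [disjoint W & V `\` W]%fset.
      by apply/fdisjointP => x xW; rewrite !inE xW.
    by rewrite !eqxx.
  have [W0|W0] := eqVneq W fset0.
    rewrite /G W0 cardfs0 /=.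
    by rewrite big1 // => g1 _; rewrite big1 // => g2 _; rewrite mul0n mul0r.
  have [D0|D0] := eqVneq (V `\` W) fset0.
    rewrite /G; have -> : (#|` W| < N)%N = false.
      by move: cW; rewrite D0 cardfs0; lia.
    rewrite andbF D0 cardfs0.
    by rewrite big1 // => g1 _; rewrite big1 // => g2 _; rewrite muln0 mul0r.
  have W1 : (0 < #|` W|)%N by rewrite cardfs_gt0.
  have D1 : (0 < #|` V `\` W|)%N by rewrite cardfs_gt0.
  have WN : (#|` W| < N)%N by rewrite -subn_gt0 -cW.
  under eq_bigr do rewrite -mulr_sumr.
  rewrite -mulr_sumr /G W1 WN /=.
  have -> : \sum_(g1 : lgraph K | trees_on W g1)
      \sum_(g2 : lgraph K | trees_on (V `\` W) g2) pair_average (g1, g2) phi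
      = \sum_(g1 : lgraph K | trees_on W g1) cut_average g1
          (fun t => (N - #|` W|).-1`!%:R * cayley_sum (N - #|` W|) (phi \o join t)).
    apply: eq_bigr => g1 _; rewrite /pair_average /join_average.
    transitivity (cut_average g1 (fun t =>
      \sum_(g2 : lgraph K | trees_on (V `\` W) g2)
        cut_average g2 (fun s => phi (join t s)))).
      apply/esym; apply: (average_sumE (M := cut_average g1)).
      exact: average_cut_average.
    apply: eq_average; first exact: average_cut_average.
    move=> t.
    by rewrite -cW -IH //; lia.
  rewrite IH //; last by lia.
  rewrite average_linZ; last exact: average_cayley_sum.
  rewrite /J /join_average cW !mulrA; congr (_ * _)%R.
  rewrite -!natrM; congr (_%:R)%R.
  rewrite (fact_pred W1) (fact_pred (_ : 0 < N - #|` W|)%N) ?subn_gt0 //.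
  by rewrite -!mulnA; congr muln; rewrite mulnCA.
rewrite sum_fsubset -/N.
rewrite -(big_mkord predT (fun k => 'C(N, k)%:R * G k)).
rewrite big_ltn // {1}/G /= mulr0 add0r.
rewrite big_nat_recr /=; last by rewrite /N; lia.
rewrite {2}/G ltnn andbF mulr0 addr0.
rewrite mulrCA cayley_sumE // -/N [N%:R / _]mulrC -[X in _ * (_ * X)]mulrA mulVKf ?mulf_neq0 ?pnatr_eq0 //;
  last by rewrite /N; lia.
rewrite mulrA -natrM mulr_sumr big_nat [RHS]big_nat.
apply: eq_bigr => k /andP[k0 kN]; rewrite /G k0 kN /= mulrA -natrM -/(J k).
congr (_%:R * _)%R; rewrite bin_fact; last exact: ltnW.
by rewrite (fact_pred (ltnW Vgt)) mulnC.
Qed.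

End labelled.

End labelled_cut_trees.

(** * Invariance under relabelling *)

Section relabelling.
Local Open Scope fset_scope.

Lemma edge_component (K : choiceType) (g : lgraph K) x e :
  (e \in (component g x).2) = (e \in g.2) && (e `<=` (component g x).1).
Proof. by rewrite /component /= in_fset inE. Qed.

Section relabel.
Variables (R : realType) (K K' : choiceType) (f : K -> K').
Hypothesis f_inj : injective f.
Implicit Types (g : lgraph K) (phi : tree -> R).

Lemma imfset_inj : injective (fun A : {fset K} => f @` A).
Proof.
move=> A B /fsetP AB; apply/fsetP => x.
by have := AB (f x); rewrite !mem_imfset.
Qed.

Definition relabel g : lgraph K' := (f @` g.1, [fset f @` (e : {fset K}) | e in g.2]).

Lemma adj_relabel g x y : adj (relabel g) (f x) (f y) = adj g x y.
Proof.
rewrite /adj /= -(imfset_fset2 f x y) mem_imfset //; exact: imfset_inj.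
Qed.

Lemma adj_relabelP g x z : adj (relabel g) (f x) z ->
  exists2 y, z = f y & adj g x y.
Proof.
move=> /imfsetP[e /= eg ee].
have : z \in f @` e by rewrite -ee !inE eqxx orbT.
move=> /imfsetP[y /= ye zy]; exists y => //.
by rewrite -adj_relabel -zy /adj ee /= mem_imfset //; exact: imfset_inj.
Qed.

Lemma linked_relabel g x y : linked (relabel g) (f x) (f y) <-> linked g x y.
Proof.
split=> [xy|].
  suff [z /f_inj <-] : exists2 z, f y = f z & linked g x z by [].
  apply: (linked_closed (S := fun u => exists2 z, u = f z & linked g x z) _ xy).
    move=> u v uv [z uz xz]; rewrite uz in uv.
    have [w vw zw] := adj_relabelP uv; exists w => //.
    exact: linked_trans xz (adj_linked zw).
  by exists x => //; exact: linked_refl.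
by apply: linked_map => u v uv; apply: adj_linked; rewrite adj_relabel.
Qed.

Lemma component_relabel g x : component (relabel g) (f x) = relabel (component g x).
Proof.
have VE : (component (relabel g) (f x)).1 = f @` (component g x).1.
  apply/fsetP => z; apply/idP/imfsetP => [|[y /= yC ->]].
    rewrite !inE => /andP[/imfsetP[y /= yg ->] /asboolP/linked_relabel xy].
    by exists y => //; rewrite !inE yg; exact/asboolP.
  move: yC; rewrite !inE mem_imfset // => /andP[-> /asboolP xy].
  by apply/asboolP/linked_relabel.
rewrite [LHS]surjective_pairing VE; congr pair.
apply/fsetP => e; apply/idP/imfsetP => [|[e' /= e'C ->]].
  rewrite edge_component VE => /andP[/imfsetP[e' /= e'g ->] /fsubsetP es]; exists e' => //.
  rewrite /= edge_component e'g /=; apply/fsubsetP => y ye.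
  by have := es (f y); rewrite !mem_imfset //; exact.
rewrite edge_component VE; move: e'C; rewrite edge_component => /andP[e'g /fsubsetP es].
rewrite mem_imfset ?e'g /=; last exact: imfset_inj.
apply/fsubsetP => _ /imfsetP[y /= ye ->].
by rewrite mem_imfset //; exact: es.
Qed.

Lemma remove_relabel g e :
  remove_edge (relabel g) (f @` e) = relabel (remove_edge g e).
Proof.
congr pair; apply/fsetP => e'; rewrite in_fsetD1.
apply/andP/imfsetP => [[ne /imfsetP[e1 /= e1g ee]]|[e1 /=]].
  exists e1; rewrite // in_fsetD1 e1g andbT.
  by apply: contra_neq ne => <-.
rewrite in_fsetD1 => /andP[ne e1g] ->; split.
  by apply: contra_neq ne; exact: imfset_inj.
by rewrite mem_imfset //; exact: imfset_inj.
Qed.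

Lemma simple_relabel g : simple_edges g -> simple_edges (relabel g).
Proof.
move=> sg _ /imfsetP[e /= /sg[/fsubsetP eg e2] ->]; split.
  by apply/fsubsetP => _ /imfsetP[x /= /eg xg ->]; rewrite mem_imfset.
by rewrite card_imfset.
Qed.

Lemma connected_relabel g : connected_graph g -> connected_graph (relabel g).
Proof.
move=> cg _ _ /imfsetP[x /= xg ->] /imfsetP[y /= yg ->].
by apply/linked_relabel/cg.
Qed.

Lemma simple_component g x : simple_edges g -> simple_edges (component g x).
Proof.
by move=> sg e; rewrite inE => /andP[/sg[_ e2] es]; split.
Qed.

Lemma simple_remove g e : simple_edges g -> simple_edges (remove_edge g e).
Proof. by move=> sg e'; rewrite in_fsetD1 => /andP[_ /sg]. Qed.

(** The law of the cut-tree only depends on the isomorphism class of the graph. The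
relabelling may list the ends of an edge in the other order, hence [match_edge]. *)
Lemma cut_mean_relabel m g phi : simple_edges g ->
  cut_mean m (relabel g) phi = cut_mean m g phi.
Proof.
elim: m g phi => [|m IH] g phi sg.
  by rewrite /= card_imfset.
have cE : #|` (relabel g).1| = #|` g.1| by rewrite card_imfset.
have [gle|ggt] := leqP #|` g.1| 1; first by rewrite /= cE gle.
pose F e := if enum_fset e is [:: x; y] then
  edge_average m (relabel g) x y phi else 0.
have FE x y : x != y -> F [fset x; y] = edge_average m (relabel g) x y phi.
  by move=> xy; exact: (match_edge xy (edge_averageC _ _ _ _ _)).
rewrite (cut_meanS _ _ (F := F)) ?cE //; first last.
- move=> x y xy; have [_ _ nxy] := simple_adj (simple_relabel sg) xy.
  exact: FE.
- exact: simple_relabel.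
rewrite (cut_meanS _ _ (F := fun e => F (f @` e))) //; last first.
  move=> x y xy; have [_ _ nxy] := simple_adj sg xy.
  rewrite imfset_fset2 FE ?(inj_eq f_inj) // /edge_average -imfset_fset2.
  rewrite remove_relabel !component_relabel /join_average.
  have sc z : simple_edges (component (remove_edge g [fset x; y]) z).
    by apply/simple_component/simple_remove.
  rewrite (IH _ _ (sc x)); apply: eq_average; first exact: average_cut_mean.
  by move=> t; exact: (IH _ _ (sc y)).
rewrite card_imfset; last exact: imfset_inj.
rewrite big_imfset //=; by move=> A B _ _; exact: imfset_inj.
Qed.

Lemma cut_average_relabel g phi : simple_edges g ->
  cut_average (relabel g) phi = cut_average g phi.
Proof.
by move=> sg; rewrite /cut_average card_imfset // cut_mean_relabel.
Qed.

End relabel.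

End relabelling.

(** * Plane trees and their graphs *)

Section plane_trees.
Local Open Scope fset_scope.

Local Notation word := (seq nat).
Implicit Types (A B D : {fset word}) (u v w z : word).

(** The finite sets of words that arise as family trees: closed under parents and
under elder siblings. *)
Definition plane_tree A :=
  [/\ [::] \in A, forall u i, rcons u i \in A -> u \in A
    & forall u i, rcons u i.+1 \in A -> rcons u i \in A].

Definition children A u := #|` [fset w in A | (w != [::]) && (parent w == u)]|.

Lemma card_rcons_iota u k : #|` [fset rcons u i | i in iota 0 k]| = k.
Proof.
rewrite card_imfset /=; last by move=> i j /rcons_inj[].
by rewrite undup_id ?iota_uniq // size_iota.
Qed.

Lemma children_eq A u k :
  (forall i, (rcons u i \in A) = (i < k)%N) -> children A u = k.
Proof.
move=> uk; rewrite /children.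
have -> : [fset w in A | (w != [::]) && (parent w == u)]
    = [fset rcons u i | i in iota 0 k].
  apply/fsetP => w; apply/idP/imfsetP => [|[i /=]].
    rewrite !inE => /and3P[+ + /eqP]; case/lastP: w => // w i + _.
    rewrite parent_rcons => + wu; rewrite wu uk => ik.
    by exists i; rewrite ?wu //= mem_iota.
  rewrite mem_iota /= add0n => ik ->; rewrite !inE uk ik parent_rcons eqxx andbT.
  by case: (u).
exact: card_rcons_iota.
Qed.

(** The ranks of the children of u form a finite initial segment of the integers, whose
length is their number. *)
Lemma mem_rcons_children A u i : plane_tree A ->
  (rcons u i \in A) = (i < children A u)%N.
Proof.
move=> [A0 Ap As].
have Ad j : rcons u j \in A -> forall k, (k <= j)%N -> rcons u k \in A.
  elim: j => [|j IH] uj k; first by rewrite leqn0 => /eqP ->.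
  by rewrite leq_eqVlt => /orP[/eqP ->//|]; rewrite ltnS; apply/IH/As.
have ex : exists j, rcons u j \notin A.
  apply: contrapT => /forallNP h.
  have : [fset rcons u j | j in iota 0 #|` A|.+1] `<=` A.
    by apply/fsubsetP => _ /imfsetP[j /= _ ->]; apply: contrapT => /negP /h.
  by move=> /fsubset_leq_card; rewrite card_rcons_iota ltnn.
have [k kN kmin] := ex_minnP ex.
have uk j : (rcons u j \in A) = (j < k)%N.
  apply/idP/idP => [uj|jk].
    by rewrite ltnNge; apply/negP => /(Ad _ uj); apply/negP.
  by apply: contraLR jk => /kmin; rewrite -leqNgt.
by rewrite (children_eq uk).
Qed.

Lemma parent_size u : u != [::] -> (size (parent u) < size u)%N.
Proof. by rewrite size_parent; case: u. Qed.

Lemma parent_neq u : u != [::] -> parent u != u.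
Proof. by move=> /parent_size; apply: contraTneq => ->; rewrite ltnn. Qed.

Lemma plane_tree_parent A u : plane_tree A -> u \in A -> parent u \in A.
Proof.
move=> [A0 Ap _]; case/lastP: u => [//|u i]; rewrite parent_rcons; exact: Ap.
Qed.

Definition plane_graph A : lgraph word :=
  (A, [fset [fset u; parent u] | u in A `\ [::]]).

Lemma graph_of_fset A : graph_of [set` A] = plane_graph A.
Proof. by rewrite /graph_of set_fsetK. Qed.

Lemma adj_plane_graph A a b : adj (plane_graph A) a b ->
  [/\ a \in A, a != [::] & b = parent a] \/ [/\ b \in A, b != [::] & a = parent b].
Proof.
move=> /imfsetP[u /=]; rewrite in_fsetD1 => /andP[u0 uA] e.
have pu := parent_neq u0.
have : a \in [fset u; parent u] by rewrite -e !inE eqxx.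
have : b \in [fset u; parent u] by rewrite -e !inE eqxx orbT.
have : u \in [fset a; b] by rewrite e !inE eqxx.
have : parent u \in [fset a; b] by rewrite e !inE eqxx orbT.
rewrite !inE => + + /orP[]/eqP bE /orP[]/eqP aE; rewrite aE bE ?eqxx.
- by rewrite orbb (negPf pu).
- by move=> _ _; right.
- by move=> _ _; left.
- by move=> _; rewrite orbb [u == _]eq_sym (negPf pu).
Qed.

(** The edge from u to its parent is a bridge because the set of words with prefix u
is only left through it. *)
Lemma plane_graph_tree A : plane_tree A -> is_tree (plane_graph A).
Proof.
move=> tA; have [A0 Ap As] := tA; apply/is_treeP; split.
- by apply/fset0Pn; exists [::].
- move=> e /imfsetP[u /=]; rewrite in_fsetD1 => /andP[u0 uA] ->.
  by rewrite fset2_sub uA plane_tree_parent // cardfs2 eq_sym parent_neq.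
- suff to_root u : u \in A -> linked (plane_graph A) [::] u.
    by move=> u v /to_root uA /to_root; apply: linked_trans; exact: linked_sym.
  elim/last_ind: u => [_|u i IH uA]; first exact: linked_refl.
  apply: linked_trans (IH (Ap _ _ uA)) _; apply: adj_linked.
  apply/imfsetP; exists (rcons u i); last by rewrite parent_rcons fsetUC.
  by rewrite /= in_fsetD1 uA andbT; case: (u).
- have bridge u : u != [::] ->
      ~ linked (remove_edge (plane_graph A) [fset u; parent u]) u (parent u).
    move=> u0 /(@linked_closed _ _ (fun w => exists s, w = u ++ s)) => h.
    have [|s /(congr1 size)] := h _ (ex_intro _ [::] (esym (cats0 u))).
      move=> a b + [s]; rewrite adj_remove => /andP[abu ab] aE.
      have [[_ a0 bE]|[_ b0 e]] := adj_plane_graph ab.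
        case/lastP: s aE => [|s i] aE.
          by move: abu; rewrite bE aE cats0 eqxx.
        by exists s; rewrite bE aE -rcons_cat parent_rcons.
      case/lastP: b b0 e {abu ab} => // b i _; rewrite parent_rcons => <-.
      by exists (rcons s i); rewrite aE rcons_cat.
    rewrite size_cat => e; have := parent_size u0; rewrite e.
    by rewrite ltnNge leq_addr.
  move=> a b ab; have [[_ a0 ->]|[_ b0 ->]] := adj_plane_graph ab.
    exact: bridge.
  by rewrite fsetUC => /linked_sym; exact: bridge.
Qed.

Lemma sum_plane_edges (R : realType) A (F : {fset word} -> R) :
  \sum_(e <- (plane_graph A).2) F e
  = \sum_(u <- A `\ [::]) F [fset parent u; u].
Proof.
rewrite /plane_graph /= big_imfset /=; last first.
  move=> u v; rewrite !in_fsetD1 => /andP[u0 _] /andP[v0 _] e.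
  have : u \in [fset v; parent v] by rewrite -e !inE eqxx.
  have : v \in [fset u; parent u] by rewrite e !inE eqxx.
  rewrite !inE => /orP[/eqP ->//|/eqP ev] /orP[/eqP ->//|/eqP eu].
  have := parent_size u0; have := parent_size v0.
  by rewrite -ev -eu => /ltn_trans h /h; rewrite ltnn.
by apply: eq_bigr => u _; rewrite fsetUC.
Qed.

(** The renaming of words that makes room for a new child of v at rank j, by shifting
the younger children of v and their descendants. *)
Fixpoint insert_child v j z : word :=
  match v, z with
  | [::], i :: z' => bump j i :: z'
  | a :: v', b :: z' => b :: (if a == b then insert_child v' j z' else z')
  | _, [::] => [::]
  end.

Lemma insert_child0 v j : insert_child v j [::] = [::].
Proof. by case: v. Qed.

Lemma insert_child_rcons v j z i : insert_child v j (rcons z i)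
  = rcons (insert_child v j z) (if z == v then bump j i else i).
Proof.
elim: v z => [|a v IH] [|b z] //=; first by case: eqP => // _; rewrite insert_child0.
rewrite eqseq_cons eq_sym; case: eqP => [->|] //=.
by rewrite IH.
Qed.

Lemma insert_child_id v j : insert_child v j v = v.
Proof. by elim: v => //= a v ->; rewrite eqxx. Qed.

Lemma insert_child_eq0 v j z : (insert_child v j z == [::]) = (z == [::]).
Proof. by case: v z => [|a v] []. Qed.

Lemma parent_insert_child v j z :
  insert_child v j (parent z) = parent (insert_child v j z).
Proof.
case/lastP: z => [|z i]; first by rewrite !insert_child0.
by rewrite insert_child_rcons !parent_rcons.
Qed.

Lemma insert_child_inj v j : injective (insert_child v j).
Proof.
elim: v => [|a v IH] [|b z] [|b' z'] //= [].
  by move=> /(can_inj (bumpK j)) -> ->.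
by move=> ->; case: eqP => [_ /IH ->|_ ->].
Qed.

Lemma insert_child_neq v j z w : insert_child v j z <> rcons v j ++ w.
Proof.
elim: v z => [|a v IH] [|b z] //= [].
  by move=> e _; have := neq_bump j b; rewrite e eqxx.
by move=> ->; rewrite eqxx => /IH.
Qed.

(** The words below the new child are exactly those missed by the renaming. *)
Lemma insert_child_cover v j z :
  (exists z', z = insert_child v j z') \/ (exists w, z = rcons v j ++ w).
Proof.
elim: v z => [|a v IH] [|b z] /=; try by left; exists [::].
  have [->|bj] := eqVneq b j; first by right; exists z.
  by left; exists (unbump j b :: z); rewrite /= unbumpK.
have [<-|ab] := eqVneq a b; last by left; exists (b :: z); rewrite /= (negPf ab).
have [[z' ->]|[w ->]] := IH z; last by right; exists w.
by left; exists (a :: z'); rewrite /= eqxx.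
Qed.

(** B with D attached as the j-th child of v. *)
Definition graft v j B D :=
  insert_child v j @` B `|` [fset rcons v j ++ z | z in D].

Section graft.
Variables (v : word) (j : nat).

Lemma cat_inj (u : word) : injective (cat u).
Proof. by move=> a b /eqP; rewrite eqseq_cat // eqxx => /eqP. Qed.

Lemma mem_graft_insert B D z : (insert_child v j z \in graft v j B D) = (z \in B).
Proof.
rewrite in_fsetU mem_imfset /=; last exact: insert_child_inj.
rewrite orbC; case: imfsetP => // -[w _ e].
by have := insert_child_neq e.
Qed.

Lemma mem_graft_cat B D z : (rcons v j ++ z \in graft v j B D) = (z \in D).
Proof.
rewrite in_fsetU orbC mem_imfset /=; last exact: cat_inj.
rewrite orbC; case: imfsetP => // -[w _ /esym e].
by have := insert_child_neq e.
Qed.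

Lemma graft_inj B D B' D' :
  graft v j B D = graft v j B' D' -> B = B' /\ D = D'.
Proof.
move=> e; split; apply/fsetP => z.
  by rewrite -(mem_graft_insert B D) e mem_graft_insert.
by rewrite -(mem_graft_cat B D) e mem_graft_cat.
Qed.

Lemma disjoint_graft B D :
  [disjoint insert_child v j @` B & [fset rcons v j ++ z | z in D]]%fset.
Proof.
apply/fdisjointP => _ /imfsetP[z _ ->]; apply/imfsetP => -[w _ e].
by have := insert_child_neq e.
Qed.

Lemma card_graft B D : #|` graft v j B D| = (#|` B| + #|` D|)%N.
Proof.
rewrite cardfsU (eqP (disjoint_graft B D)) cardfs0 subn0 !card_imfset //.
  exact: cat_inj.
exact: insert_child_inj.
Qed.

Lemma prod_graft (R : comRingType) B D (F : word -> R) :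
  \prod_(u <- graft v j B D) F u =
  (\prod_(z <- B) F (insert_child v j z)) * \prod_(z <- D) F (rcons v j ++ z).
Proof.
rewrite /graft (perm_big (enum_fset (insert_child v j @` B) ++
  enum_fset [fset rcons v j ++ z | z in D])) /=; last first.
  apply: uniq_perm; first exact: fset_uniq.
    rewrite cat_uniq !fset_uniq andbT /=; apply/hasPn => z zD.
    by apply: (fdisjointP_sym (disjoint_graft B D)).
  by move=> z; rewrite mem_cat -in_fsetU.
rewrite big_cat /= !big_imfset //; move=> a b _ _; first exact: cat_inj.
exact: insert_child_inj.
Qed.

End graft.

End plane_trees.

(** * Grafting and pruning plane trees *)

Section grafting.
Local Open Scope fset_scope.

Implicit Types (A B D : {fset seq nat}) (u v w z : seq nat).

Lemma bump_leq j i n : (j <= n)%N -> (bump j i < n.+1)%N = (i < n)%N.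
Proof. by rewrite /bump; case: leqP => h /=; lia. Qed.

Lemma rcons_insert v j B D z i :
  (rcons (insert_child v j z) i \in graft v j B D) =
  if z == v then (i == j) && ([::] \in D) || (i != j) && (rcons v (unbump j i) \in B)
  else rcons z i \in B.
Proof.
have [->|zv] := eqVneq z v; last first.
  by rewrite -(mem_graft_insert v j B D) insert_child_rcons (negPf zv).
rewrite insert_child_id; have [->|ij] /= := eqVneq i j.
  by rewrite orbF -[rcons v j]cats0 mem_graft_cat.
rewrite -(mem_graft_insert v j B D) insert_child_rcons eqxx insert_child_id.
by rewrite unbumpK // inE eq_sym.
Qed.

Section graft_plane.
Variables (v : seq nat) (j : nat) (B D : {fset seq nat}).
Hypotheses (tB : plane_tree B) (tD : plane_tree D) (vB : v \in B)
  (jv : (j <= children B v)%N).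

(** The graft gives v one more child and leaves the other vertices of B unchanged. *)
Lemma mem_rcons_graft_insert z i :
  (rcons (insert_child v j z) i \in graft v j B D)
  = (i < children B z + (z == v))%N.
Proof.
rewrite rcons_insert.
have [->|zv] := eqVneq z v; last by rewrite addn0 mem_rcons_children.
have [D0 _ _] := tD; rewrite D0 andbT mem_rcons_children // addn1.
have [->|ij] /= := eqVneq i j; first by rewrite ltnS jv.
by rewrite -(bump_leq _ jv) unbumpK // inE eq_sym.
Qed.

Lemma mem_rcons_graft_cat z i :
  (rcons (rcons v j ++ z) i \in graft v j B D) = (i < children D z)%N.
Proof. by rewrite rcons_cat mem_graft_cat mem_rcons_children. Qed.

Lemma children_graft_insert z :
  children (graft v j B D) (insert_child v j z) = (children B z + (z == v))%N.
Proof. by apply: children_eq => i; exact: mem_rcons_graft_insert. Qed.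

Lemma children_graft_cat z :
  children (graft v j B D) (rcons v j ++ z) = children D z.
Proof. by apply: children_eq => i; exact: mem_rcons_graft_cat. Qed.

Lemma plane_tree_graft : plane_tree (graft v j B D).
Proof.
have [B0 Bp Bs] := tB; have [D0 Dp Ds] := tD; split.
- by rewrite -(insert_child0 v j) mem_graft_insert.
- move=> u i; have [[z ->]|[w ->]] := insert_child_cover v j u.
    rewrite rcons_insert mem_graft_insert.
    by case: eqP => [->//|_]; exact: Bp.
  rewrite !rcons_cat !mem_graft_cat; exact: Dp.
- move=> u i; have [[z ->]|[w ->]] := insert_child_cover v j u.
    by rewrite !mem_rcons_graft_insert; exact: ltnW.
  by rewrite !mem_rcons_graft_cat; exact: ltnW.
Qed.

Variable R : realType.

(** Up to a factor e per vertex, the probability of A under the Galton-Watson law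
with Poisson (1) offspring. *)
Definition plane_weight A : R := \prod_(u <- A) (children A u)`!%:R^-1.

(** The new child has (children B v).+1 possible ranks, so the factor compensates
exactly for the choice of the rank. *)
Lemma plane_weight_graft : plane_weight (graft v j B D)
  = plane_weight B * plane_weight D / (children B v).+1%:R.
Proof.
rewrite /plane_weight prod_graft mulrAC; congr (_ * _)%R; last first.
  by apply: eq_bigr => z _; rewrite children_graft_cat.
rewrite [LHS](big_fsetD1 v) //= [X in _ = X / _](big_fsetD1 v) //=.
rewrite children_graft_insert eqxx addn1 factS natrM invfM -[RHS]mulrA.
rewrite -[LHS]mulrA [LHS]mulrCA; congr (_ * _)%R.
rewrite [RHS]mulrC; congr (_ * _)%R.
apply: eq_big_seq => z.
by rewrite in_fsetD1 => /andP[/negPf zv _]; rewrite children_graft_insert zv addn0.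
Qed.

Let GB := relabel (insert_child v j) (plane_graph B).
Let GD := relabel (cat (rcons v j)) (plane_graph D).

(** Each part of the graft is a renamed plane tree; the renaming is harmless by
[cut_mean_relabel]. *)
Lemma plane_graph_graft :
  plane_graph (graft v j B D) = glue_graph GB GD v (rcons v j).
Proof.
have [D0 _ _] := tD.
congr pair; apply/fsetP => e; rewrite !in_fsetU in_fset1.
have iB := @insert_child_inj v j; have iD := @cat_inj (rcons v j).
apply/imfsetP/idP => [[u /=]|].
  rewrite in_fsetD1 => /andP[u0 uG] ->.
  have [[z uz]|[w uw]] := insert_child_cover v j u.
    apply/or3P/Or32; apply/imfsetP; exists [fset z; parent z] => /=.
      apply/imfsetP; exists z => //=.
      by move: u0 uG; rewrite uz insert_child_eq0 mem_graft_insert in_fsetD1 => -> ->.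
    by rewrite imfset_fset2 parent_insert_child uz.
  have [w0|w0] := eqVneq w [::].
    by rewrite uw w0 cats0 parent_rcons fsetUC eqxx.
  apply/or3P/Or33; apply/imfsetP; exists [fset w; parent w] => /=.
    apply/imfsetP; exists w => //=.
    by move: uG; rewrite uw mem_graft_cat in_fsetD1 w0.
  rewrite imfset_fset2 uw; congr [fset _; _].
  by case/lastP: w w0 {uw} => // w i _; rewrite -rcons_cat !parent_rcons.
move=> /or3P[/eqP ->|/imfsetP[_ /= /imfsetP[z /= +->] ->]|/imfsetP[_ /= /imfsetP[w /= + ->] ->]].
- exists (rcons v j); last by rewrite parent_rcons fsetUC.
  rewrite /= in_fsetD1 -{2}[rcons v j]cats0 mem_graft_cat D0 andbT.
  by case: (v).
- rewrite in_fsetD1 => /andP[z0 zB]; exists (insert_child v j z).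
    by rewrite /= in_fsetD1 insert_child_eq0 z0 mem_graft_insert.
  by rewrite imfset_fset2 parent_insert_child.
- rewrite in_fsetD1 => /andP[w0 wD]; exists (rcons v j ++ w).
    by rewrite /= in_fsetD1 mem_graft_cat wD andbT; case: (v).
  rewrite imfset_fset2; congr [fset _; _].
  by case/lastP: w w0 {wD} => // w i _; rewrite -rcons_cat !parent_rcons.
Qed.

Lemma edge_cut_graft (phi : tree -> R) :
  edge_cut (plane_graph (graft v j B D)) v (rcons v j) phi
  = join_average (cut_average (plane_graph B)) (cut_average (plane_graph D)) phi.
Proof.
have iB := @insert_child_inj v j; have iD := @cat_inj (rcons v j).
have [_ sB cB _] := (is_treeP _).1 (plane_graph_tree tB).
have [_ sD cD _] := (is_treeP _).1 (plane_graph_tree tD).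
have sGB : simple_edges GB by exact: simple_relabel.
have sGD : simple_edges GD by exact: simple_relabel.
have cGB : connected_graph GB by exact: connected_relabel.
have cGD : connected_graph GD by exact: connected_relabel.
have d : [disjoint GB.1 & GD.1]%fset by exact: disjoint_graft.
have vGB : v \in GB.1 by rewrite -{1}(insert_child_id v j) mem_imfset.
have uGD : rcons v j \in GD.1.
  by rewrite -{1}[rcons v j]cats0 mem_imfset //; case: tD.
rewrite /edge_cut plane_graph_graft remove_glue // component_disjoint_union //.
rewrite component_disjoint_unionr // /join_average cut_average_relabel //.
apply: eq_average; first exact: average_cut_average.
by move=> t; rewrite cut_average_relabel.
Qed.

End graft_plane.

(** The inverse of grafting: pull A back along the two renamings. *)
Lemma prune A v j : plane_tree A -> rcons v j \in A -> exists B D,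
  [/\ plane_tree B, plane_tree D, v \in B & (j <= children B v)%N] /\
  A = graft v j B D.
Proof.
move=> tA uA; have [A0 Ap As] := tA.
have fin (f : seq nat -> seq nat) : injective f -> finite_set [set z | f z \in A].
  move=> fi; apply: (@finite_preimage _ _ [set` A] f).
    by move=> a b _ _; exact: fi.
  exact: finite_fset.
have iB := @insert_child_inj v j; have iD := @cat_inj (rcons v j).
pose B := fset_set [set z | insert_child v j z \in A].
pose D := fset_set [set z | rcons v j ++ z \in A].
have memB z : (z \in B) = (insert_child v j z \in A).
  by rewrite in_fset_set ?inE; [apply/idP/idP; rewrite inE|exact: fin].
have memD z : (z \in D) = (rcons v j ++ z \in A).
  by rewrite in_fset_set ?inE; [apply/idP/idP; rewrite inE|exact: fin].
have tB : plane_tree B.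
  split => [|u i|u i]; rewrite !memB.
  - by rewrite insert_child0.
  - by rewrite insert_child_rcons; exact: Ap.
  - rewrite !insert_child_rcons; case: eqP => [->|_]; last exact: As.
    rewrite !mem_rcons_children // insert_child_id; apply: leq_ltn_trans.
    by rewrite /bump; lia.
have tD : plane_tree D.
  split => [|u i|u i]; rewrite !memD.
  - by rewrite cats0.
  - by rewrite -!rcons_cat; exact: Ap.
  - by rewrite -!rcons_cat; exact: As.
exists B, D; split; first split => //.
- by rewrite memB insert_child_id; exact: Ap uA.
- rewrite leqNgt; apply/negP => h.
  have : rcons v (children B v) \in B.
    rewrite memB insert_child_rcons eqxx insert_child_id /bump leqNgt h /= add0n.
    rewrite mem_rcons_children //; apply: ltn_trans h _.
    by rewrite -mem_rcons_children.
  by rewrite mem_rcons_children // ltnn.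
- apply/fsetP => u; have [[z ->]|[w ->]] := insert_child_cover v j u.
    by rewrite mem_graft_insert memB.
  by rewrite mem_graft_cat memD.
Qed.

End grafting.

(** * Cut-trees of plane trees with Galton-Watson weights *)

Section plane_cut_trees.
Local Open Scope fset_scope.

Implicit Types (A B D : {fset seq nat}) (u v w z : seq nat).

Lemma children_le_card A u : plane_tree A -> (children A u < #|` A|)%N.
Proof.
move=> [A0 _ _]; rewrite (cardfsD1 [::]) A0 add1n ltnS.
apply: fsubset_leq_card; apply/fsubsetP => w.
by rewrite !inE => /and3P[-> -> _].
Qed.

Lemma plane_tree_gt0 A : plane_tree A -> (0 < #|` A|)%N.
Proof. by move=> [A0 _ _]; rewrite cardfs_gt0; apply/fset0Pn; exists [::]. Qed.

Lemma plane_tree_single A : plane_tree A -> (#|` A| <= 1)%N -> A = [fset [::]].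
Proof.
move=> tA A1; have /cardfs1P[x xE] : #|` A| == 1%N.
  by rewrite eqn_leq A1 plane_tree_gt0.
by have [] := tA; rewrite xE inE => /eqP ->.
Qed.

Lemma plane_tree1 : plane_tree [fset [::]].
Proof.
split=> [|u i|u i]; rewrite ?inE //.
  by rewrite -size_eq0 size_rcons.
by rewrite -size_eq0 size_rcons.
Qed.

Lemma plane_tree_cut A u : plane_tree A -> u \in A -> u != [::] -> exists v j B D,
  [/\ plane_tree B, plane_tree D, v \in B & (j <= children B v)%N] /\
  (u = rcons v j /\ A = graft v j B D).
Proof.
case/lastP: u => // v j tA vA _.
by have [B [D [h ->]]] := prune tA vA; exists v, j, B, D.
Qed.

(** Every plane tree with an edge is a graft of smaller ones. *)
Lemma finite_plane_trees n :
  finite_set [set A | plane_tree A /\ (#|` A| <= n)%N].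
Proof.
elim: n => [|n IH].
  rewrite (_ : [set A | _] = set0) //; apply/seteqP; split => A //= -[/plane_tree_gt0].
  by rewrite ltnNge => /negP.
pose S := [set A | plane_tree A /\ (#|` A| <= n)%N].
pose W := (\bigcup_(B in S) [set` B])%classic.
pose I := [set k | (k < n.+1)%N].
pose h (q : (seq nat * nat) * ({fset seq nat} * {fset seq nat})) :=
  graft q.1.1 q.1.2 q.2.1 q.2.2.
apply: (@sub_finite_set _ _ ([set [fset [::]]] `|` h @` ((W `*` I) `*` (S `*` S)))%classic).
  move=> A [tA An]; have [A1|A1] := leqP #|` A| 1.
    by left; exact: plane_tree_single.
  right; have /fset0Pn[u] : A `\ [::] != fset0.
    by have [A0 _ _] := tA; move: A1; rewrite (cardfsD1 [::]) A0 -cardfs_gt0.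
  rewrite in_fsetD1 => /andP[u0 uA].
  have [v [j [B [D [[tB tD vB jv] [_ AE]]]]]] := plane_tree_cut tA uA u0.
  have := plane_tree_gt0 tB; have := plane_tree_gt0 tD.
  move: An; rewrite AE card_graft => An D0 B0.
  have Bn : (#|` B| <= n)%N by lia.
  have jn : (j < n.+1)%N.
    rewrite ltnS (leq_trans jv) // (leq_trans _ Bn) // ltnW //.
    exact: children_le_card.
  exists ((v, j), (B, D)) => //; split; split => //=; first by exists B.
  by split => //; lia.
rewrite finite_setU; split; first exact: finite_set1.
apply: finite_image; apply: finite_setX; apply: finite_setX => //.
- by apply: bigcup_finite => // B _; exact: finite_fset.
- exact: finite_II.
Qed.

Definition plane_trees n : {fset {fset seq nat}} :=
  fset_set [set A | plane_tree A /\ #|` A| = n].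

Lemma plane_treesP n A : A \in plane_trees n <-> plane_tree A /\ #|` A| = n.
Proof.
rewrite in_fset_set; first by rewrite inE.
by apply: sub_finite_set (finite_plane_trees n) => B [tB <-].
Qed.

Lemma uniq_allpairs_by (I T : eqType) (r : seq I) (t : I -> seq T) (f : T -> I) :
  uniq r -> (forall k, uniq (t k)) -> (forall k p, p \in t k -> f p = k) ->
  uniq [seq p | k <- r, p <- t k].
Proof.
move=> + ut ft; elim: r => //= k r IH /andP[kr ur].
rewrite cat_uniq map_id ut IH // andbT /=; apply/hasPn => p.
move=> /allpairsPdep[k' [q [k'r qk' ->]]]; apply/negP => qk.
by move: kr; rewrite -(ft _ _ qk) (ft _ _ qk') k'r.
Qed.

Section plane_sum.
Variable R : realType.
Implicit Type phi : tree -> R.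

Definition plane_sum n phi : R :=
  \sum_(A <- plane_trees n) plane_weight R A * cut_average (plane_graph A) phi.

Lemma plane_weight_ge0 A : 0 <= plane_weight R A.
Proof. by apply: prodr_ge0 => u _; rewrite invr_ge0. Qed.

Definition marked_trees n : seq ({fset seq nat} * seq nat) :=
  [seq (A, u) | A <- plane_trees n, u <- A `\ [::]].

Definition tree_pairs_of n : seq ({fset seq nat} * {fset seq nat}) :=
  [seq p | k <- index_iota 1 n,
           p <- [seq (B, D) | B <- plane_trees k, D <- plane_trees (n - k)]].

Definition slots B : seq (seq nat * nat) :=
  [seq (v, j) | v <- B, j <- iota 0 (children B v).+1].

Definition graft_data n := [seq (p, s) | p <- tree_pairs_of n, s <- slots p.1].

Definition graft_at (q : ({fset seq nat} * {fset seq nat}) * (seq nat * nat)) :=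
  (graft q.2.1 q.2.2 q.1.1 q.1.2, rcons q.2.1 q.2.2).

Lemma mem_tree_pairs_of n p : p \in tree_pairs_of n <->
  [/\ plane_tree p.1, plane_tree p.2 & (#|` p.1| + #|` p.2|)%N = n].
Proof.
split=> [/allpairsPdep[k [q [kn + ->]]]|[t1 t2 e]].
  move=> /allpairsP[[B D] [/= /plane_treesP[tB Bk] /plane_treesP[tD Dk] ->]].
  move: kn; rewrite mem_index_iota => /andP[k0 kn].
  by split => //=; rewrite Bk Dk subnKC // ltnW.
have p1 := plane_tree_gt0 t1; have p2 := plane_tree_gt0 t2.
apply/allpairsPdep; exists #|` p.1|, p; split => //.
  by rewrite mem_index_iota p1 -e -addn1 leq_add2l.
apply/allpairsP; exists p; split; rewrite -?surjective_pairing //.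
  exact/plane_treesP.
by apply/plane_treesP; split => //; rewrite -e addKn.
Qed.

Lemma mem_slots B s :
  s \in slots B <-> s.1 \in B /\ (s.2 <= children B s.1)%N.
Proof.
split=> [/allpairsPdep[v [j [vB + ->]]]|[vB jv]].
  by rewrite mem_iota add0n ltnS.
apply/allpairsPdep; exists s.1, s.2; rewrite -surjective_pairing; split => //.
by rewrite mem_iota add0n ltnS.
Qed.

(** Plane trees with a marked edge (named by its lower end) are the same as grafts. *)
Lemma perm_graft n : perm_eq (marked_trees n) (map graft_at (graft_data n)).
Proof.
apply: uniq_perm.
- apply: allpairs_uniq_dep => [|A _|[A u] [B v] _ _ /= [-> ->]//];
    exact: fset_uniq.
- rewrite map_inj_in_uniq.
    apply: allpairs_uniq_dep => [|p _|[p s] [q r] _ _ /= [-> ->]//].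
      apply: (uniq_allpairs_by (f := fun p : {fset seq nat} * {fset seq nat} => #|` p.1|)).
      + exact: iota_uniq.
      + move=> k; apply: allpairs_uniq; [exact: fset_uniq|exact: fset_uniq|].
        by move=> [B D] [B' D'] _ _ /= [-> ->].
      + by move=> k [B D] /allpairsP[[B' D'] [/= /plane_treesP[_ <-] _ [-> _]]].
    apply: allpairs_uniq_dep => [|v _|[v i] [w j] _ _ /= [-> ->]//].
      exact: fset_uniq.
    exact: iota_uniq.
  move=> [[B D] [v j]] [[B' D'] [v' j']] _ _ [+ /rcons_inj[e1 e2]].
  by rewrite e1 e2 => /graft_inj[-> ->].
- move=> [A u]; apply/idP/idP.
    move=> /allpairsPdep[A' [u' [/plane_treesP[tA An] + [-> ->]]]].
    rewrite in_fsetD1 => /andP[u0 uA].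
    have [v [j [B [D [[tB tD vB jv] [-> AE]]]]]] := plane_tree_cut tA uA u0.
    apply/mapP; exists ((B, D), (v, j)); last by rewrite AE.
    apply/allpairsPdep; exists (B, D), (v, j); split => //.
      by apply/mem_tree_pairs_of; split => //=; rewrite -An AE card_graft.
    exact/mem_slots.
  move=> /mapP[_ /allpairsPdep[[B D] [[v j] [+ + ->]]] [-> ->]].
  move=> /mem_tree_pairs_of[/= tB tD n_] /mem_slots[/= vB jv].
  apply/allpairsPdep; exists (graft v j B D), (rcons v j); split => //.
    apply/plane_treesP; split; last by rewrite card_graft.
    exact: plane_tree_graft.
  rewrite in_fsetD1 -{2}[rcons v j]cats0 mem_graft_cat; case: tD => -> _ _.
  by rewrite andbT; case: (v).
Qed.

(** Cutting at a uniform edge, the part with the root has k vertices; each of them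
may carry the graft, and summing over the rank of the new child cancels the ratio of
the weights. *)
Lemma plane_sum_edges n phi : (1 < n)%N ->
  n.-1%:R * plane_sum n phi
  = \sum_(1 <= k < n) k%:R * join_average (plane_sum k) (plane_sum (n - k)) phi.
Proof.
move=> n1.
transitivity (\sum_(q <- marked_trees n)
    plane_weight R q.1 * edge_cut (plane_graph q.1) (parent q.2) q.2 phi).
  rewrite big_allpairs_dep mulr_sumr big_seq [RHS]big_seq.
  apply: eq_bigr => A /plane_treesP[tA An] /=.
  rewrite mulrCA -mulr_sumr; congr (_ * _)%R.
  have := cut_average_edge_terms phi (plane_graph_tree tA); rewrite /= An => -> //.
  rewrite sum_plane_edges big_seq [RHS]big_seq; apply: eq_bigr => u.
  by rewrite in_fsetD1 => /andP[u0 _]; rewrite edge_termE // parent_neq.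
rewrite (perm_big _ (perm_graft n)) /= big_map big_allpairs_dep big_allpairs_dep /=.
rewrite big_nat [RHS]big_nat; apply: eq_bigr => k /andP[k0 kn].
rewrite big_allpairs.
transitivity (\sum_(B <- plane_trees k) \sum_(D <- plane_trees (n - k))
   k%:R * (plane_weight R B * plane_weight R D * join_average
     (cut_average (plane_graph B)) (cut_average (plane_graph D)) phi)).
  rewrite big_seq [RHS]big_seq; apply: eq_bigr => B /plane_treesP[tB Bk].
  rewrite big_seq [RHS]big_seq; apply: eq_bigr => D /plane_treesP[tD Dk].
  rewrite big_allpairs_dep.
  set c := _ * join_average _ _ _.
  transitivity (\sum_(v <- B) c); last first.
    by rewrite big_const_seq count_predT iter_addr_0 Bk mulr_natl.
  rewrite big_seq [RHS]big_seq; apply: eq_bigr => v vB.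
  transitivity (\sum_(j <- iota 0 (children B v).+1) c / (children B v).+1%:R).
    rewrite big_seq [RHS]big_seq; apply: eq_bigr => j.
    rewrite mem_iota add0n ltnS => /= jv.
    rewrite plane_weight_graft // parent_rcons edge_cut_graft // /c.
    by rewrite mulrAC.
  rewrite big_const_seq count_predT iter_addr_0 size_iota -[LHS]mulr_natr.
  by rewrite mulfVK // pnatr_eq0.
under eq_bigr do rewrite -mulr_sumr.
rewrite -mulr_sumr; congr (_ * _)%R.
rewrite /join_average {1}/plane_sum; apply: eq_bigr => B _.
under eq_bigr do rewrite -mulrA.
rewrite -mulr_sumr; congr (_ * _)%R; apply/esym.
rewrite /plane_sum (average_sumE _ _ (fun D t => _)).
  by apply: eq_bigr => D _; rewrite average_linZ //; exact: average_cut_average.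
exact: average_cut_average.
Qed.

(** The factor k of [plane_sum_edges] becomes n / 2 after symmetrisation, because the
two subtrees of a join are exchangeable; the result is the recursion of [cayley_sum].
Thus a Galton-Watson tree conditioned on its size has the cut-tree law of a uniform
labelled tree, without any comparison of the underlying random trees. *)
Theorem plane_sumE n phi : (0 < n)%N -> plane_sum n phi = cayley_sum n phi.
Proof.
elim/ltn_ind: n phi => n IH phi n0; have [n1|n1] := leqP n 1.
  have -> : n = 1%N by lia.
  have -> : plane_sum 1 phi = \sum_(A <- [fset [fset [::]]]) plane_weight R A *
      cut_average (plane_graph A) phi.
    rewrite /plane_sum; congr (\sum_(A <- enum_fset _) _)%R.
    apply/fsetP => A; rewrite inE; apply/idP/eqP => [/plane_treesP[tA A1]|->].
      by apply: plane_tree_single; rewrite ?A1.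
    by apply/plane_treesP; rewrite cardfs1; split => //; exact: plane_tree1.
  rewrite big_seq_fset1 cut_average_leaf /= ?cardfs1 // cayley_sum1.
  rewrite /plane_weight big_seq_fset1 (@children_eq _ _ 0) ?fact0 ?invr1 ?mul1r //.
  by move=> i; rewrite inE.
have n1' : n.-1%:R != 0 :> R by rewrite pnatr_eq0; lia.
apply: (@mulfI _ (2 * n.-1%:R)); first by rewrite mulf_neq0 // pnatr_eq0.
rewrite -mulrA plane_sum_edges // cayley_sumE //.
rewrite [X in _ = X]mulrA [_ * (n%:R / _)]mulrCA divff ?mulf_neq0 ?pnatr_eq0 //; last by lia.
rewrite mulr1.
pose J k := join_average (@cayley_sum R k) (cayley_sum (n - k)) phi.
have -> : \sum_(1 <= k < n) k%:R * join_average (plane_sum k) (plane_sum (n - k)) phi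
    = \sum_(1 <= k < n) k%:R * J k.
  rewrite big_nat [RHS]big_nat; apply: eq_bigr => k /andP[k0 kn].
  congr (_ * _)%R; rewrite /join_average IH //.
  apply: (eq_average (average_cayley_sum _ _)) => t; apply: IH; lia.
have JC k : (0 < k < n)%N -> J (n - k)%N = J k.
  move=> /andP[k0 kn]; rewrite /J subKn 1?ltnW //.
  by apply: join_averageC; exact: average_cayley_sum.
have e : \sum_(1 <= k < n) k%:R * J k = \sum_(1 <= k < n) (n - k)%:R * J k.
  rewrite big_nat_rev /= big_nat [RHS]big_nat; apply: eq_bigr => k kn.
  by rewrite add1n subSS JC.
rewrite mulr_natl mulr2n {2}e -big_split mulr_sumr /=.
rewrite big_nat [RHS]big_nat; apply: eq_bigr => k /andP[k0 kn].
by rewrite -mulrDl -natrD subnKC // ltnW.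
Qed.

End plane_sum.

End plane_cut_trees.

(** * Approximation of the limit law from below *)

Section limit_mean.
Variables (R : realType) (K : nat).
Implicit Type phi : tree -> R.

(** The law of the limit tree down to depth r, restricted to the event that the first
r hanging trees are cut-trees of trees with at most K vertices. The restriction keeps
all sums finite, and its mass tends to 1 with K. *)
Fixpoint limit_mean r phi : R :=
  if r is r'.+1 then
    \sum_(1 <= k < K.+1)
      expR (- k%:R) * join_average (@cayley_sum R k) (limit_mean r') phi
  else phi leaf.

Lemma average_limit_mean r : average (limit_mean r).
Proof.
elim: r => [|r IH] /=; first exact: average_leaf.
apply: average_sum => k _; apply: averageZ; first exact: expR_ge0.
exact: average_join (average_cayley_sum _ _) IH.
Qed.

Lemma limit_mean_const r : limit_mean r (fun=> 1) = borel_mass R K ^+ r.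
Proof.
elim: r => [|r IH] //; rewrite exprS /borel_mass mulr_suml /=.
rewrite big_nat [RHS]big_nat; apply: eq_bigr => k /andP[k0 _].
rewrite -mulrA; congr (_ * _); rewrite /join_average.
rewrite (eq_average (average_cayley_sum R k) (psi := fun=> borel_mass R K ^+ r * 1)).
  by rewrite average_linZ ?cayley_sum_const 1?mulrC //; exact: average_cayley_sum.
by move=> t; rewrite IH mulr1.
Qed.

(** Cut a Cayley tree of size n at its first edge. For n > 2 K the events that the first
or the second part has size k <= K are disjoint and have the same contribution, which
dominates that of the Borel law by [cayley_coef_ratio]. The other part has size n - k and
the induction hypothesis applies to it, one level higher. *)
Lemma limit_mean_le r n phi : (r.+2 * K < n)%N -> (forall t, 0 <= phi t) ->
  depends_on_trunc r phi ->
  limit_mean r phi * cayley_coef R n <= cayley_sum n phi.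
Proof.
elim: r n phi => [|r IH] n phi rn phi0 dphi.
  have n0 : (0 < n)%N by lia.
  rewrite (eq_average (average_cayley_sum R n) (psi := fun=> phi leaf * 1)).
    by rewrite average_linZ ?cayley_sum_const //; exact: average_cayley_sum.
  by move=> t; rewrite mulr1; exact: depends_on_trunc0.
have [K0|K0] := posnP K.
  rewrite /= K0 big_geq // mul0r; apply: average_ge0 => //.
  exact: average_cayley_sum.
have n1 : (1 < n)%N by nia.
have Kn : (K + K < n)%N by nia.
pose J k := join_average (@cayley_sum R k) (cayley_sum (n - k)) phi.
have J0 k : 0 <= J k.
  apply: average_ge0 => //; apply: average_join; exact: average_cayley_sum.
have JC k : (0 < k < n)%N -> J (n - k)%N = J k.
  move=> /andP[k0 kn]; rewrite /J subKn 1?ltnW //.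
  by apply: join_averageC; exact: average_cayley_sum.
(* The two ends of the sum are exchanged by k <-> n - k; the middle is dropped. *)
have sJ : 2 * \sum_(1 <= k < K.+1) J k <= \sum_(1 <= k < n) J k.
  have Kn1 : (K.+1 <= n)%N by lia.
  have Kn2 : (K.+1 <= n - K)%N by lia.
  have Kn3 : (n - K <= n)%N by lia.
  rewrite [leRHS](big_cat_nat _ (n := K.+1)) //=.
  rewrite [X in _ <= _ + X](big_cat_nat _ (n := (n - K)%N)) //=.
  have -> : \sum_(n - K <= k < n) J k = \sum_(1 <= k < K.+1) J k.
    rewrite -[X in \sum_(X <= _ < _) _]add0n big_addn subKn; last by lia.
    rewrite big_mkord.
    rewrite big_add1 /= big_mkord (reindex_inj rev_ord_inj) /=.
    apply: eq_bigr => -[k kK] _ /=; rewrite -(JC k.+1); last by lia.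
    by congr J; lia.
  rewrite mulr_natl mulr2n lerD2l lerDr.
  by apply: sumr_ge0.
have n1R : 0 < n.-1%:R :> R by rewrite ltr0n; lia.
apply: (@le_trans _ _ (\sum_(1 <= k < K.+1) J k)); last first.
  rewrite cayley_sumE // mulrAC ler_pdivlMr ?mulr_gt0 //.
  set S := \sum_(1 <= k < K.+1) _; have -> : S * (2 * n.-1%:R) = n.-1%:R * (2 * S) by ring.
  apply: ler_pM => //.
  - by rewrite mulr_ge0 // sumr_ge0.
  - by rewrite ler_nat leq_pred.
rewrite /= mulr_suml [leLHS]big_nat [leRHS]big_nat; apply: ler_sum => k /andP[k0 kK].
have := cayley_coef_ratio R (_ : (k < n)%N); rewrite (_ : (k < n)%N); last by lia.
move=> /(_ isT) ratio.
rewrite /J /join_average mulrAC -(average_linZ _ _ (average_cayley_sum R k)).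
apply: le_average => [|t]; first exact: average_cayley_sum.
apply: (@le_trans _ _ (limit_mean r (fun s => phi (join t s)) * cayley_coef R (n - k))).
  rewrite mulrC ler_wpM2l //.
  by apply: average_ge0 => //; exact: average_limit_mean.
by apply: IH => //; [nia|exact: depends_on_trunc_join].
Qed.

End limit_mean.

(** * The local topology and measurability *)

Section local_topology.
Variable R : realType.
Local Notation T := (loctree R).

(** Balls of radius e^(-r) are the sets of trees with a given truncation at r. *)
Lemma nbhs_loctree (t : T) (A : set T) :
  nbhs t A <-> exists r, forall s, trunc r t = trunc r s -> A s.
Proof.
split=> [/nbhs_ballP[e /= e0]|[r rA]].
  rewrite ballEmdist => eA.
  have [r re] : exists r, expR (- r%:R) < e.
    have [n] : exists n, e^-1 < n%:R.
      by exists (Num.truncn e^-1).+1; exact: truncnS_gt.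
    move=> en; exists n; rewrite expRN invf_plt ?posrE ?expR_gt0 //.
    apply: lt_le_trans en _; apply: le_trans (expR_ge1Dx _).
    by rewrite lerDr.
  exists r.+1 => s ts; apply: eA => /=.
  have : dloc t s <= expR (- r%:R) :> R.
    case: dlocP => [_|m ne _]; first exact: expR_ge0.
    rewrite ler_expR lerN2 ler_nat leqNgt; apply/negP => mr.
    by apply: ne; apply: trunc_le ts; lia.
  by move=> /le_lt_trans; exact.
apply/nbhs_ballP; exists (expR (- r%:R)); first exact: expR_gt0.
rewrite ballEmdist => s /= ts; apply: rA; apply: contrapT => /(@dloc_le R).
by rewrite leNgt => /negP; apply.
Qed.

Lemma open_depends_on_trunc r (A : T -> Prop) :
  depends_on_trunc r A -> open (A : set T).
Proof.
move=> dA; rewrite openE => t At; apply/nbhs_loctree; exists r => s ts.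
by rewrite -(dA t s).
Qed.

Lemma continuous_loctree (f : T -> R) : continuous f -> forall t e, 0 < e ->
  exists r, forall s, trunc r t = trunc r s -> `|f t - f s| <= e.
Proof.
move=> cf t e e0; apply/(nbhs_loctree t [set s | `|f t - f s| <= e]).
by have /cvgr_dist_le/(_ _ e0) := cf t.
Qed.

(** There are countably many truncated trees; this is what makes countable unions
sufficient for the measurability of the limit tree. *)
Lemma trunc_code : exists h : {fset seq nat} -> tree,
  forall r t, exists V, trunc r t = h V.
Proof.
exists (fun V => if pselect (exists t, verts t = [set` V]) is left e
  then tree_of (projT1 (cid e)) else leaf) => r t.
exists (fset_set (verts (wtrunc r (rep t)))).
case: pselect => [e|[]]; last first.
  by exists (wtrunc r (rep t)); rewrite fset_setK //; exact: level_finite.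
case: cid => s /= sE; congr tree_of; apply: wtree_eq.
by rewrite sE fset_setK //; exact: level_finite.
Qed.

Section measurability.
Context d (Om : measurableType d) (P : probability Om R).

Lemma open_preimage_measurable (S : topologicalType) (X : Om -> S) (f : S -> R) :
  (forall U : set S, open U -> measurable (X @^-1` U)) -> continuous f ->
  measurable_fun setT (f \o X).
Proof.
move=> mX cf; apply: (measurability _ (measurable_realfun.RGenOpens.measurableE R)).
move=> _ [_ [a [b ->] <-]].
rewrite setTI; apply: (mX (f @^-1` `]a, b[)); move/continuousP: cf; apply.
exact: interval_open.
Qed.

Lemma random_tree_depends r (X : Om -> T) (A : T -> Prop) : random_tree X ->
  depends_on_trunc r A -> measurable [set w | A (X w)].
Proof. by move=> mX dA; apply: (mX A); exact: open_depends_on_trunc dA. Qed.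

Lemma random_tree_eq (X : Om -> T) t : random_tree X ->
  measurable [set w | X w = t].
Proof.
move=> mX.
have -> : [set w | X w = t] = \bigcap_r [set w | trunc r (X w) = trunc r t].
  apply/seteqP; split => w /=; first by move=> e r _ /=; rewrite e.
  by move=> h; apply: trunc_sep => r; exact: h.
apply: bigcapT_measurable => r.
by apply: (@random_tree_depends r _ (fun s => trunc r s = trunc r t)) => // s s' ->.
Qed.

(** An open set is the increasing union over r of the sets of trees whose truncation
at r forces membership. *)
Lemma random_treeP (X : Om -> T) :
  (forall r (A : T -> Prop), depends_on_trunc r A -> measurable [set w | A (X w)]) ->
  random_tree X.
Proof.
move=> mX U oU.
have -> : X @^-1` U = \bigcup_r [set w | forall s, trunc r (X w) = trunc r s -> U s].
  apply/seteqP; split => w /=.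
    by move: oU; rewrite openE => h /h /nbhs_loctree[r rU]; exists r.
  by move=> [r _ /= h]; exact: h.
apply: bigcupT_measurable => r.
apply: (mX r (fun t => forall s, trunc r t = trunc r s -> U s)) => t s ts.
by rewrite ts.
Qed.

Definition branch_from (C : nat -> Om -> T) m w : T :=
  branch_with (fun n => C (m + n)%N w).

Lemma branch_fromS C m w :
  branch_from C m w = join (C m w) (branch_from C m.+1 w).
Proof.
rewrite /branch_from branch_with_join addn0; congr (join _ (branch_with _)).
by apply/funext => n; rewrite addnS.
Qed.

(** The topology of trees enters only through the truncations, for which the branch is
a function of the truncated first hanging tree (a countable choice) and of a shorter
part of the remaining branch. *)
Lemma random_tree_branch C m : (forall n, random_tree (C n)) ->
  random_tree (branch_from C m).
Proof.
move=> mC; apply: random_treeP => r; elim: r m => [|r IH] m A dA.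
  have [Al|Al] := pselect (A leaf).
    rewrite (_ : [set w | _] = setT) //; apply/seteqP; split => w //= _.
    by rewrite (depends_on_trunc0 _ dA).
  rewrite (_ : [set w | _] = set0) //; apply/seteqP; split => w //=.
  by rewrite (depends_on_trunc0 _ dA).
(* Only the truncation at r of the first hanging tree matters at level r + 1. *)
have [h hP] := trunc_code.
have -> : [set w | A (branch_from C m w)] = \bigcup_V
    ([set w | trunc r (C m w) = h V] `&`
     [set w | A (join (h V) (branch_from C m.+1 w))]).
  have AE t s : A (join t s) = A (join (trunc r t) s).
    by apply: dA; rewrite !trunc_join trunc_trunc.
  apply/seteqP; split => w /=; rewrite branch_fromS.
    have [V VE] := hP r (C m w) => Aw; exists V => //; split => //=.
    by rewrite -VE -AE.
  by move=> [V _ /= [VE]]; rewrite -VE -AE.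
apply: countable_bigcupT_measurable; first exact: countableP.
move=> V; apply: measurableI.
  by apply: (@random_tree_depends r _ (fun s => trunc r s = h V)) => // s s' ->.
by apply: (IH m.+1 (fun s => A (join (h V) s))); exact: depends_on_trunc_join.
Qed.

End measurability.
End local_topology.

(** * Expectations for Cayley trees *)

Section pieces.
Context d (Om : measurableType d) (R : realType) (P : probability Om R).
Local Open Scope ereal_scope.

(** Lower bounds only need disjoint pieces, not a partition: the missing mass is
recovered at the end from the total mass of [limit_mean]. *)
Lemma sum_pieces_le (I : eqType) (s : seq I) (F : I -> set Om) (D : set Om)
    (X : Om -> R) (a : I -> R) :
  uniq s -> trivIset [set` s] F -> (forall i, measurable (F i)) ->
  measurable D -> (forall i, i \in s -> F i `<=` D) ->
  measurable_fun setT X -> (forall w, (0 <= X w)%R) ->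
  (forall i, i \in s -> (a i)%:E <= \int[P]_(w in F i) (X w)%:E) ->
  (\sum_(i <- s) a i)%:E <= \int[P]_(w in D) (X w)%:E.
Proof.
move=> us tF mF mD FD mX X0 aF.
have mX' B : measurable_fun B (fun w => (X w)%:E).
  apply/measurable_EFinP; apply: measurable_funS mX => //.
apply: (@le_trans _ _ (\int[P]_(w in \big[setU/set0]_(i <- s) F i) (X w)%:E)).
  rewrite ge0_integral_bigsetU //; last by move=> w _; rewrite lee_fin.
  by rewrite -sumEFin big_seq [leRHS]big_seq; apply: lee_sum.
apply: ge0_subset_integral => //.
- exact: bigsetU_measurable.
- by move=> w _; rewrite lee_fin.
- by rewrite big_seq; elim/big_ind: _ => // A B AD BD; rewrite subUset.
Qed.

Lemma integral_on_const (D : set Om) (X : Om -> R) c : measurable D ->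
  (forall w, D w -> X w = c) -> \int[P]_(w in D) (X w)%:E = c%:E * P D.
Proof.
move=> mD Xc; rewrite -integral_cst //; apply: eq_integral => w.
by rewrite inE => /Xc ->.
Qed.

End pieces.

Section cayley_expectation.
Context d (Om : measurableType d) (R : realType) (P : probability Om R).
Variables (n : nat) (tau : Om -> lgraph 'I_n) (T : Om -> loctree R).
Hypotheses (n0 : (0 < n)%N) (tauP : uniform_tree P tau)
  (TP : random_cut_tree P tau T).

Let V : {fset 'I_n} := [fset x in enum 'I_n]%fset.

Let cardV : #|` V| = n.
Proof. by rewrite card_fseq undup_id ?enum_uniq // -cardE card_ord. Qed.

Lemma labelled_treesE g : (g \in labelled_trees n) = trees_on V g.
Proof.
rewrite inE; congr andb; apply/forallP/eqP => [h|-> x].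
  by apply/fsetP => x; rewrite h !inE mem_enum.
by rewrite !inE mem_enum.
Qed.

Lemma sum_labelled (phi : tree -> R) :
  \sum_(g in labelled_trees n) cut_average g phi = n.-1`!%:R * cayley_sum n phi.
Proof.
rewrite (eq_bigl _ _ labelled_treesE) sum_labelled_trees ?cardV //.
by rewrite -cardfs_gt0 cardV.
Qed.

Lemma card_labelled_trees :
  #|labelled_trees n|%:R = n.-1`!%:R * cayley_coef R n.
Proof.
rewrite -cayley_sum_const // -sum_labelled -sum1_card natr_sum.
apply: eq_bigr => g; rewrite labelled_treesE => /andP[_ /asboolP tg].
by rewrite cut_average1.
Qed.

(** The pieces fix the labelled tree and its cut-tree. *)
Lemma cayley_expectation_ge (phi : tree -> R) : (forall t, 0 <= phi t) ->
  measurable_fun setT (fun w => phi (T w)) ->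
  ((cayley_sum n phi / cayley_coef R n)%R%:E <= \int[P]_w (phi (T w))%:E)%E.
Proof.
move=> phi0 mphi; have [mT lawT] := TP.
have /choice[S SP] : forall g : lgraph 'I_n, exists S : seq tree, uniq S /\
    forall psi, cut_average g psi = \sum_(t <- S) cut_law R g t * psi t.
  move=> g; have [S uS SE] := average_indic (average_cut_average R g).
  by exists S.
pose s := [seq (g, t) | g <- enum (labelled_trees n), t <- S g].
pose F (q : lgraph 'I_n * tree) := [set w | tau w = q.1 /\ T w = q.2].
pose c : R := #|labelled_trees n|%:R.
have mF q : measurable (F q).
  rewrite (_ : F q = tau @^-1` [set q.1] `&` [set w | T w = q.2]) //.
  by apply: measurableI; [case: (tauP q.1)|exact: random_tree_eq].
suff -> : cayley_sum n phi / cayley_coef R n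
    = \sum_(q <- s) c^-1 * cut_law R q.1 q.2 * phi q.2.
  apply: (sum_pieces_le (F := F)) => //.
  - apply: allpairs_uniq_dep => [|g _|[g t] [g' t'] _ _ /= [-> ->]//].
      exact: enum_uniq.
    by case: (SP g).
  - by move=> [g t] [g' t'] _ _ [w [[/= e1 e2] [/= e3 e4]]]; rewrite -e1 -e2 e3 e4.
  move=> [g t] /allpairsPdep[g' [t' [gL _ [-> ->]]]].
  rewrite (integral_on_const P (c := phi t')) //=; last by move=> w [_ ->].
  rewrite [P _](lawT g' t') (tauP g').2; rewrite mem_enum in gL; rewrite gL.
  by rewrite -!EFinM lee_fin mulrC.
rewrite big_allpairs_dep big_enum /=.
under eq_bigr do (under eq_bigr do rewrite -mulrA; rewrite -mulr_sumr -(SP _).2).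
rewrite -mulr_sumr sum_labelled /c card_labelled_trees.
have y0 := lt0r_neq0 (cayley_coef_gt0 R n0).
by field; rewrite y0 fact_neq0.
Qed.

End cayley_expectation.

(** * Expectations for the limit tree *)

Lemma family_tree_rcons k u i :
  family_tree k (rcons u i) <-> family_tree k u /\ (i < k u)%N.
Proof.
split=> [h|[h iu] j].
  split=> [j ju|].
    have := h j; rewrite size_rcons nth_rcons ju -cats1 takel_cat ?(ltnW ju) //.
    by apply; exact: leqW.
  have := h (size u); rewrite size_rcons nth_rcons ltnn eqxx -cats1.
  by rewrite take_size_cat //; apply.
rewrite size_rcons ltnS leq_eqVlt => /orP[/eqP ->|ju].
  by rewrite nth_rcons ltnn eqxx -cats1 take_size_cat.
by rewrite nth_rcons ju -cats1 takel_cat ?h // ltnW.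
Qed.

(** A family tree is finite and equal to A exactly when each individual of A has the
number of children prescribed by A: the event is a cylinder in the offspring numbers. *)
Lemma family_treeP A k : plane_tree A ->
  graph_of (family_tree k) = plane_graph A <->
  forall u, u \in A -> k u = children A u.
Proof.
move=> tA; have [A0 Ap _] := tA; split=> [e|kA].
  have {}e : fset_set (family_tree k) = A by have := congr1 fst e.
  have fin : finite_set (family_tree k).
    apply: contrapT => inf; move: A0; rewrite -e.
    by rewrite /fset_set; case: pselect => // h; rewrite inE.
  have memA u : (u \in A) <-> family_tree k u.
    by rewrite -e in_fset_set // inE.
  move=> u /memA ku; apply/esym/children_eq => i; apply/idP/idP.
    by move=> /memA/family_tree_rcons[].
  by move=> ik; apply/memA/family_tree_rcons.
rewrite -graph_of_fset; congr graph_of; apply/seteqP.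
have : forall u, family_tree k u <-> u \in A.
  elim/last_ind => [|u i IH]; first by split.
  split=> [/family_tree_rcons[/IH uA]|uiA].
    by rewrite kA // mem_rcons_children.
  have uA := Ap _ _ uiA.
  by apply/family_tree_rcons; split; [exact/IH|rewrite kA // -mem_rcons_children].
by move=> h; split => u /h.
Qed.

Section galton_watson.
Context d (Om : measurableType d) (R : realType) (P : probability Om R).
Variables (K : nat -> seq nat -> {RV P >-> nat})
  (theta : nat -> Om -> lgraph (seq nat)) (C : nat -> Om -> loctree R).
Hypotheses
  (K_indep : mutually_independent P (fun (nu : nat * seq nat) w => K nu.1 nu.2 w))
  (K_law : forall n u k, P (K n u @^-1` [set k]) = (poisson_pmf 1 k)%:E)
  (thetaE : forall n w, theta n w = graph_of (family_tree (fun u => K n u w)))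
  (C_law : random_cut_trees P theta C).

Definition gw_weight A : R := expR (- #|` A|%:R) * plane_weight R A.

Definition prefix_event m (A : nat -> {fset seq nat}) (t : nat -> tree) : set Om :=
  [set w | forall i, (i < m)%N -> theta i w = plane_graph (A i) /\ C i w = t i].

Definition prefix_weight m (A : nat -> {fset seq nat}) (t : nat -> tree) : R :=
  \prod_(i < m) (gw_weight (A i) * cut_law R (plane_graph (A i)) (t i)).

Lemma theta_eqE i A w : plane_tree A ->
  theta i w = plane_graph A <-> forall u, u \in A -> K i u w = children A u.
Proof. by move=> tA; rewrite thetaE; exact: family_treeP. Qed.

Lemma measurable_theta i A : plane_tree A ->
  measurable [set w | theta i w = plane_graph A].
Proof.
move=> tA.
have -> : [set w | theta i w = plane_graph A]
    = \bigcap_(u in [set` A]) (K i u @^-1` [set children A u]).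
  by apply/seteqP; split => w /= /theta_eqE; apply.
apply: fin_bigcap_measurable; first exact: finite_fset.
by move=> u _; exact: measurable_funPTI.
Qed.

Lemma measurable_prefix_event m A t : (forall i, (i < m)%N -> plane_tree (A i)) ->
  measurable (prefix_event m A t).
Proof.
move=> tA.
have -> : prefix_event m A t = \bigcap_(i in `I_m)
    ([set w | theta i w = plane_graph (A i)] `&` [set w | C i w = t i]).
  by [].
apply: fin_bigcap_measurable; first exact: finite_II.
move=> i /= im; apply: measurableI; first by apply: measurable_theta; exact: tA.
apply: random_tree_eq; exact: C_law.1.
Qed.

(** The prescribed offspring numbers of the first m trees are finitely many, so
independence gives the product of the Poisson weights. *)
Lemma theta_law m A : (forall i, (i < m)%N -> plane_tree (A i)) ->
  P [set w | forall i, (i < m)%N -> theta i w = plane_graph (A i)]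
  = (\prod_(i < m) gw_weight (A i))%:E.
Proof.
move=> tA.
pose s : seq (nat * seq nat) := [seq (i, u) | i <- iota 0 m, u <- A i].
have us : uniq s.
  apply: allpairs_uniq_dep => [|i _|[i u] [j v] _ _ /= [-> ->]//].
    exact: iota_uniq.
  exact: fset_uniq.
have mB (nu : nat * seq nat) : measurable [set children (A nu.1) nu.2].
  by [].
have := K_indep [fset nu in s]%fset mB.
have -> : [set w | forall nu, nu \in [fset nu in s]%fset ->
      [set children (A nu.1) nu.2] (K nu.1 nu.2 w)]
    = [set w | forall i, (i < m)%N -> theta i w = plane_graph (A i)].
  apply/seteqP; split => w /= h.
    move=> i im; apply/theta_eqE; first exact: tA.
    move=> u uA; apply: (h (i, u)); rewrite inE /=.
    by apply/allpairsPdep; exists i, u; rewrite mem_iota.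
  move=> [i u]; rewrite inE /= => /allpairsPdep[j [v [jm vA [-> ->]]]].
  move: jm; rewrite mem_iota add0n /= => jm.
  by have /theta_eqE := h j jm; apply => //; exact: tA.
move=> ->; under eq_bigr do rewrite K_law.
rewrite prodEFin; congr (_%:E).
rewrite (perm_big s) /=; last first.
  by apply: uniq_perm => // [|nu]; rewrite ?fset_uniq // inE.
rewrite big_allpairs_dep /= -[X in iota 0 X]subn0 big_mkord.
apply: eq_bigr => i _; rewrite /gw_weight /plane_weight.
have -> : expR (- #|` A i|%:R) = \prod_(u <- A i) expR (-1) :> R.
  by rewrite big_const_seq count_predT iter_mulr_1 -expRM_natr mulN1r.
rewrite -big_split /=; apply: eq_bigr => u _.
by rewrite /poisson_pmf ltr01 expr1n mul1r mulrC.
Qed.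

Lemma prefix_event_law m A t : (forall i, (i < m)%N -> plane_tree (A i)) ->
  P (prefix_event m A t) = (prefix_weight m A t)%:E.
Proof.
move=> tA; have [_ lawC] := C_law.
have := lawC [fset i in iota 0 m]%fset (fun i => plane_graph (A i)) t.
have memE i : (i \in [fset i in iota 0 m]%fset) = (i < m)%N.
  by rewrite inE /= mem_iota.
have -> : [set w | forall i, i \in [fset i in iota 0 m]%fset ->
    theta i w = plane_graph (A i) /\ C i w = t i] = prefix_event m A t.
  by apply/seteqP; split => w /= h i; [rewrite -memE|rewrite memE]; exact: h.
have -> : [set w | forall i, i \in [fset i in iota 0 m]%fset ->
      theta i w = plane_graph (A i)]
    = [set w | forall i, (i < m)%N -> theta i w = plane_graph (A i)].
  by apply/seteqP; split => w /= h i; [rewrite -memE|rewrite memE]; exact: h.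
move=> ->; rewrite theta_law // -EFinM; congr (_%:E).
rewrite (perm_big (iota 0 m)) /=; last first.
  by apply: uniq_perm => [||i]; rewrite ?fset_uniq ?iota_uniq // inE.
by rewrite -[X in iota 0 X]subn0 big_mkord -big_split.
Qed.

(** Induction on r, for all m at once: on the event that fixes the first m hanging
trees, split according to the next family tree, of size at most k, and its cut-tree.
The branch is then the join of a known tree with the branch from m + 1, and the sum
over the family trees is [plane_sum]. *)
Lemma branch_expectation_ge k r m A t (phi : tree -> R) :
  (forall i, (i < m)%N -> plane_tree (A i)) -> (forall s, 0 <= phi s) ->
  depends_on_trunc r phi ->
  ((prefix_weight m A t * limit_mean k r phi)%R%:E
    <= \int[P]_(w in prefix_event m A t) (phi (branch_from C m w))%:E)%E.
Proof.
have mC := C_law.1.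
elim: r m A t phi => [|r IH] m A t phi tA phi0 dphi.
  rewrite (integral_on_const P (c := phi leaf)).
  - by rewrite prefix_event_law // -EFinM lee_fin mulrC.
  - exact: measurable_prefix_event.
  - by move=> w _; exact: depends_on_trunc0.
have /choice[S SP] : forall B : {fset seq nat}, exists S : seq tree, uniq S /\
    forall psi, cut_average (plane_graph B) psi
      = \sum_(s <- S) cut_law R (plane_graph B) s * psi s.
  move=> B; have [S uS SE] := average_indic (average_cut_average R (plane_graph B)).
  by exists S.
pose I := ({fset seq nat} * tree)%type.
pose pieces := [seq q | j <- index_iota 1 k.+1,
  q <- [seq ((B, s) : I) | B <- plane_trees j, s <- S B]].
have upieces : uniq pieces.
  apply: (uniq_allpairs_by (f := fun q : I => #|` q.1|)) => [|j|j [B s]].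
  - exact: iota_uniq.
  - apply: allpairs_uniq_dep => [|B _|[B s] [B' s'] _ _ /= [-> ->]//].
      exact: fset_uniq.
    by case: (SP B).
  - by move=> /allpairsPdep[B' [s' [/plane_treesP[_ <-] _ [-> _]]]].
pose upd (T' : Type) (f : nat -> T') b i := if i == m then b else f i.
(* The empty set when q.1 is not a plane tree, so that F q is always measurable. *)
pose F (q : I) := if `[< plane_tree q.1 >]
  then prefix_event m.+1 (upd _ A q.1) (upd _ t q.2) else set0.
have tU B : plane_tree B -> forall i, (i < m.+1)%N -> plane_tree (upd _ A B i).
  by move=> tB i; rewrite /upd ltnS leq_eqVlt; case: eqP => //= _; exact: tA.
have mF q : measurable (F q).
  rewrite /F; case: asboolP => // tq; apply: measurable_prefix_event; exact: tU.
have FE q w : F q w -> [/\ prefix_event m A t w, plane_tree q.1,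
    theta m w = plane_graph q.1 & C m w = q.2].
  rewrite /F; case: asboolP => // tq h; split => //.
  - by move=> i im; have := h i (ltnW im); rewrite /upd (ltn_eqF im).
  - by have [] := h m (ltnSn m); rewrite /upd eqxx.
  - by have [] := h m (ltnSn m); rewrite /upd eqxx.
pose a (q : I) := prefix_weight m A t *
  (gw_weight q.1 * cut_law R (plane_graph q.1) q.2) *
  limit_mean k r (fun s => phi (join q.2 s)).
suff <- : \sum_(q <- pieces) a q = prefix_weight m A t * limit_mean k r.+1 phi.
  apply: (sum_pieces_le (F := F)) => //.
  - move=> [B s] [B' s'] _ _ [w [/FE[/= _ _ e1 e2] /FE[/= _ _ e3 e4]]].
    have := congr1 fst (etrans (esym e1) e3); rewrite /= => ->.
    by rewrite -e2 e4.
  - exact: measurable_prefix_event.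
  - by move=> q _ w /FE[].
  - have mX := random_tree_branch m mC.
    move=> _ B mB; rewrite setTI.
    apply: (random_tree_depends (r := r.+1) (A := fun s => B (phi s)) mX).
    by move=> s s' e; rewrite (dphi s s').
  move=> q /allpairsPdep[j [q' [_ + e]]]; rewrite -e => {e q'}.
  move=> /allpairsPdep[B [s [/plane_treesP[tB _] _ ->]]].
  rewrite (_ : \int[P]_(w in F (B, s)) (phi (branch_from C m w))%:E =
    \int[P]_(w in F (B, s)) (phi (join s (branch_from C m.+1 w)))%:E)%E; last first.
    apply: eq_integral => w; rewrite inE => /FE[_ _ _ /= e].
    by rewrite branch_fromS e.
  rewrite /F asboolT //= /a /=.
  have -> : prefix_weight m A t * (gw_weight B * cut_law R (plane_graph B) s)
      = prefix_weight m.+1 (upd _ A B) (upd _ t s).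
    rewrite /prefix_weight big_ord_recr /= /upd eqxx; congr (_ * _).
    by apply: eq_bigr => i _; rewrite (ltn_eqF (ltn_ord i)).
  apply: IH => //; first exact: tU.
  exact: depends_on_trunc_join.
rewrite big_allpairs_dep /= mulr_sumr big_nat [RHS]big_nat.
apply: eq_bigr => j /andP[j0 _]; rewrite big_allpairs_dep.
rewrite /join_average -plane_sumE // /plane_sum !mulr_sumr.
rewrite big_seq [RHS]big_seq; apply: eq_bigr => B /plane_treesP[_ Bj].
rewrite (SP B).2 !mulr_sumr; apply: eq_bigr => s _.
by rewrite /a /gw_weight /= Bj; ring.
Qed.

End galton_watson.

(** * Comparison of the expectations *)

(** Bernoulli's inequality. *)
Lemma borel_mass_expr (R : realType) r (e : R) : 0 < e ->
  exists K, 1 - e <= borel_mass R K ^+ r.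
Proof.
move=> e0; pose c := Num.min 1 (e / r.+1%:R).
have c0 : 0 < c by rewrite lt_min ltr01 divr_gt0.
have [K Kc] := borel_mass_cvg c0; exists K.
have s0 := borel_mass_ge0 R K; move: (borel_mass R K) s0 Kc => s s0 sc.
have c1 : c <= 1 by rewrite ge_min lexx.
have bern k : 1 - k%:R * c <= s ^+ k.
  elim: k => [|k IH]; first by rewrite mul0r subr0 expr0.
  have [kc|kc] := leP (k%:R * c) 1.
    have h : (1 - c) * (1 - k%:R * c) <= s * s ^+ k.
      by apply: ler_pM => //; [rewrite subr_ge0|rewrite subr_ge0|exact: ltW].
    rewrite exprS; apply: le_trans h; rewrite -natr1.
    have : 0 <= k%:R * c * c by rewrite !mulr_ge0 // ltW.
    by nra.
  apply: (@le_trans _ _ 0); last by rewrite exprn_ge0.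
  by rewrite subr_le0 -natr1 mulrDl; lra.
apply: le_trans (bern r); rewrite lerD2l lerN2.
have : c <= e / r.+1%:R by rewrite ge_min lexx orbT.
rewrite ler_pdivlMr // mulrC -natr1; nra.
Qed.

Section lower_envelope.
Variables (R : realType) (f : loctree R -> R) (B : R).
Hypotheses (cf : continuous f) (f0 : forall t, 0 <= f t) (fB : forall t, f t <= B).

(** The largest minorant of f that depends only on the truncation at r. *)
Definition lower_env r (t : tree) : R :=
  inf [set f s | s in [set s | trunc r t = trunc r s]].

Let has_inf_env r t : has_inf [set f s | s in [set s | trunc r t = trunc r s]].
Proof.
by split; [exists (f t), t|exists 0 => _ [s _ <-]].
Qed.

Lemma lower_env_le r t : lower_env r t <= f t.
Proof. by apply: ge_inf; [case: (has_inf_env r t)|exists t]. Qed.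

Lemma lower_env_ge r t c : (forall s, trunc r t = trunc r s -> c <= f s) ->
  c <= lower_env r t.
Proof.
move=> h; apply: lb_le_inf; first by case: (has_inf_env r t).
by move=> _ [s /h cs <-].
Qed.

Lemma lower_env_ge0 r t : 0 <= lower_env r t.
Proof. exact: lower_env_ge. Qed.

Lemma lower_env_depends r : depends_on_trunc r (lower_env r).
Proof. by move=> t s ts; rewrite /lower_env ts. Qed.

Lemma lower_env_cvg t : lower_env r t @[r --> \oo] --> f t.
Proof.
apply/cvgrPdist_le => e e0; have [r0 h] := continuous_loctree cf t e0.
exists r0 => // r /= rr; rewrite ger0_norm ?subr_ge0 ?lower_env_le //.
rewrite lerBlDl -lerBlDr; apply: lower_env_ge => s /(trunc_le rr)/h.
by rewrite ler_norml => /andP[_]; rewrite lerBlDl addrC -lerBlDl; lra.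
Qed.

End lower_envelope.

Section bounded_integral.
Context d (Om : measurableType d) (R : realType) (P : probability Om R).

Lemma bounded_integrable (X : Om -> R) M : measurable_fun setT X ->
  (forall w, `|X w| <= M) -> P.-integrable setT (EFin \o X).
Proof.
move=> mX XM; apply: measurable_bounded_integrable => //.
  by rewrite (le_lt_trans (probability_le1 P measurableT)) // ltry.
exists M; split; first exact: num_real.
by move=> x Mx w _ /=; rewrite (le_trans (XM w)) // ltW.
Qed.

Lemma EFin_Rintegral (X : Om -> R) : P.-integrable setT (EFin \o X) ->
  (\int[P]_w (X w)%:E)%E = (\int[P]_w X w)%R%:E.
Proof. by move=> iX; rewrite /Rintegral fineK //; exact: integrable_fin_num. Qed.

Lemma Rintegral_prob_cst c : (\int[P]_w c)%R = c.
Proof. by rewrite Rintegral_cst // [X in fine X]probability_setT mulr1. Qed.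

End bounded_integral.

Section lower_bound.
Variables (R : realType)
    (d : nat -> measure_display) (Om : forall n, measurableType (d n))
    (P : forall n, probability (Om n) R)
    (tau : forall n, Om n -> lgraph 'I_n) (T : forall n, Om n -> loctree R)
    (d' : measure_display) (Om' : measurableType d') (P' : probability Om' R)
    (K : nat -> seq nat -> {RV P' >-> nat})
    (theta : nat -> Om' -> lgraph (seq nat))
    (C : nat -> Om' -> loctree R).
Hypotheses
  (tauP : forall n, (1 <= n)%N -> uniform_tree (P n) (@tau n))
  (TP : forall n, (1 <= n)%N -> random_cut_tree (P n) (@tau n) (@T n))
  (K_indep : mutually_independent P' (fun (nu : nat * seq nat) w => K nu.1 nu.2 w))
  (K_law : forall n u k, P' (K n u @^-1` [set k]) = (poisson_pmf 1 k)%:E)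
  (thetaE : forall n w, theta n w = graph_of (family_tree (fun u => K n u w)))
  (C_law : random_cut_trees P' theta C).

Let Tinf := branch_from C 0.

Lemma random_tree_Tinf : random_tree Tinf.
Proof. by apply: random_tree_branch; exact: C_law.1. Qed.

Lemma depends_measurable d1 (Om1 : measurableType d1) (X : Om1 -> loctree R) r
    (phi : tree -> R) : random_tree X -> depends_on_trunc r phi ->
  measurable_fun setT (fun w => phi (X w)).
Proof.
move=> mX dphi _ A mA; rewrite setTI.
apply: (random_tree_depends (r := r) (A := fun s => A (phi s)) mX) => s s' e.
by rewrite (dphi s s').
Qed.

(** The lower bound of [branch_expectation_ge] for B - phi is an upper bound for phi, up
to the mass missing from [limit_mean]. *)
Lemma Tinf_expectation_le k r (phi : tree -> R) B :
  (forall t, 0 <= phi t) -> (forall t, phi t <= B) -> depends_on_trunc r phi ->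
  \int[P']_w phi (Tinf w) <= B * (1 - borel_mass R k ^+ r) + limit_mean k r phi.
Proof.
move=> phi0 phiB dphi.
have aL := average_limit_mean R k r.
have := @branch_expectation_ge _ _ _ _ _ _ _ K_indep K_law thetaE C_law k r 0
  (fun=> fset0) (fun=> leaf) (fun t => B - phi t).
have -> : prefix_event theta C 0 (fun=> fset0) (fun=> leaf) = setT.
  by apply/seteqP; split.
rewrite /prefix_weight big_ord0 mul1r average_linB //.
rewrite (eq_average aL (psi := fun=> B * 1)); last by move=> t; rewrite mulr1.
rewrite average_linZ // limit_mean_const -/Tinf.
have mphi := depends_measurable random_tree_Tinf dphi.
have iphi : P'.-integrable setT (EFin \o (fun w => phi (Tinf w))).
  by apply: (@bounded_integrable _ _ _ _ _ B) => // w; rewrite ger0_norm.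
have iB : P'.-integrable setT (EFin \o (fun=> B)).
  by apply: (@bounded_integrable _ _ _ _ _ `|B|).
have iBphi : P'.-integrable setT (EFin \o (fun w => B - phi (Tinf w))).
  apply: (@bounded_integrable _ _ _ _ _ B) => [|w].
    by apply: measurable_funB => //; exact: measurable_cst.
  by rewrite ger0_norm ?subr_ge0 // lerBlDl lerDr.
rewrite EFin_Rintegral // lee_fin RintegralB // Rintegral_prob_cst.
move=> h; have {h} : B * borel_mass R k ^+ r - limit_mean k r phi <=
    B - \int[P']_w phi (Tinf w).
  apply: h => [//|t|t s ts]; first by rewrite subr_ge0.
  by rewrite (dphi t s).
lra.
Qed.

(** The lower semicontinuous half of the convergence: replace f by its minorant at a
level r that nearly preserves the expectation in the limit, then compare both
expectations of the minorant with [limit_mean]. *)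
Lemma expectation_lower_bound (f : loctree R -> R) B e : continuous f ->
  (forall t, 0 <= f t) -> (forall t, f t <= B) -> 0 < e ->
  \forall n \near \oo,
    \int[P']_w f (Tinf w) - e <= \int[P n]_w f (T w).
Proof.
move=> cf f0 fB e0.
have B0 : 0 <= B by exact: le_trans (f0 leaf) (fB leaf).
have fN t : `|f t| <= B by rewrite ger0_norm.
pose g := lower_env f.
have g0 r t : 0 <= g r t by exact: lower_env_ge0.
have gf r t : g r t <= f t by exact: lower_env_le.
have gB r t : g r t <= B by exact: le_trans (fB t).
have gN r t : `|g r t| <= B by rewrite ger0_norm.
have dg r : depends_on_trunc r (g r) by exact: lower_env_depends.
have mg r := depends_measurable random_tree_Tinf (dg r).
have ig r : P'.-integrable setT (EFin \o (fun w => g r (Tinf w))).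
  exact: (@bounded_integrable _ _ _ _ _ B).
have [r gr] : exists r, \int[P']_w f (Tinf w) - e / 2 <= \int[P']_w g r (Tinf w).
  have mf : measurable_fun setT (f \o Tinf).
    by apply: open_preimage_measurable => //; exact: random_tree_Tinf.
  have if_ : P'.-integrable setT (EFin \o (fun w => f (Tinf w))).
    exact: (@bounded_integrable _ _ _ _ _ B).
  have : (\int[P']_w (g r (Tinf w))%:E)%E @[r --> \oo] -->
      (\int[P']_w (f (Tinf w))%:E)%E.
    apply: (@dominated_cvg _ _ _ P' setT _ (fun r w => (g r (Tinf w))%:E)
      (fun w => (f (Tinf w))%:E) (cst B%:E)) => //.
    - by move=> r; apply/measurable_EFinP; exact: mg.
    - move=> w _; apply: cvg_EFin; first by near=> r.
      exact: lower_env_cvg.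
    - exact: (@bounded_integrable _ _ _ P' (fun=> B) `|B|).
    - by move=> r w _; rewrite lee_fin.
  rewrite EFin_Rintegral // => /fine_cvg /cvgrPdist_le/(_ (e / 2)).
  case=> [|r _ /(_ r (leqnn r))]; first by rewrite divr_gt0.
  rewrite /= ler_norml => /andP[_ h]; exists r.
  move: h; rewrite EFin_Rintegral //=; lra.
have eB : 0 < e / (2 * (B + 1)) by rewrite divr_gt0 // mulr_gt0 // ltr_wpDl.
have [k sk] := borel_mass_expr r eB.
exists (r.+2 * k).+1 => // n /= rn; have n0 : (1 <= n)%N by lia.
have y0 := cayley_coef_gt0 R n0.
have mT := (TP n0).1.
have mgT := depends_measurable mT (dg r).
have mfT : measurable_fun setT (@f \o @T n) by exact: open_preimage_measurable.
have igT : (P n).-integrable setT (EFin \o (fun w => g r (@T n w))).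
  exact: (@bounded_integrable _ _ _ _ _ B).
have ifT : (P n).-integrable setT (EFin \o (fun w => f (@T n w))).
  exact: (@bounded_integrable _ _ _ _ _ B).
have h1 := Tinf_expectation_le k (g0 r) (gB r) (dg r).
have h2 : limit_mean k r (g r) <= cayley_sum n (g r) / cayley_coef R n.
  by rewrite ler_pdivlMr //; exact: limit_mean_le.
have h3 := cayley_expectation_ge n0 (tauP n0) (TP n0) (g0 r) mgT.
rewrite EFin_Rintegral // lee_fin in h3.
have h4 := le_Rintegral measurableT igT ifT (fun w _ => gf r (@T n w)).
have h5 : B * (1 - borel_mass R k ^+ r) <= e / 2.
  apply: (@le_trans _ _ ((B + 1) * (e / (2 * (B + 1))))).
    apply: (@le_trans _ _ (B * (e / (2 * (B + 1))))).
      by rewrite ler_wpM2l //; lra.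
    by rewrite ler_pM2r //; lra.
  have -> : (B + 1) * (e / (2 * (B + 1))) = e / 2 by field; lra.
  exact: lexx.
lra.
Unshelve. all: by end_near.
Qed.

End lower_bound.

Theorem proposition5p9 (R : realType)
    (d : nat -> measure_display) (Om : forall n, measurableType (d n))
    (P : forall n, probability (Om n) R)
    (tau : forall n, Om n -> lgraph 'I_n) (T : forall n, Om n -> loctree R)
    (d' : measure_display) (Om' : measurableType d') (P' : probability Om' R)
    (K : nat -> seq nat -> {RV P' >-> nat})
    (theta : nat -> Om' -> lgraph (seq nat))
    (C : nat -> Om' -> loctree R) (Tinf : Om' -> loctree R) :
  (forall n, (1 <= n)%N -> uniform_tree (P n) (@tau n)) ->
  (forall n, (1 <= n)%N -> random_cut_tree (P n) (@tau n) (@T n)) ->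
  mutually_independent P' (fun (nu : nat * seq nat) w => K nu.1 nu.2 w) ->
  (forall n u k, P' (K n u @^-1` [set k]) = (poisson_pmf 1 k)%:E) ->
  (forall n w, theta n w = graph_of (family_tree (fun u => K n u w))) ->
  random_cut_trees P' theta C ->
  (forall w, Tinf w = branch_with (fun n => C n w)) ->
  cvg_in_distribution P T P' Tinf.
Proof.
move=> tauP TP K_indep K_law thetaE C_law TinfE f cf [M fM].
have M0 : 0 <= M by exact: le_trans (fM leaf).
have -> : Tinf = branch_from C 0 by apply/funext => w; rewrite TinfE.
have mTinf := random_tree_Tinf C_law.
have lower := expectation_lower_bound tauP TP K_indep K_law thetaE C_law.
have ifT d1 (Om1 : measurableType d1) (P1 : probability Om1 R)
    (X : Om1 -> loctree R) : random_tree X ->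
    P1.-integrable setT (EFin \o (fun w => f (X w))).
  move=> mX; apply: (@bounded_integrable _ _ _ _ _ M) => //.
  exact: (open_preimage_measurable mX cf).
have ic d1 (Om1 : measurableType d1) (P1 : probability Om1 R) :
    P1.-integrable setT (EFin \o (fun=> M)).
  by apply: (@bounded_integrable _ _ _ _ _ `|M|).
rewrite unlock EFin_Rintegral; last exact: ifT.
apply: cvg_EFin.
  near=> n; rewrite EFin_Rintegral //; apply: ifT.
  by have n1 : (1 <= n)%N by [near: n; exists 1%N]; exact: (TP n n1).1.
apply/cvgrPdist_le => e e0.
have fle t : - M <= f t <= M by rewrite -ler_norml.
have l1 : \forall n \near \oo,
    \int[P']_w (M + f (branch_from C 0 w)) - e <= \int[P n]_w (M + f (@T n w)).
  apply: (lower (fun t => M + f t) (M + M)) => // [t|t|t].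
  - by apply: (@continuousD _ _ _ (fun=> M) f); [exact: cst_continuous|exact: cf].
  - by have /andP[] := fle t; lra.
  - by have /andP[] := fle t; lra.
have l2 : \forall n \near \oo,
    \int[P']_w (M - f (branch_from C 0 w)) - e <= \int[P n]_w (M - f (@T n w)).
  apply: (lower (fun t => M - f t) (M + M)) => // [t|t|t].
  - by apply: (@continuousB _ _ _ (fun=> M) f); [exact: cst_continuous|exact: cf].
  - by have /andP[] := fle t; lra.
  - by have /andP[] := fle t; lra.
near=> n.
have n1 : (1 <= n)%N by near: n; exists 1%N.
have mT := (TP n n1).1.
have h1 : \int[P']_w (M + f (branch_from C 0 w)) - e <= \int[P n]_w (M + f (@T n w)).
  by near: n; exact: l1.
have h2 : \int[P']_w (M - f (branch_from C 0 w)) - e <= \int[P n]_w (M - f (@T n w)).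
  by near: n; exact: l2.
rewrite RintegralD // in h1; try exact: ifT; try exact: ic.
rewrite RintegralD // in h1; try exact: ifT; try exact: ic.
rewrite RintegralB // in h2; try exact: ifT; try exact: ic.
rewrite RintegralB // in h2; try exact: ifT; try exact: ic.
rewrite !Rintegral_prob_cst in h1 h2.
rewrite /= EFin_Rintegral; last exact: ifT.
rewrite /= ler_norml; apply/andP; split; lra.
Unshelve. all: by end_near.
Qed.
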